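(* Let $\mu$ be a finite positive (Borel) measure on $\mathbb{T}=\mathbb{R}/\mathbb{Z}$ with infinite support. Let $f := [d\mu/d\lambda]$ be the Radon-Nikodým derivative of the absolutely continuous part of $\mu$ with respect to $\lambda$, and let $\varphi_f$ be the associated function defined in the context. Let $r \ge 0$ be an integer. Given any functions $f_0,\ldots,f_r,g_0,\ldots,g_r \in L^2(\mu)$, let $F_j := P_{H^2}(f_j\overline{\varphi_f})$ and $G_j := P_{H^2}(g_j\overline{\varphi_f})$ for $0\le j\le r$. For $n\ge 1$ and $-n\le j\le r$ define $$p_j := \begin{cases} f_j & \text{if } 0\le j\le r,\\ e_j & \text{if } -n\le j\le -1,\end{cases}\qquad q_j := \begin{cases} g_j & \text{if } 0\le j\le r,\\ e_j & \text{if } -n\le j\le -1.\end{cases}$$ Then $$\lim_{n\to\infty} D_{n-1}(\mu)^{-1}\det\left[\int p_j\overline{q_k}\,d\mu\right]_{-n\le j,k\le r} = \det\left[\int F_j\overline{G_k}\,d\lambda\right]_{0\le j,k\le r}.$$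
   Context: $\lambda$ is Lebesgue measure on the unit-length circle $\mathbb{T}=\mathbb{R}/\mathbb{Z}$, and $e_n(t) := e^{2\pi i n t}$ for $n\in\mathbb{Z}$. Fourier coefficients: $\widehat\mu(n) := \int_{\mathbb{T}} e^{-2\pi i n t}\,d\mu(t)$, and for $g\in L^1(\lambda)$, $\widehat g(n) := \int_{\mathbb{T}} g\,\overline{e_n}\,d\lambda$. For $n\ge 0$, $D_n(\mu) := \det[\widehat\mu(k-j)]_{0\le j,k\le n}$. $H^2(\mathbb{T})$ is the Hardy space of those $g\in L^2(\lambda)$ with $\widehat g(n)=0$ for all $n<0$, and $P_{H^2}$ is the orthogonal projection from $L^2(\lambda)$ onto $H^2(\mathbb{T})$. For $f\ge 0$ with $\log f\in L^1(\lambda)$, define for $|z|<1$ $$\Phi_f(z) := \exp\left(\frac12\int_{\mathbb{T}}\frac{e_1(t)+z}{e_1(t)-z}\log f(t)\,d\lambda(t)\right),$$ and $\varphi_f(t) := \lim_{r\uparrow 1}\Phi_f(r e_1(t))$, which exists for $\lambda$-a.e. $t$ and satisfies $|\varphi_f|^2=f$ $\lambda$-a.e. If $\log f\notin L^1(\lambda)$, define $\varphi_f := 0$ (the zero function), in which case all $F_j$ and $G_j$ are $0$. (When $\log f\in L^1(\lambda)$, $f>0$ $\lambda$-a.e., so $f_j,g_j$ are well defined $\lambda$-a.e. and $f_j\overline{\varphi_f}, g_j\overline{\varphi_f}\in L^2(\lambda)$.) *)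

(* Defs.v *)
From HB Require Import structures.
From mathcomp Require Import all_boot all_order all_algebra.
From mathcomp Require Import all_classical all_reals all_analysis.
From mathcomp Require Import measurable_realfun charge.
From mathcomp Require Import generic_quotient.
From mathcomp Require Import complex.

Set Implicit Arguments.
Unset Strict Implicit.
Unset Printing Implicit Defensive.

Import Order.TTheory GRing.Theory Num.Theory.
Import numFieldNormedType.Exports.

Local Open Scope classical_set_scope.
Local Open Scope ring_scope.
Local Open Scope complex_scope.
Local Open Scope charge_scope.

Section circle_equiv.
Context (R : realType).

Definition circle_equiv (x y : R) : bool := x - y \is a Num.int.

Lemma circle_equiv_is_equiv : equiv_class_of circle_equiv.
Proof.
split=> [x|x y|y x z]; rewrite /circle_equiv.
- by rewrite subrr rpred0.
- by rewrite -opprB rpredN.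
- by move=> xy yz; rewrite -[x](addrNK y) -addrA rpredD.
Qed.

Canonical circle_equiv_equiv := EquivRelPack circle_equiv_is_equiv.
Canonical circle_equiv_encModRel := defaultEncModRel circle_equiv.
End circle_equiv.

(* R/Z with the quotient topology and its Borel sigma-algebra. *)
Definition circle (R : realType) : Type :=
  quotient_topology {eq_quot @circle_equiv R}%qT.
HB.instance Definition _ (R : realType) := Quotient.on (circle R).
HB.instance Definition _ (R : realType) := PointedTopological.on (circle R).

Definition circle_open (R : realType) : set (set (circle R)) := [set U | open U].

HB.instance Definition _ (R : realType) :=
  Measurable.copy (circle R) (g_sigma_algebraType (@circle_open R)).

Definition circle_pi (R : realType) (x : measurableTypeR R) : circle R :=
  (\pi_(circle R) x)%qT.

Lemma measurable_circle_pi (R : realType) :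
  measurable_fun [set: measurableTypeR R] (@circle_pi R).
Proof.
apply: (@measurability _ _ _ _ setT (@circle_pi R) (@circle_open R)) => //.
move=> _ [U oU <-]; rewrite setTI.
exact: (@open_measurable R _ oU).
Qed.

HB.instance Definition _ (R : realType) :=
  isMeasurableFun.Build _ _ _ _ (@circle_pi R) (@measurable_circle_pi R).

Section circle_lebesgue.
Context (R : realType).

Definition circle_lebesgue : set (circle R) -> \bar R :=
  pushforward
    (mrestr (@lebesgue_measure R) (measurable_itv `[0%R, 1%R[))
    (@circle_pi R).

Let circle_lebesgue0 : circle_lebesgue set0 = 0%E.
Proof. by rewrite /circle_lebesgue /pushforward preimage_set0 measure0. Qed.

Let circle_lebesgue_ge0 A : (0 <= circle_lebesgue A)%E.
Proof. exact: measure_ge0. Qed.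

Let circle_lebesgue_sigma_additive : semi_sigma_additive circle_lebesgue.
Proof. exact: measure_semi_sigma_additive. Qed.

HB.instance Definition _ := isMeasure.Build _ _ _ circle_lebesgue
  circle_lebesgue0 circle_lebesgue_ge0 circle_lebesgue_sigma_additive.

Lemma circle_lebesgue_setT : circle_lebesgue setT = 1%E.
Proof.
rewrite /circle_lebesgue /pushforward preimage_setT /mrestr setTI.
by rewrite lebesgue_measure_itv /= lte_fin ltr01 sube0.
Qed.

HB.instance Definition _ :=
  Measure_isProbability.Build _ _ _ circle_lebesgue circle_lebesgue_setT.
End circle_lebesgue.

Section complex_functions.
Context (R : realType).

Definition cexp (z : R[i]) : R[i] :=
  let: x +i* y := z in (expR x)%:C * (cos y +i* sin y).

Context d (T : measurableType d) (mu : {measure set T -> \bar R}).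

Definition cintegral (f : T -> R[i]) : R[i] :=
  (\int[mu]_t complex.Re (f t)) +i* (\int[mu]_t complex.Im (f t)).

Definition L2 (f : T -> R[i]) : Prop :=
  [/\ measurable_fun setT (fun t => complex.Re (f t)),
      measurable_fun setT (fun t => complex.Im (f t)) &
      (\int[mu]_t (ComplexField.Normc.normc (f t) ^+ 2)%:E < +oo)%E].

End complex_functions.

Section circle_analysis.
Context (R : realType).
Local Notation T := (circle R).
Local Notation lambda := (@circle_lebesgue R).

(* Independent of the representative of [t], by periodicity. *)
Definition e_ (n : int) (t : T) : R[i] :=
  cexp (0 +i* (2 * trigo.pi * n%:~R * repr t)).

Definition msupport (mu : set T -> \bar R) : set T :=
  [set t | forall U : set T, open U -> U t -> (0 < mu U)%E].

Definition measure_coef (mu : {measure set T -> \bar R}) (n : int) : R[i] :=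
  cintegral mu (e_ (- n)).

Definition fourier_coef (g : T -> R[i]) (n : int) : R[i] :=
  cintegral lambda (fun t => g t * (e_ n t)^* ).

Definition toeplitz_det (mu : {measure set T -> \bar R}) (n : nat) : R[i] :=
  \det (\matrix_(j < n.+1, k < n.+1) measure_coef mu (k%:Z - j%:Z)).

Definition H2 (g : T -> R[i]) : Prop :=
  L2 lambda g /\ forall n : int, n < 0 -> fourier_coef g n = 0.

(* [F] represents the class of the orthogonal projection onto H^2 of the class
   of [g]; it is determined by [g] up to a lambda-null set. *)
Definition is_proj_H2 (g F : T -> R[i]) : Prop :=
  H2 F /\
  forall h, H2 h -> cintegral lambda (fun t => (g t - F t) * (h t)^* ) = 0.

Definition mutually_singular (mu nu : set T -> \bar R) : Prop :=
  exists N : set T, [/\ measurable N, mu N = 0%E & nu (~` N) = 0%E].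

(* [f] is a nonnegative real-valued version of the Radon-Nikodym derivative of
   the absolutely continuous part in the Lebesgue decomposition of [mu]. *)
Definition is_ac_density (mu : {finite_measure set T -> \bar R})
    (f : T -> R) : Prop :=
  [/\ measurable_fun setT f, forall t, 0 <= f t &
  exists mua mus : {finite_measure set T -> \bar R},
    [/\ mua `<< lambda,
        mutually_singular lambda mus,
        forall A, measurable A -> mu A = (mua A + mus A)%E &
        ae_eq lambda setT (EFin \o f)
          ('d (charge_of_finite_measure mua) '/d lambda)]].

Definition outer (f : T -> R) (z : R[i]) : R[i] :=
  cexp (2^-1 * cintegral lambda
    (fun t => (e_ 1 t + z) / (e_ 1 t - z) * (ln (f t))%:C)).

(* Integrability of log f is tested with the extended logarithm [lne], for
   which [lne 0 = -oo]; the real logarithm has the junk value [ln 0 = 0].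
   The cast to [numFieldType] gives access to the topology of [R[i]]. *)
Definition varphi (f : T -> R) (t : T) : R[i] :=
  if `[< lambda.-integrable setT (fun s => lne (f s)%:E) >] then
    lim (outer f (s%:C * e_ 1 t) @[s --> (1 : R)^'-]
         : set_system (R[i] : numFieldType))
  else 0.

(* The family (p_j) for -n <= j <= r: the given functions for 0 <= j <= r, and
   e_j for j < 0. *)
Definition extend (r : nat) (f : 'I_r.+1 -> T -> R[i]) (j : int) : T -> R[i] :=
  match j with
  | Posz k => f (inord k)
  | Negz _ => e_ j
  end.

End circle_analysis.

(* Main.v *)
(** Put [phi := varphi w].  Dividing the block determinant by the determinant of
    the Gram matrix of [e_(-n), ..., e_(-1)] in [L2(mu)], which is Toeplitz,
    leaves the determinant of the Schur complement; its entries are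
    [<f_j - P_n f_j, g_k>] in [L2(mu)], with [P_n] the orthogonal projection onto
    the span of [e_(-n), ..., e_(-1)].  By polarization it is enough that the
    squared distance from [f] to that span tends to [||F||^2], where [F] is the
    projection of [f * conj phi] onto [H^2].

    Lower bound: [phi] lies in [H^2], so [h * conj phi] is orthogonal to [H^2] for
    every [h] in the span, and [|phi|^2 dlambda <= dmu].

    Upper bound: the [f] whose distance to [{h}] is at most [||F||] form a closed
    subspace of [L2(mu)] containing [e_(-1), e_(-2), ...].  It contains [e_k] as
    soon as it contains all [e_j] with [j < k], because by Szego's theorem there
    are polynomials [q] with [q(0) = 1] and [int |q|^2 dmu] close to
    [exp (int log w) = |int phi|^2], and [e_k * conj q] differs from [e_k] by
    lower terms.  Trigonometric polynomials being dense, it is everything.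

    The two analytic inputs avoid complex function theory.  Szego's bound: for [g]
    Lipschitz with Herglotz transform [H g], [|exp (H g / 2)|^2] on the circle of
    radius [r] is the exponential of the Poisson integral of [g], hence uniformly
    close to [exp g], and [exp (H g / 2)] is a locally uniform limit of
    polynomials; a bounded measurable [g] is approximated by Lipschitz functions
    in [L1(lambda + mu)].  Boundary values: if [v >= 0], then [exp (- H v / 2)] is
    bounded by 1 and is the Poisson integral of an [L2] function; for general
    [log w] the outer function is a quotient of two such functions, and truncation
    gives its Fourier coefficients. *)
Require Import Defs.
From HB Require Import structures.
From mathcomp Require Import all_boot all_order all_algebra.
From mathcomp Require Import all_classical all_reals all_analysis.
From mathcomp Require Import measurable_realfun charge.
From mathcomp Require Import complex.
From mathcomp Require Import ring lra.

Set Implicit Arguments.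
Unset Strict Implicit.
Unset Printing Implicit Defensive.

Import Order.TTheory GRing.Theory Num.Theory.
Import numFieldNormedType.Exports.

Local Open Scope classical_set_scope.
Local Open Scope complex_scope.
Local Open Scope ring_scope.

Local Notation Re := (@complex.Re _).
Local Notation Im := (@complex.Im _).
Local Notation normc := ComplexField.Normc.normc.

(** * Complex-valued L2 functions *)

Section complex_parts.
Context (R : realType).
Implicit Types x y z : R[i].

(** Of the outer function only a few boundary facts are used: [phi] is in L2, its Fourier
    coefficients of negative index vanish, its mean is [sigma], [sigma ^+ 2] is the constant in
    Szego's theorem, and multiplication by the conjugate of [phi] is a contraction from L2(mu) to
    L2(lambda). When log w is not integrable, [phi = 0] and [sigma = 0] satisfy all of them, so the
    prediction argument needs no case distinction. The closed-subspace argument needs a quantity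
    that is quadratic on all of L2(mu); [defect], the squared norm minus a finite Bessel sum of
    [f * conj phi], plays this role and makes no mention of projections. The singular part of [mu]
    disappears because Szego's polynomials are fitted to a function that is very negative on the
    null set carrying it. Holomorphy is replaced by approximation by polynomials on smaller discs:
    mean values, Fourier coefficients and the growth of circle means are computed for polynomials
    and pass to the limit. Since [varphi] is a mere pointwise limit, all integrals are taken with a
    measurable representative, and the exchange is made at the very end. *)

Definition n2 z : R := Re z ^+ 2 + Im z ^+ 2.

Lemma ReD x y : Re (x + y) = Re x + Re y. Proof. by case: x y => [a b] [c d]. Qed.
Lemma ImD x y : Im (x + y) = Im x + Im y. Proof. by case: x y => [a b] [c d]. Qed.
Lemma ReN x : Re (- x) = - Re x. Proof. by case: x. Qed.
Lemma ImN x : Im (- x) = - Im x. Proof. by case: x. Qed.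
Lemma ReM x y : Re (x * y) = Re x * Re y - Im x * Im y.
Proof. by case: x y => [a b] [c d]. Qed.
Lemma ImM x y : Im (x * y) = Re x * Im y + Im x * Re y.
Proof. by case: x y => [a b] [c d] /=. Qed.
Lemma Reconj x : Re x^* = Re x. Proof. by case: x. Qed.
Lemma Imconj x : Im x^* = - Im x. Proof. by case: x. Qed.
Lemma ReC (a : R) : Re a%:C = a. Proof. by []. Qed.
Lemma ImC (a : R) : Im a%:C = 0. Proof. by []. Qed.

Lemma ReE (a b : R) : Re (a +i* b)%C = a. Proof. by []. Qed.
Lemma ImE (a b : R) : Im (a +i* b)%C = b. Proof. by []. Qed.

Definition partsE := (ReE, ImE, ReM, ImM, ReD, ImD, ReN, ImN, Reconj, Imconj, ReC, ImC).

Lemma complexP x y : Re x = Re y -> Im x = Im y -> x = y.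
Proof. by case: x y => [a b] [c d] /= -> ->. Qed.

Lemma n2_ge0 z : 0 <= n2 z. Proof. by rewrite addr_ge0 ?sqr_ge0. Qed.
Lemma n2M x y : n2 (x * y) = n2 x * n2 y.
Proof. by rewrite /n2 !partsE; ring. Qed.
Lemma n2N x : n2 (- x) = n2 x. Proof. by rewrite /n2 !partsE; ring. Qed.
Lemma n2conj x : n2 x^* = n2 x. Proof. by rewrite /n2 !partsE; ring. Qed.
Lemma n2C (a : R) : n2 a%:C = a ^+ 2. Proof. by rewrite /n2 !partsE; ring. Qed.
Lemma n2_0 : n2 0 = 0. Proof. by rewrite /n2 /=; ring. Qed.
Lemma n2_1 : n2 1 = 1. Proof. by rewrite /n2 /=; ring. Qed.
Lemma n2X z k : n2 (z ^+ k) = n2 z ^+ k.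
Proof. by elim: k => [|k IH]; rewrite ?expr0 ?n2_1// !exprS n2M IH. Qed.
Lemma n2D_le x y : n2 (x + y) <= 2 * n2 x + 2 * n2 y.
Proof.
rewrite /n2 !partsE; have := sqr_ge0 (Re x - Re y); have := sqr_ge0 (Im x - Im y).
nra.
Qed.
Lemma n2_eq0 z : (n2 z == 0) = (z == 0).
Proof. by rewrite /n2 paddr_eq0 ?sqr_ge0// !sqrf_eq0 eq_complex. Qed.
Lemma mul_conj z : z * z^* = (n2 z)%:C.
Proof. by apply: complexP; rewrite /n2 !partsE; ring. Qed.
Lemma normc_n2 z : ComplexField.Normc.normc z ^+ 2 = n2 z.
Proof. by case: z => a b /=; rewrite sqr_sqrtr ?addr_ge0 ?sqr_ge0. Qed.
Lemma normc_sqrt z : ComplexField.Normc.normc z = Num.sqrt (n2 z).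
Proof. by case: z. Qed.
Lemma Re_n2 z : Re z ^+ 2 <= n2 z. Proof. by rewrite lerDl sqr_ge0. Qed.
Lemma Im_n2 z : Im z ^+ 2 <= n2 z. Proof. by rewrite lerDr sqr_ge0. Qed.
Lemma n2_inv z : n2 z^-1 = (n2 z)^-1.
Proof.
have [->|z0] := eqVneq z 0; first by rewrite invr0 n2_0 invr0.
have nz : n2 z != 0 by rewrite n2_eq0.
by apply: (mulfI nz); rewrite -n2M divff// n2_1 divff.
Qed.
Lemma Re_sum (I : Type) (r : seq I) (P : pred I) (F : I -> R[i]) :
  Re (\sum_(i <- r | P i) F i) = \sum_(i <- r | P i) Re (F i).
Proof. by elim/big_rec2: _ => // i x y _ <-; rewrite ReD. Qed.
Lemma Im_sum (I : Type) (r : seq I) (P : pred I) (F : I -> R[i]) :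
  Im (\sum_(i <- r | P i) F i) = \sum_(i <- r | P i) Im (F i).
Proof. by elim/big_rec2: _ => // i x y _ <-; rewrite ImD. Qed.

Lemma conjD x y : (x + y)^* = x^* + y^*.
Proof. by apply: complexP; rewrite !partsE; ring. Qed.
Lemma conjM x y : (x * y)^* = x^* * y^*.
Proof. by apply: complexP; rewrite !partsE; ring. Qed.
Lemma conjN x : (- x)^* = - x^*.
Proof. by apply: complexP; rewrite !partsE; ring. Qed.
Lemma conjK x : (x^*)^* = x. Proof. exact: conjcK. Qed.
Lemma conjR (a : R) : (a%:C)^* = a%:C.
Proof. by apply: complexP; rewrite !partsE; ring. Qed.
Lemma conj_sum (I : Type) (r : seq I) (P : pred I) (F : I -> R[i]) :
  (\sum_(i <- r | P i) F i)^* = \sum_(i <- r | P i) (F i)^*.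
Proof.
by elim/big_rec2: _ => [|i x y _ <-]; [rewrite conjR|rewrite conjD].
Qed.
End complex_parts.

(** * Integrals and inner products of complex-valued functions *)

Section cintegral.
Context (R : realType) d (T : measurableType d) (mu : {measure set T -> \bar R}).
Implicit Types f g h : T -> R[i].
Implicit Types u v : T -> R.

Definition rint u := mu.-integrable [set: T] (EFin \o u).
Definition cmeas f := measurable_fun setT (fun t => Re (f t)) /\ measurable_fun setT (fun t => Im (f t)).
Definition cint f := rint (fun t => Re (f t)) /\ rint (fun t => Im (f t)).

Lemma rint_meas u : rint u -> measurable_fun setT u.
Proof. by move=> /measurable_int/measurable_EFinP. Qed.
Lemma rintD u v : rint u -> rint v -> rint (fun t => u t + v t).
Proof. by move=> ru rv; have := integrableD measurableT ru rv; apply: eq_integrable. Qed.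
Lemma rintZ (a : R) u : rint u -> rint (fun t => a * u t).
Proof. by move=> ru; have := integrableZl measurableT a ru; apply: eq_integrable. Qed.
Lemma rintN u : rint u -> rint (fun t => - u t).
Proof. by move=> /(rintZ (-1)); apply: eq_integrable => //= t _; rewrite mulN1r. Qed.
Lemma rintB u v : rint u -> rint v -> rint (fun t => u t - v t).
Proof. by move=> ru /rintN; exact: rintD. Qed.
Lemma rint_le u v : measurable_fun setT u -> (forall t, `|u t| <= v t) ->
  rint v -> rint u.
Proof.
move=> mu_ uv; apply: le_integrable => //; first exact/measurable_EFinP.
by move=> t _ /=; rewrite lee_fin (le_trans (uv t))// ler_norm.
Qed.
Lemma rint_abs u : rint u -> rint (fun t => `|u t|).
Proof. by move=> /integrable_abse. Qed.

Lemma cint_meas f : cint f -> cmeas f.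
Proof. by case=> /rint_meas ? /rint_meas. Qed.
Lemma cmeasD f g : cmeas f -> cmeas g -> cmeas (fun t => f t + g t).
Proof.
move=> [f1 f2] [g1 g2]; split.
- by under eq_fun do rewrite ReD; exact: measurable_funD.
- by under eq_fun do rewrite ImD; exact: measurable_funD.
Qed.
Lemma cmeasM f g : cmeas f -> cmeas g -> cmeas (fun t => f t * g t).
Proof.
move=> [f1 f2] [g1 g2]; split.
- under eq_fun do rewrite ReM.
  by apply: measurable_funB; exact: measurable_funM.
- under eq_fun do rewrite ImM.
  by apply: measurable_funD; exact: measurable_funM.
Qed.
Lemma cmeas_cst (c : R[i]) : cmeas (fun=> c).
Proof. by split; exact: measurable_cst. Qed.
Lemma cmeas_conj f : cmeas f -> cmeas (fun t => (f t)^*).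
Proof.
move=> [f1 f2]; split.
- by under eq_fun do rewrite Reconj.
- by under eq_fun do rewrite Imconj; exact: measurableT_comp.
Qed.
Lemma cmeasN f : cmeas f -> cmeas (fun t => - f t).
Proof.
by move=> [f1 f2]; split; [under eq_fun do rewrite ReN | under eq_fun do rewrite ImN];
  exact: measurableT_comp.
Qed.
Lemma cmeas_n2 f : cmeas f -> measurable_fun setT (fun t => n2 (f t)).
Proof. by move=> [f1 f2]; apply: measurable_funD; exact: measurable_funX. Qed.
Lemma cmeas_real u : measurable_fun setT u -> cmeas (fun t => (u t)%:C).
Proof. by move=> mu_; split => //; exact: measurable_cst. Qed.
Lemma cmeas_exp f k : cmeas f -> cmeas (fun t => f t ^+ k).
Proof.
move=> mf; elim: k => [|k IH]; first exact: cmeas_cst.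
by under eq_fun do rewrite exprS; exact: cmeasM.
Qed.
Lemma cmeas_sum (I : Type) (r : seq I) (F : I -> T -> R[i]) :
  (forall i, cmeas (F i)) -> cmeas (fun t => \sum_(i <- r) F i t).
Proof.
move=> mF; elim: r => [|i r IH].
  by under eq_fun do rewrite big_nil; exact: cmeas_cst.
by under eq_fun do rewrite big_cons; exact: cmeasD.
Qed.

Lemma cintD f g : cint f -> cint g -> cint (fun t => f t + g t).
Proof.
move=> [f1 f2] [g1 g2]; split.
- by have := rintD f1 g1; apply: eq_integrable => //= t _; rewrite ReD.
- by have := rintD f2 g2; apply: eq_integrable => //= t _; rewrite ImD.
Qed.
Lemma cintZ (c : R[i]) f : cint f -> cint (fun t => c * f t).
Proof.
move=> [f1 f2]; split.
- have := rintB (rintZ (Re c) f1) (rintZ (Im c) f2).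
  by apply: eq_integrable => //= t _; rewrite ReM.
- have := rintD (rintZ (Re c) f2) (rintZ (Im c) f1).
  by apply: eq_integrable => //= t _; rewrite ImM.
Qed.
Lemma cintN f : cint f -> cint (fun t => - f t).
Proof.
by move=> /(cintZ (-1)); rewrite (_ : (fun t => _) = (fun t => - f t))//; apply/funext => t; rewrite mulN1r.
Qed.
Lemma cint_conj f : cint f -> cint (fun t => (f t)^*).
Proof.
move=> [f1 f2]; split; first by apply: eq_integrable f1 => //= t _; rewrite Reconj.
by have := rintN f2; apply: eq_integrable => //= t _; rewrite Imconj.
Qed.
Lemma cint_sum (I : Type) (r : seq I) (F : I -> T -> R[i]) :
  (forall i, cint (F i)) -> cint (fun t => \sum_(i <- r) F i t).
Proof.
move=> iF; elim: r => [|i r IH].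
  under eq_fun do rewrite big_nil.
  by split; exact: integrable0.
by under eq_fun do rewrite big_cons; exact: cintD.
Qed.

Lemma eq_cintegral f g : f =1 g -> cintegral mu f = cintegral mu g.
Proof. by move=> fg; congr cintegral; apply/funext. Qed.
Lemma cintegralD f g : cint f -> cint g ->
  cintegral mu (fun t => f t + g t) = cintegral mu f + cintegral mu g.
Proof.
move=> [f1 f2] [g1 g2]; apply: complexP; rewrite ?partsE /=.
- by rewrite -RintegralD//; apply: eq_Rintegral => t _; rewrite ReD.
- by rewrite -RintegralD//; apply: eq_Rintegral => t _; rewrite ImD.
Qed.
Lemma cintegralZ (c : R[i]) f : cint f ->
  cintegral mu (fun t => c * f t) = c * cintegral mu f.
Proof.
move=> [f1 f2]; apply: complexP; rewrite !partsE /=.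
- rewrite -!RintegralZl// -RintegralB//; try exact: rintZ.
  by apply: eq_Rintegral => t _; rewrite ReM.
- rewrite -!RintegralZl// -RintegralD//; try exact: rintZ.
  by apply: eq_Rintegral => t _; rewrite ImM.
Qed.
Lemma cintegralN f : cint f -> cintegral mu (fun t => - f t) = - cintegral mu f.
Proof.
by move=> cf; rewrite -mulN1r -cintegralZ//; apply: eq_cintegral => t; rewrite mulN1r.
Qed.
Lemma cintegralB f g : cint f -> cint g ->
  cintegral mu (fun t => f t - g t) = cintegral mu f - cintegral mu g.
Proof. by move=> cf cg; rewrite cintegralD// ?cintegralN//; exact: cintN. Qed.
Lemma cintegral_conj f : cint f ->
  cintegral mu (fun t => (f t)^*) = (cintegral mu f)^*.
Proof.
move=> [f1 f2]; apply: complexP; rewrite !partsE /=.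
- by apply: eq_Rintegral => t _; rewrite Reconj.
- rewrite -mulN1r -RintegralZl//; apply: eq_Rintegral => t _.
  by rewrite Imconj mulN1r.
Qed.
Lemma cintegral0 : cintegral mu (fun=> 0) = 0.
Proof. by apply: complexP; rewrite /= /Rintegral integral0. Qed.
Lemma cintegral_sum (I : Type) (r : seq I) (F : I -> T -> R[i]) :
  (forall i, cint (F i)) ->
  cintegral mu (fun t => \sum_(i <- r) F i t) = \sum_(i <- r) cintegral mu (F i).
Proof.
move=> iF; elim: r => [|i r IH].
  by under eq_fun do rewrite big_nil; rewrite cintegral0 big_nil.
under eq_fun do rewrite big_cons; rewrite big_cons cintegralD//.
  by rewrite IH.
exact: cint_sum.
Qed.
Lemma cintegral_real u : cintegral mu (fun t => (u t)%:C) = (\int[mu]_t u t)%:C.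
Proof. by apply: complexP => //=; rewrite /Rintegral integral0. Qed.

Lemma cint_le f u : cmeas f -> (forall t, n2 (f t) <= u t ^+ 2) ->
  (forall t, 0 <= u t) -> rint u -> cint f.
Proof.
move=> [m1 m2] fu u0 ru; split; apply: (rint_le _ _ ru) => // t.
- by rewrite -(ler_pXn2r (n := 2)) ?nnegrE// real_normK ?num_real//
    (le_trans (Re_n2 _)).
- by rewrite -(ler_pXn2r (n := 2)) ?nnegrE// real_normK ?num_real//
    (le_trans (Im_n2 _)).
Qed.

Lemma cint_normc f : cint f -> rint (fun t => Num.sqrt (n2 (f t))).
Proof.
move=> cf; have [m1 m2] := cint_meas cf; case: cf => f1 f2.
apply: (rint_le _ _ (rintD (rint_abs f1) (rint_abs f2))).
  apply: measurableT_comp; last by apply: cmeas_n2.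
  apply: continuous_measurable_fun; exact: sqrt_continuous.
move=> t /=; rewrite ger0_norm ?sqrtr_ge0//.
rewrite -(ler_pXn2r (n := 2)) ?nnegrE ?addr_ge0 ?sqrtr_ge0// sqr_sqrtr ?n2_ge0//.
rewrite sqrrD !real_normK ?num_real// /n2 addrAC lerDl.
by rewrite mulrn_wge0// mulr_ge0.
Qed.

(* Rotate so that the integral becomes nonnegative. *)
Lemma n2_cintegral_le f : cint f ->
  n2 (cintegral mu f) <= (\int[mu]_t Num.sqrt (n2 (f t))) ^+ 2.
Proof.
move=> cf; set I := cintegral mu f; set J := Rintegral _ _ _.
have J0 : 0 <= J by apply: Rintegral_ge0 => t _; exact: sqrtr_ge0.
have key : n2 I <= Num.sqrt (n2 I) * J.
  have {1}-> : n2 I = Re (cintegral mu (fun t => I^* * f t)).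
    by rewrite cintegralZ// mulrC mul_conj.
  rewrite [Re _]/= -RintegralZl//; last exact: cint_normc.
  apply: le_Rintegral => //.
  - by case: (cintZ I^* cf).
  - by apply: rintZ; exact: cint_normc.
  move=> t _; rewrite -sqrtrM ?n2_ge0// -(n2conj I) -n2M.
  rewrite (le_trans (ler_norm _))// -sqrtr_sqr ler_wsqrtr//.
  exact: Re_n2.
have [->|I0] := eqVneq (n2 I) 0; first exact: sqr_ge0.
have sI : 0 < Num.sqrt (n2 I) by rewrite sqrtr_gt0 lt_neqAle eq_sym I0 n2_ge0.
have : Num.sqrt (n2 I) <= J.
  by rewrite -(ler_pM2l sI) -expr2 sqr_sqrtr ?n2_ge0.
move=> le; rewrite -(sqr_sqrtr (n2_ge0 I)).
by rewrite ler_sqr ?nnegrE ?sqrtr_ge0.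
Qed.

Lemma L2P f : L2 mu f <-> cmeas f /\ rint (fun t => n2 (f t)).
Proof.
have e : (fun t => (ComplexField.Normc.normc (f t) ^+ 2)%:E) =
         (EFin \o (fun t => n2 (f t))).
  by apply/funext => t; rewrite /= normc_n2.
rewrite /L2 e; split.
- move=> [m1 m2 fin]; split => //; apply/integrableP; split.
    by apply/measurable_EFinP; exact: cmeas_n2.
  by under eq_integral do rewrite gee0_abs ?lee_fin ?n2_ge0//.
- move=> [[m1 m2] /integrableP[_]].
  by under eq_integral do rewrite gee0_abs ?lee_fin ?n2_ge0//.
Qed.

Definition nrm2 f : R := \int[mu]_t n2 (f t).
Definition ip f g : R[i] := cintegral mu (fun t => f t * (g t)^*).

Lemma L2_meas f : L2 mu f -> cmeas f. Proof. by move=> /L2P[]. Qed.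
Lemma L2_n2 f : L2 mu f -> rint (fun t => n2 (f t)). Proof. by move=> /L2P[]. Qed.
Lemma L2_le f u : cmeas f -> (forall t, n2 (f t) <= u t) -> rint u -> L2 mu f.
Proof.
move=> mf fu ru; apply/L2P; split => //; apply: (rint_le _ _ ru).
  exact: cmeas_n2.
by move=> t; rewrite ger0_norm ?n2_ge0.
Qed.
Lemma L2D f g : L2 mu f -> L2 mu g -> L2 mu (fun t => f t + g t).
Proof.
move=> Lf Lg; apply: (@L2_le _ (fun t => 2 * n2 (f t) + 2 * n2 (g t))).
- by apply: cmeasD; exact: L2_meas.
- by move=> t; exact: n2D_le.
- by apply: rintD; apply: rintZ; exact: L2_n2.
Qed.
Lemma L2M_bdd f g (M : R) : L2 mu f -> cmeas g -> (forall t, n2 (g t) <= M) ->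
  L2 mu (fun t => g t * f t).
Proof.
move=> Lf mg gM; apply: (@L2_le _ (fun t => M * n2 (f t))).
- by apply: cmeasM => //; exact: L2_meas.
- by move=> t; rewrite n2M ler_wpM2r ?n2_ge0.
- by apply: rintZ; exact: L2_n2.
Qed.
Lemma L2Z (c : R[i]) f : L2 mu f -> L2 mu (fun t => c * f t).
Proof. by move=> Lf; apply: (L2M_bdd (M := n2 c) Lf) => //; exact: cmeas_cst. Qed.
Lemma L2N f : L2 mu f -> L2 mu (fun t => - f t).
Proof.
by move=> /(L2Z (-1)); rewrite (_ : (fun t => _) = (fun t => - f t))//; apply/funext => t; rewrite mulN1r.
Qed.
Lemma L2B f g : L2 mu f -> L2 mu g -> L2 mu (fun t => f t - g t).
Proof. by move=> Lf /L2N; exact: L2D. Qed.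
Lemma L2_conj f : L2 mu f -> L2 mu (fun t => (f t)^*).
Proof.
move=> Lf; apply: (@L2_le _ (fun t => n2 (f t))); last exact: L2_n2.
- by apply: cmeas_conj; exact: L2_meas.
- by move=> t; rewrite n2conj.
Qed.
Lemma L2_0 : L2 mu (fun=> 0).
Proof.
apply: (@L2_le _ (fun=> 0)); [exact: cmeas_cst| |exact: integrable0].
by move=> t; rewrite n2_0.
Qed.
Lemma L2_sum (I : Type) (r : seq I) (F : I -> T -> R[i]) :
  (forall i, L2 mu (F i)) -> L2 mu (fun t => \sum_(i <- r) F i t).
Proof.
move=> iF; elim: r => [|i r IH].
  by under eq_fun do rewrite big_nil; exact: L2_0.
by under eq_fun do rewrite big_cons; exact: L2D.
Qed.
Lemma L2_cint f g : L2 mu f -> L2 mu g -> cint (fun t => f t * (g t)^*).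
Proof.
move=> Lf Lg; apply: (@cint_le _ (fun t => n2 (f t) + n2 (g t))).
- apply: cmeasM; first exact: L2_meas.
  by apply: cmeas_conj; exact: L2_meas.
- move=> t; rewrite n2M n2conj; have := n2_ge0 (f t); have := n2_ge0 (g t); nra.
- by move=> t; rewrite addr_ge0 ?n2_ge0.
- by apply: rintD; exact: L2_n2.
Qed.

Lemma ipDl f g h : L2 mu f -> L2 mu g -> L2 mu h ->
  ip (fun t => f t + g t) h = ip f h + ip g h.
Proof.
move=> *; rewrite /ip -cintegralD; try exact: L2_cint.
by apply: eq_cintegral => t; rewrite mulrDl.
Qed.
Lemma ipZl (c : R[i]) f h : L2 mu f -> L2 mu h ->
  ip (fun t => c * f t) h = c * ip f h.
Proof.
move=> *; rewrite /ip -cintegralZ; try exact: L2_cint.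
by apply: eq_cintegral => t; rewrite mulrA.
Qed.
Lemma ipC f g : L2 mu f -> L2 mu g -> ip g f = (ip f g)^*.
Proof.
move=> *; rewrite /ip -cintegral_conj; last exact: L2_cint.
by apply: eq_cintegral => t; rewrite conjM conjK mulrC.
Qed.
Lemma ipDr f g h : L2 mu f -> L2 mu g -> L2 mu h ->
  ip h (fun t => f t + g t) = ip h f + ip h g.
Proof.
move=> Lf Lg Lh; rewrite ipC//; last exact: L2D.
by rewrite ipDl// conjD -!ipC.
Qed.
Lemma ipZr (c : R[i]) f h : L2 mu f -> L2 mu h ->
  ip h (fun t => c * f t) = c^* * ip h f.
Proof.
move=> Lf Lh; rewrite ipC//; last exact: L2Z.
by rewrite ipZl// conjM -ipC.
Qed.
Lemma ipBl f g h : L2 mu f -> L2 mu g -> L2 mu h ->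
  ip (fun t => f t - g t) h = ip f h - ip g h.
Proof.
move=> Lf Lg Lh; rewrite ipDl//; last exact: L2N.
congr (_ + _); rewrite -mulN1r -ipZl//.
by apply: eq_cintegral => t; rewrite mulN1r.
Qed.
Lemma ipBr f g h : L2 mu f -> L2 mu g -> L2 mu h ->
  ip h (fun t => f t - g t) = ip h f - ip h g.
Proof.
move=> Lf Lg Lh; rewrite ipC//; last exact: L2B.
by rewrite ipBl// conjD conjN -!ipC.
Qed.
Lemma ip_suml (I : Type) (r : seq I) (c : I -> R[i]) (F : I -> T -> R[i]) h :
  (forall i, L2 mu (F i)) -> L2 mu h ->
  ip (fun t => \sum_(i <- r) c i * F i t) h = \sum_(i <- r) c i * ip (F i) h.
Proof.
move=> LF Lh; elim: r => [|i r IH].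
  rewrite big_nil /ip; under eq_fun do rewrite big_nil mul0r.
  exact: cintegral0.
under [X in ip X _]eq_fun do rewrite big_cons.
rewrite big_cons ipDl// ?ipZl// ?IH//; first exact: L2Z.
by apply: L2_sum => j; exact: L2Z.
Qed.
Lemma ip_sumr (I : Type) (r : seq I) (c : I -> R[i]) (F : I -> T -> R[i]) h :
  (forall i, L2 mu (F i)) -> L2 mu h ->
  ip h (fun t => \sum_(i <- r) c i * F i t) = \sum_(i <- r) (c i)^* * ip h (F i).
Proof.
move=> LF Lh; rewrite ipC//; last by apply: L2_sum => j; exact: L2Z.
rewrite ip_suml// conj_sum; apply: eq_bigr => i _.
by rewrite conjM -ipC.
Qed.
Lemma ip_nrm2 f : ip f f = (nrm2 f)%:C.
Proof. by rewrite /ip /nrm2 -cintegral_real; apply: eq_cintegral => t; rewrite mul_conj. Qed.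
Lemma nrm2_ge0 f : 0 <= nrm2 f.
Proof. by apply: Rintegral_ge0 => t _; exact: n2_ge0. Qed.
Lemma nrm2Z (c : R[i]) f : L2 mu f -> nrm2 (fun t => c * f t) = n2 c * nrm2 f.
Proof.
move=> Lf; rewrite /nrm2 -RintegralZl//; last exact: L2_n2.
by apply: eq_Rintegral => t _; rewrite n2M.
Qed.
Lemma nrm2D f g : L2 mu f -> L2 mu g ->
  nrm2 (fun t => f t + g t) = nrm2 f + nrm2 g + 2 * Re (ip f g).
Proof.
move=> Lf Lg.
have : ip (fun t => f t + g t) (fun t => f t + g t) =
    ip f f + ip g g + (ip f g + (ip f g)^*).
  by rewrite ipDl ?ipDr// ?(ipC Lf Lg)//; [ring|exact: L2D].
by rewrite !ip_nrm2 => /(congr1 (@complex.Re R)); rewrite !partsE => ->; ring.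
Qed.
Lemma nrm2D_le f g : L2 mu f -> L2 mu g ->
  nrm2 (fun t => f t + g t) <= 2 * nrm2 f + 2 * nrm2 g.
Proof.
move=> Lf Lg; rewrite /nrm2 -!RintegralZl//; try exact: L2_n2.
rewrite -RintegralD//; try by apply: rintZ; exact: L2_n2.
apply: le_Rintegral => //.
- by apply: L2_n2; exact: L2D.
- by apply: rintD; apply: rintZ; exact: L2_n2.
by move=> t _; exact: n2D_le.
Qed.
Lemma ip_CS f g : L2 mu f -> L2 mu g -> n2 (ip f g) <= nrm2 f * nrm2 g.
Proof.
move=> Lf Lg.
(* The direction [ip f g * g] makes the cross term real, so a real parameter [a] suffices. *)
have H (a : R) : 0 <= nrm2 f + a ^+ 2 * (n2 (ip f g) * nrm2 g) + 2 * a * n2 (ip f g).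
  have L : L2 mu (fun t => (a%:C * ip f g) * g t) by exact: L2Z.
  have := nrm2_ge0 (fun t => f t + (a%:C * ip f g) * g t).
  rewrite nrm2D// nrm2Z// ipZr// n2M n2C; set z := ip f g.
  by rewrite (_ : Re _ = a * n2 z); [nra | rewrite /n2 !partsE; ring].
have := nrm2_ge0 g; rewrite le_eqVlt => /orP[/eqP g0|g0].
  move: H; rewrite -g0 mulr0 => H.
  have := n2_ge0 (ip f g); rewrite le_eqVlt => /orP[/eqP <-|N0]; first by rewrite mulr0.
  (* With [nrm2 g = 0] the form is affine in [a]; this value makes it equal to [- nrm2 f - 2], a
     contradiction. *)
  have := H (- (nrm2 f + 1) / (n2 (ip f g))).
  rewrite mulr0 addr0 -!mulrA mulVf ?gt_eqF//.
  have := nrm2_ge0 f; lra.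
have := H (- (nrm2 g)^-1).
rewrite sqrrN [_ ^+2 * _](_ : _ = (nrm2 g)^-1 * n2 (ip f g)); last first.
  by rewrite expr2 mulrCA -!mulrA [_ * nrm2 g]mulrC; field; rewrite gt_eqF.
move=> HH; rewrite -ler_pdivrMr//; lra.
Qed.
End cintegral.

(** * The circle and its characters *)

Section circle_basics.
Context (R : realType).
Local Notation T := (circle R).
Local Notation lambda := (@circle_lebesgue R).
Local Notation C := R[i].
Local Notation pi := (@trigo.pi R).

Lemma cos_sin_int (y : R) (k : int) :
  cos (y + 2 * pi * k%:~R) = cos y /\ sin (y + 2 * pi * k%:~R) = sin y.
Proof.
have H (n : nat) u : cos (u + 2 * pi * n%:R) = cos u :> R /\ sin (u + 2 * pi * n%:R) = sin u :> R.
  rewrite (_ : 2 * pi * n%:R = pi *+ 2 *+ n); last first.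
    by rewrite -(mulr_natr _ n) -(mulr_natr _ 2); ring.
  by rewrite (periodicn (@cosD2pi R)) (periodicn (@sinD2pi R)).
case: k => n; first exact: H.
have [c s] := H n.+1 (y + 2 * pi * (Negz n)%:~R).
have e : y + 2 * pi * (Negz n)%:~R + 2 * pi * n.+1%:R = y.
  by rewrite NegzE mulrNz mulrN subrK.
by rewrite -c -s e.
Qed.

Lemma cexp_i (y : R) : cexp (0 +i* y) = (cos y +i* sin y)%C.
Proof. by rewrite /cexp expR0 mul1r. Qed.

Lemma circle_piP (x y : R) : circle_pi x = circle_pi y <-> x - y \is a Num.int.
Proof.
split; last by move=> h; apply/eqmodP.
by move=> /eqmodP.
Qed.

Lemma circle_reprK (t : T) : circle_pi (repr t) = t.
Proof. by rewrite /circle_pi reprK. Qed.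

Lemma e_pi (n : int) (x : R) :
  e_ n (circle_pi x) = (cos (2 * pi * n%:~R * x) +i* sin (2 * pi * n%:~R * x))%C.
Proof.
rewrite /e_ cexp_i; have /circle_piP/intrP[k hk] := circle_reprK (circle_pi x).
have -> : 2 * pi * n%:~R * repr (circle_pi x) =
    2 * pi * n%:~R * x + 2 * pi * (n * k)%:~R.
  by rewrite intrM -hk; ring.
by have [-> ->] := cos_sin_int (2 * pi * n%:~R * x) (n * k).
Qed.

Lemma circle_ind (P : T -> Prop) : (forall x : R, P (circle_pi x)) -> forall t, P t.
Proof. by move=> H t; rewrite -(circle_reprK t). Qed.

Lemma e_D m n (t : T) : e_ (m + n) t = e_ m t * e_ n t.
Proof.
rewrite /e_ !cexp_i intrD mulrDr mulrDl; move: (_ * repr t) (_ * repr t) => a b.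
rewrite cosD sinD; apply: complexP; rewrite !partsE /=; first by [].
by rewrite addrC.
Qed.
Lemma e_0 (t : T) : e_ 0 t = 1.
Proof. by rewrite /e_ cexp_i mulr0 mul0r cos0 sin0. Qed.
Lemma e_N n (t : T) : e_ (- n) t = (e_ n t)^*.
Proof.
rewrite /e_ !cexp_i mulrNz mulrN mulNr cosN sinN.
by apply: complexP; rewrite !partsE.
Qed.
Lemma n2_e n (t : T) : n2 (e_ n t) = 1.
Proof. by rewrite /e_ cexp_i /n2 /= cos2Dsin2. Qed.
Lemma e_nat k (t : T) : e_ (Posz k) t = e_ 1 t ^+ k.
Proof.
elim: k => [|k IH]; first by rewrite e_0.
by rewrite exprSr -IH -e_D -PoszD addn1.
Qed.
Lemma e_conj (t : T) n : e_ n t * (e_ n t)^* = 1.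
Proof. by rewrite mul_conj n2_e. Qed.

Lemma circle_open_pi (A : set T) : open A = open ((@circle_pi R) @^-1` A).
Proof. by []. Qed.

Lemma circle_measurable_open (A : set T) : open A -> measurable A.
Proof. by move=> oA; exact: sub_sigma_algebra. Qed.

(** The sigma-algebra is generated by the open sets of the quotient, and these are tested on
    preimages in the line, so continuity of the pull-back is enough. *)
Lemma circle_cont_meas (h : T -> R) : continuous (h \o (@circle_pi R)) ->
  measurable_fun setT h.
Proof.
move=> /continuousP ch; apply: (@measurability _ _ _ _ setT h (@RGenOpens.G R)).
  exact: RGenOpens.measurableE.
move=> _ [_ [a [b ->]] <-]; rewrite setTI; apply: circle_measurable_open.
by rewrite circle_open_pi; apply: ch; exact: interval_open.
Qed.

Lemma cont_e_pi n : continuous (fun x : R => Re (e_ n (circle_pi x))) /\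
  continuous (fun x : R => Im (e_ n (circle_pi x))).
Proof.
split; under eq_fun do rewrite e_pi /=.
- move=> x; apply: (@continuous_comp _ _ _ (fun x : R => 2 * pi * n%:~R * x) cos).
    exact: mulrl_continuous.
  exact: continuous_cos.
- move=> x; apply: (@continuous_comp _ _ _ (fun x : R => 2 * pi * n%:~R * x) sin).
    exact: mulrl_continuous.
  exact: continuous_sin.
Qed.

Lemma cmeas_e n : cmeas (@e_ R n).
Proof. by have [c s] := cont_e_pi n; split; exact: circle_cont_meas. Qed.

Local Notation leb := (@lebesgue_measure R).
Local Notation I01 := (`[0%R, 1%R[%classic : set R).

Lemma ge0_integral_circle (h : T -> \bar R) :
  measurable_fun setT h -> (forall t, 0%E <= h t)%E ->
  (\int[lambda]_t h t = \int[leb]_(x in `[0%R, 1%R[) h (circle_pi x))%E.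
Proof.
move=> mh h0.
rewrite (@eq_measure_integral _ _ _ _ (pushforward
    (mrestr (@lebesgue_measure R) (measurable_itv `[0%R, 1%R[))
    (@circle_pi R))) //.
rewrite ge0_integral_pushforward//= preimage_setT.
have mc : measurable_fun setT (h \o (@circle_pi R)).
  by apply: measurableT_comp => //; exact: measurable_circle_pi.
rewrite (@ge0_negligible_integral _ _ _ (mrestr leb (measurable_itv `[0%R, 1%R[))
  setT (~` I01))//; first last.
- by rewrite /= /mrestr setICl measure0.
- exact: measurableC.
rewrite setTD setCK; apply: eq_measure_integral => A mA AI.
by rewrite /= /mrestr setIidl.
Qed.

Lemma rint_circle (u : T -> R) : rint lambda u ->
  leb.-integrable I01 (EFin \o (u \o (@circle_pi R))).
Proof.
move=> /[dup] /rint_meas mu_ /integrableP[_ fin]; apply/integrableP; split.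
  apply/measurable_EFinP; apply: measurable_funTS.
  by apply: measurableT_comp => //; exact: measurable_circle_pi.
move: fin; rewrite ge0_integral_circle//.
by apply: measurableT_comp => //; exact/measurable_EFinP.
Qed.

Lemma Rintegral_circle (u : T -> R) : rint lambda u ->
  \int[lambda]_t u t = \int[leb]_(x in I01) u (circle_pi x).
Proof.
move=> ru; rewrite /Rintegral; congr fine.
have mu_ : measurable_fun setT (EFin \o u) by exact: measurable_int ru.
rewrite [LHS]integralE [RHS]integralE; congr (_ - _)%E.
- rewrite ge0_integral_circle//; last exact: measurable_funepos.
  by apply: eq_integral => x _; rewrite !funeposE.
- rewrite [LHS]ge0_integral_circle//; last exact: measurable_funeneg.
  by apply: eq_integral => x _; rewrite !funenegE.
Qed.

Lemma rint_cst (nu : {finite_measure set T -> \bar R}) (c : R) : rint nu (fun=> c).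
Proof. by apply: finite_measure_integrable_cst. Qed.

Lemma rint_bdd (nu : {finite_measure set T -> \bar R}) (u : T -> R) (M : R) :
  measurable_fun setT u -> (forall t, `|u t| <= M) -> rint nu u.
Proof. by move=> mu_ uM; apply: (rint_le _ _ (rint_cst nu M)). Qed.

Lemma L2_bdd (nu : {finite_measure set T -> \bar R}) (f : T -> C) (M : R) :
  cmeas f -> (forall t, n2 (f t) <= M) -> L2 nu f.
Proof. by move=> mf fM; apply: (L2_le _ fM) => //; exact: rint_cst. Qed.

Lemma L2_e (nu : {finite_measure set T -> \bar R}) n : L2 nu (@e_ R n).
Proof. by apply: (@L2_bdd _ _ 1) => [|t]; [exact: cmeas_e|rewrite n2_e]. Qed.

Lemma cint_e n : cint lambda (@e_ R n).
Proof.
apply: (@cint_le _ _ _ _ _ (fun=> 1)); [exact: cmeas_e| | |exact: rint_cst] => //.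
by move=> t; rewrite n2_e expr1n.
Qed.

Lemma Rintegral_cos (n : int) : n != 0 ->
  \int[leb]_(x in I01) cos (2 * pi * n%:~R * x) = 0.
Proof.
move=> n0; set a := 2 * pi * n%:~R.
have a0 : a != 0 by rewrite /a !mulf_neq0 ?intr_eq0// ?pnatr_eq0// gt_eqF ?pi_gt0.
pose F (x : R) := a^-1 * sin (a * x).
have dF (x : R) : is_derive x 1 F (cos (a * x)).
  have -> : F = a^-1 *: (sin \o (a *: id)) by [].
  apply: is_derive_eq.
  by rewrite /= !scaler1 /GRing.scale /= [cos _ * a]mulrC mulrA mulVf// mul1r.
have cF : continuous F.
  by move=> x; apply: differentiable_continuous; apply/derivable1_diffP; exact: ex_derive.
have ccos : continuous (fun x : R => cos (a * x)).
  move=> x; apply: (@continuous_comp _ _ _ (fun x : R => a * x) cos).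
    exact: mulrl_continuous.
  exact: continuous_cos.
have ic : leb.-integrable `[0%R, 1%R] (EFin \o (fun x : R => cos (a * x))).
  apply: continuous_compact_integrable; first exact: segment_compact.
  exact: continuous_subspaceT.
rewrite Rintegral_itv_bndo_bndc; last first.
  by apply: integrableS ic => //; apply: subset_itvl; rewrite bnd_simp.
rewrite /Rintegral (@continuous_FTC2 _ _ F)//.
- rewrite /F mulr0 mulr1 sin0 mulr0 sube0 /=.
  by have [_] := cos_sin_int 0 n; rewrite add0r => ->; rewrite sin0 mulr0.
- exact: continuous_subspaceT.
- split; first by move=> x _; exact: ex_derive.
  + by apply: cvg_at_right_filter; exact: cF.
  + by apply: cvg_at_left_filter; exact: cF.
- by move=> x _; rewrite derive1E; exact: derive_val.
Qed.

Lemma Rintegral_sin (n : int) : \int[leb]_(x in I01) sin (2 * pi * n%:~R * x) = 0.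
Proof.
have [->|n0] := eqVneq n 0.
  under eq_Rintegral do rewrite mulr0 mul0r sin0.
  by rewrite /Rintegral integral0.
set a := 2 * pi * n%:~R.
have a0 : a != 0 by rewrite /a !mulf_neq0 ?intr_eq0// ?pnatr_eq0// gt_eqF ?pi_gt0.
pose F (x : R) := - a^-1 * cos (a * x).
have dF (x : R) : is_derive x 1 F (sin (a * x)).
  have -> : F = (- a^-1) *: (cos \o (a *: id)) by [].
  apply: is_derive_eq.
  rewrite /= scaler1 /GRing.scale /= mulNr [_ * a]mulNr mulrN opprK.
  by rewrite [sin _ * a]mulrC mulrA mulVf// mul1r.
have cF : continuous F.
  by move=> x; apply: differentiable_continuous; apply/derivable1_diffP; exact: ex_derive.
have csin : continuous (fun x : R => sin (a * x)).
  move=> x; apply: (@continuous_comp _ _ _ (fun x : R => a * x) sin).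
    exact: mulrl_continuous.
  exact: continuous_sin.
have ic : leb.-integrable `[0%R, 1%R] (EFin \o (fun x : R => sin (a * x))).
  apply: continuous_compact_integrable; first exact: segment_compact.
  exact: continuous_subspaceT.
rewrite Rintegral_itv_bndo_bndc; last first.
  by apply: integrableS ic => //; apply: subset_itvl; rewrite bnd_simp.
rewrite /Rintegral (@continuous_FTC2 _ _ F)//.
- rewrite /F mulr0 mulr1 cos0 /=.
  have [c _] := cos_sin_int 0 n; rewrite add0r -/a cos0 in c.
  by rewrite c subrr.
- exact: continuous_subspaceT.
- split; first by move=> x _; exact: ex_derive.
  + by apply: cvg_at_right_filter; exact: cF.
  + by apply: cvg_at_left_filter; exact: cF.
- by move=> x _; rewrite derive1E; exact: derive_val.
Qed.

Lemma cintegral_e (n : int) : cintegral lambda (@e_ R n) = (n == 0)%:R.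
Proof.
have [ire iim] := cint_e n.
have [->|n0] := eqVneq n 0.
  rewrite (_ : cintegral lambda _ = cintegral lambda (fun=> 1%:C)); last first.
    by apply: eq_cintegral => t; rewrite e_0.
  rewrite cintegral_real /Rintegral integral_cst// mul1e.
  by apply: complexP => //=; rewrite (@circle_lebesgue_setT R).
apply: complexP.
- transitivity (\int[lambda]_t Re (e_ n t)) => //; rewrite Rintegral_circle//.
  apply: etrans (Rintegral_cos n0); apply: eq_Rintegral => x _.
  by rewrite e_pi.
- transitivity (\int[lambda]_t Im (e_ n t)) => //; rewrite Rintegral_circle//.
  apply: etrans (Rintegral_sin n); apply: eq_Rintegral => x _.
  by rewrite e_pi.
Qed.

(** Once the difference is reduced to [d] in [0, 1), [cos (2 * pi * d) = 1] forces
    [sin (pi * d) = 0], which is impossible for [0 < d < 1]. *)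
Lemma e_1_inj (s t : T) : e_ 1 s = e_ 1 t -> s = t.
Proof.
move: s t; apply: circle_ind => x; apply: circle_ind => y; rewrite !e_pi !mulr1 => -[cxy sxy].
set d := x - y - (Num.floor (x - y))%:~R.
have d01 : 0 <= d < 1.
  have := floorD1_gt (x - y); have := floor_le (x - y); rewrite /d intrD.
  by move: (Num.floor _)%:~R => k; lra.
have cd : cos (2 * pi * d) = 1.
  have [-> _] : cos (2 * pi * d) = cos (2 * pi * (x - y)) /\ sin (2 * pi * d) = sin (2 * pi * (x - y)).
    have := cos_sin_int (2 * pi * (x - y)) (- Num.floor (x - y)).
    by rewrite -mulrDr intrN.
  by rewrite mulrBr cosB cxy sxy -!expr2 cos2Dsin2.
have sd : sin (pi * d) = 0.
  move: cd; rewrite (_ : 2 * pi * d = (pi * d) *+ 2); last by rewrite -mulr_natr; ring.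
  rewrite cos_mulr2n cos2sin2 => h; apply/eqP; rewrite -sqrf_eq0; apply/eqP; move: h.
  by rewrite -mulr_natr; lra.
have d0 : d = 0.
  case/andP: d01 => dge0 d1; move: dge0; rewrite le_eqVlt => /orP[/eqP <-//|dgt0].
  have : 0 < sin (pi * d).
    apply: sin_gt0_pi; rewrite mulr_gt0 ?pi_gt0//=.
    by rewrite -ltr_pdivlMl ?pi_gt0// mulVf// gt_eqF// pi_gt0.
  by rewrite sd ltxx.
apply/circle_piP; move/eqP: d0; rewrite subr_eq0 => /eqP ->.
exact: intr_int.
Qed.

Lemma circle_compact : compact [set: T].
Proof.
have -> : [set: T] = (@circle_pi R) @` `[0, 1].
  apply/seteqP; split => // t _; move: t; apply: circle_ind => x.
  exists (x - (Num.floor x)%:~R) => /=.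
    have := floorD1_gt x; have := floor_le x; rewrite in_itv /= intrD.
    by move: (Num.floor _)%:~R => k; lra.
  by apply/circle_piP; rewrite addrAC subrr sub0r rpredN intr_int.
apply: continuous_compact; last exact: segment_compact.
apply: continuous_subspaceT; exact: (@pi_continuous _ {eq_quot @circle_equiv R}%qT).
Qed.

End circle_basics.

(** * Density of Lipschitz functions *)

Section lipschitz.
Context (R : realType).
Local Notation T := (circle R).

(** The quotient carries only a topology; the chordal distance supplies a metric. Its square is a
    trigonometric polynomial of degree one, which the Poisson kernel integrates exactly
    ([poisson_chord2]). *)
Definition chord (s t : T) : R := normc (e_ 1 s - e_ 1 t).

Lemma chord_ge0 s t : 0 <= chord s t.
Proof. by rewrite /chord normc_sqrt sqrtr_ge0. Qed.
Lemma chord_sym s t : chord s t = chord t s.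
Proof. by rewrite /chord !normc_sqrt -opprB n2N. Qed.
Lemma chord_tri s t u : chord s u <= chord s t + chord t u.
Proof. by rewrite /chord -(subrKA (e_ 1 t)); exact: le_normcD. Qed.
Lemma chord_sqr s t : chord s t ^+ 2 = n2 (e_ 1 s - e_ 1 t).
Proof. exact: normc_n2. Qed.
Lemma chord_le2 s t : chord s t <= 2.
Proof.
rewrite -(ler_pXn2r (n := 2)) ?nnegrE ?chord_ge0// chord_sqr.
by rewrite (le_trans (n2D_le _ _))// n2N !n2_e; lra.
Qed.

Lemma chord_cont (t : T) : continuous (fun x : R => chord t (circle_pi x)).
Proof.
have [cr ci] := cont_e_pi R 1.
have -> : (fun x : R => chord t (circle_pi x)) = (fun x : R => Num.sqrt
   ((Re (e_ 1 t) - Re (e_ 1 (circle_pi x))) ^+ 2 +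
    (Im (e_ 1 t) - Im (e_ 1 (circle_pi x))) ^+ 2)).
  by apply/funext => x; rewrite /chord normc_sqrt /n2 !partsE.
move=> x; apply: continuous_comp; last exact: sqrt_continuous.
apply: cvgD; rewrite expr2; under eq_fun do rewrite expr2.
- by apply: cvgM; apply: cvgB; (exact: cvg_cst || exact: cr).
- by apply: cvgM; apply: cvgB; (exact: cvg_cst || exact: ci).
Qed.

Lemma chord_eq0 s t : chord s t = 0 -> s = t.
Proof.
move=> c0; apply: e_1_inj; apply/eqP; rewrite -subr_eq0 -n2_eq0 -chord_sqr c0.
by rewrite expr0n.
Qed.

Definition lip (g : T -> R) := exists L, 0 <= L /\ forall s t, `|g s - g t| <= L * chord s t.

Lemma lip_cst c : lip (fun=> c).
Proof. by exists 0; split => // s t; rewrite subrr normr0 mul0r. Qed.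
Lemma lipD g h : lip g -> lip h -> lip (fun t => g t + h t).
Proof.
move=> [L [L0 gL]] [M [M0 hM]]; exists (L + M); split; first exact: addr_ge0.
move=> s t; rewrite opprD addrACA mulrDl (le_trans (ler_normD _ _))//.
by rewrite lerD.
Qed.
Lemma lipZ c g : lip g -> lip (fun t => c * g t).
Proof.
move=> [L [L0 gL]]; exists (`|c| * L); split; first exact: mulr_ge0.
by move=> s t; rewrite -mulrBr normrM -mulrA ler_wpM2l.
Qed.
Definition clip (M x : R) : R := Num.max (- M) (Num.min M x).

Lemma clip_norm M x : 0 <= M -> `|clip M x| <= M.
Proof.
move=> M0; rewrite /clip ler_norml le_max lexx /= ge_max ge_min lexx /= andbT.
lra.
Qed.
Lemma clip_lip M x y : `|clip M x - clip M y| <= `|x - y|.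
Proof.
have h1 : x - y <= `|x - y| by exact: ler_norm.
have h2 : y - x <= `|x - y| by rewrite distrC ler_norm.
rewrite /clip; move: `|x - y| h1 h2 => n h1 h2; rewrite ler_norml.
by case: (lerP M x) => ?; case: (lerP M y) => ?; do 2?[case: (lerP (- M) _) => ?]; lra.
Qed.
Lemma clip_id M x : `|x| <= M -> clip M x = x.
Proof. by rewrite ler_norml => /andP[a b]; rewrite /clip min_r// max_r. Qed.
Lemma clip_sub M x : 0 <= M -> `|x - clip M x| <= `|x|.
Proof.
move=> M0; have h1 : x <= `|x| by exact: ler_norm.
have h2 : - x <= `|x| by rewrite -normrN ler_norm.
have h3 : 0 <= `|x| by [].
rewrite /clip; move: `|x| h1 h2 h3 => n h1 h2 h3; rewrite ler_norml.
case: (lerP M x) => ?; case: (lerP (- M) _) => ?; lra.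
Qed.
Lemma lip_clip M g : lip g -> lip (fun t => clip M (g t)).
Proof.
move=> [L [L0 gL]]; exists L; split => // s t.
exact: le_trans (clip_lip _ _ _) (gL s t).
Qed.

Lemma lip_meas g : lip g -> measurable_fun setT g.
Proof.
move=> [L [L0 gL]]; apply: circle_cont_meas => x.
apply/cvgrPdist_le => e e0 /=.
have /cvgrPdist_le := @chord_cont (circle_pi x) x.
have L1 : 0 < L + 1 by rewrite ltr_wpDl.
move=> /(_ (e / (L + 1))) []; first by rewrite divr_gt0.
move=> d d0 H; exists d => // y /= xy.
rewrite (le_trans (gL _ _))//.
have := H y xy; rewrite /= {1}/chord subrr Normc.normc0 sub0r normrN ger0_norm ?chord_ge0//.
rewrite ler_pdivlMr// => h; rewrite (le_trans _ h)// mulrC ler_wpM2l ?chord_ge0//.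
by rewrite lerDl.
Qed.

Lemma lip_bdd g : lip g -> exists2 M, 0 <= M & forall t, `|g t| <= M.
Proof.
move=> [L [L0 gL]]; exists (`|g point| + L * 2); first by rewrite addr_ge0// mulr_ge0.
move=> t; rewrite -[g t](subrK (g point)) addrC (le_trans (ler_normD _ _))// lerD2l.
by rewrite (le_trans (gL _ _))// ler_wpM2l// chord_le2.
Qed.

Lemma lip_rint (nu : {finite_measure set T -> \bar R}) g : lip g -> rint nu g.
Proof. by move=> lg; have [M M0 gM] := lip_bdd lg; apply: (@rint_bdd _ _ _ M) => //; exact: lip_meas. Qed.

Definition dist_set (A : set T) (t : T) : R := inf [set chord t s | s in A].

Lemma dist_set_le (A : set T) t s : A s -> dist_set A t <= chord t s.
Proof.
move=> As; apply: ge_inf; last by exists s.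
by exists 0 => _ [u _ <-]; exact: chord_ge0.
Qed.

Lemma dist_set_ge (A : set T) t c : A !=set0 -> (forall s, A s -> c <= chord t s) ->
  c <= dist_set A t.
Proof.
move=> [s As] H; apply: lb_le_inf; first by exists (chord t s), s.
by move=> _ [u Au <-]; exact: H.
Qed.

Lemma lip_dist_set (A : set T) : A !=set0 -> lip (dist_set A).
Proof.
move=> A0; exists 1; split => // s t; rewrite mul1r.
wlog : s t / dist_set A t <= dist_set A s.
  move=> H; have [|/ltW] := leP (dist_set A t) (dist_set A s); first exact: H.
  by move=> /H; rewrite distrC chord_sym.
move=> ts; rewrite ger0_norm ?subr_ge0// lerBlDr addrC -lerBlDr.
apply: dist_set_ge => // u Au; rewrite lerBlDr.
by rewrite (le_trans (dist_set_le s Au))// addrC chord_tri.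
Qed.

(** The complement of [U] is compact, so the set of its chord lengths from [t] is compact, hence
    closed; it omits 0 because chords separate points. *)
Lemma dist_set_gt0 (U : set T) t : open U -> ~` U !=set0 -> U t -> 0 < dist_set (~` U) t.
Proof.
move=> oU U0 Ut.
have cK : compact [set chord t s | s in ~` U].
  apply: continuous_compact; last first.
    by apply: (subclosed_compact _ (@circle_compact R)) => //; exact: open_closedC.
  apply: continuous_subspaceT.
  apply/(@quotient_continuous _ {eq_quot @circle_equiv R}%qT).
  exact: chord_cont.
have /closed_openC := compact_closed (@Rhausdorff R) cK.
rewrite openE => /(_ 0)[].
  by move=> [s Us /chord_eq0 ts]; apply: Us; rewrite -ts.
move=> e /= e0 H; apply: (lt_le_trans e0); apply: dist_set_ge => // s Us.
rewrite leNgt; apply/negP => lt; apply: (H (chord t s)); last by exists s.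
by rewrite /ball_ /= sub0r normrN ger0_norm ?chord_ge0.
Qed.
End lipschitz.

Import HBSimple.

(** * Approximation in L1 of a finite Borel measure *)

Section density.
Context (R : realType).
Local Notation T := (circle R).
Variable nu : {finite_measure set T -> \bar R}.
Implicit Types u v : T -> R.

Definition lipdense u := rint nu u /\
  forall e, 0 < e -> exists2 g, lip g & \int[nu]_t `|u t - g t| <= e.

Lemma lip_lipdense g : lip g -> lipdense g.
Proof.
move=> lg; split; first exact: lip_rint.
move=> e e0; exists g => //.
by rewrite (eq_Rintegral _ (g := fun=> 0)) => [|t _]; rewrite ?subrr ?normr0// /Rintegral integral0 ltW.
Qed.

Lemma L1_tri u v w : rint nu u -> rint nu v -> rint nu w ->
  \int[nu]_t `|u t - w t| <= \int[nu]_t `|u t - v t| + \int[nu]_t `|v t - w t|.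
Proof.
move=> ru rv rw; have r1 := rint_abs (rintB ru rv); have r2 := rint_abs (rintB rv rw).
rewrite -RintegralD//; apply: le_Rintegral => //; first exact: rint_abs (rintB ru rw).
- exact: rintD.
- by move=> t _; rewrite -(subrKA (v t)) ler_normD.
Qed.

Lemma lipdense_lim u : rint nu u ->
  (forall e, 0 < e -> exists2 v, lipdense v & \int[nu]_t `|u t - v t| <= e) -> lipdense u.
Proof.
move=> ru H; split => // e e0; have e2 : 0 < e / 2 by rewrite divr_gt0.
have [v [rv lv] uv] := H _ e2; have [g lg vg] := lv _ e2.
exists g => //; apply: (le_trans (L1_tri ru rv (lip_rint nu lg))).
by rewrite (splitr e) lerD.
Qed.

Lemma lipdenseD u v : lipdense u -> lipdense v -> lipdense (fun t => u t + v t).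
Proof.
move=> [ru lu] [rv lv]; split; first exact: rintD.
move=> e e0; have e2 : 0 < e / 2 by rewrite divr_gt0.
have [g lg ug] := lu _ e2; have [h lh vh] := lv _ e2.
exists (fun t => g t + h t); first exact: lipD.
have r1 := rint_abs (rintB ru (lip_rint nu lg)).
have r2 := rint_abs (rintB rv (lip_rint nu lh)).
rewrite (le_trans (y := \int[nu]_t (`|u t - g t| + `|v t - h t|)))//.
  apply: le_Rintegral => //; last by move=> t _; rewrite opprD addrACA ler_normD.
  - apply: rint_abs; apply: rintB; apply: rintD => //; exact: lip_rint.
  - exact: rintD.
by rewrite RintegralD// (splitr e) lerD.
Qed.

Lemma lipdenseZ c u : lipdense u -> lipdense (fun t => c * u t).
Proof.
move=> [ru lu]; split; first exact: rintZ.
move=> e e0; have c1 : 0 < `|c| + 1 by rewrite ltr_wpDl.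
have [g lg ug] := lu (e / (`|c| + 1)) (divr_gt0 e0 c1).
exists (fun t => c * g t); first exact: lipZ.
under eq_Rintegral do rewrite -mulrBr normrM.
rewrite RintegralZl//; last by apply: rint_abs; apply: rintB => //; exact: lip_rint.
rewrite ler_pdivlMr// in ug; rewrite (le_trans _ ug)// mulrC ler_wpM2l//.
  by apply: Rintegral_ge0.
by rewrite lerDl.
Qed.

Lemma lipdense_sum (I : Type) (r : seq I) (F : I -> T -> R) :
  (forall i, lipdense (F i)) -> lipdense (fun t => \sum_(i <- r) F i t).
Proof.
move=> lF; elim: r => [|i r IH].
  by under eq_fun do rewrite big_nil; exact: lip_lipdense (lip_cst 0).
by under eq_fun do rewrite big_cons; exact: lipdenseD.
Qed.

Lemma L1_lim (u : T -> R) (v : nat -> T -> R) (w : T -> R) :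
  (forall n, measurable_fun setT (v n)) -> measurable_fun setT u -> rint nu w ->
  (forall n t, `|v n t| <= w t) -> (forall t, v n t @[n --> \oo] --> u t) ->
  forall e, 0 < e -> exists n, \int[nu]_t `|u t - v n t| <= e.
Proof.
move=> mv mu_ rw vw vu e e0.
have [] := @dominated_convergence _ _ _ nu setT measurableT
   (fun n t => (v n t)%:E) (EFin \o u) (EFin \o w).
- by move=> n; exact/measurable_EFinP.
- exact/measurable_EFinP.
- apply: aeW => t _ /=; apply: cvg_EFin; last exact: vu.
  by near=> n.
- by [].
- by apply: aeW => t n _ /=; rewrite lee_fin.
move=> iu /fine_cvgP[fin /cvgrPdist_le /(_ _ e0)] /= H _.
have [N _ /(_ N (leqnn N)) HN] := H.
exists N; rewrite sub0r normrN in HN; apply: le_trans HN.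
rewrite (le_trans _ (ler_norm _))//.
rewrite /Rintegral; set a := integral _ _ _; set b := integral _ _ _.
suff -> : a = b by [].
by apply: eq_integral => t _ /=; rewrite distrC.
Unshelve. all: by end_near.
Qed.

Lemma indic_meas (A : set T) : measurable A -> measurable_fun setT (\1_A : T -> R).
Proof. by move=> mA; exact: measurable_indic. Qed.
Lemma indic_rint (A : set T) : measurable A -> rint nu (\1_A : T -> R).
Proof.
move=> mA; apply: (@rint_bdd _ _ _ 1); first exact: indic_meas.
by move=> t; rewrite indicE; case: (_ \in _); rewrite ?normr1 ?normr0.
Qed.

(** The indicator of [U] is the pointwise limit of the distance to the complement, multiplied by [n]
    and cut off at 1. *)
Lemma lipdense_open (U : set T) : open U -> lipdense (\1_U : T -> R).
Proof.
move=> oU; have mU := circle_measurable_open oU.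
(* If [U] is the whole circle, [dist_set] is an infimum over the empty set, a default value; that
   case is treated apart. *)
have [U0|/nonemptyPn U0] := pselect (~` U !=set0); last first.
  have -> : (\1_U : T -> R) = fun=> 1.
    apply/funext => t; rewrite indicE mem_set//.
    apply: contrapT => nU; have : (~` U) t by []. by rewrite U0.
  exact: lip_lipdense (lip_cst 1).
apply: lipdense_lim; first exact: indic_rint.
pose v n t := clip 1 (n%:R * dist_set (~` U) t) : R.
have lv n : lip (v n) by apply: lip_clip; apply: lipZ; exact: lip_dist_set.
move=> e e0; have := @L1_lim (\1_U) v (fun=> 1) _ (indic_meas mU) (rint_cst nu 1) _ _ e e0.
case.
- by move=> n; exact: lip_meas.
- by move=> n t; exact: clip_norm.
- move=> t; rewrite indicE; case: (boolP (t \in U)) => [/set_mem Ut|/negP tU] /=.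
    have d0 := dist_set_gt0 oU U0 Ut.
    have [k k0] : exists k : nat, (dist_set (~` U) t)^-1 <= k%:R.
      exists (Num.trunc (dist_set (~` U) t)^-1).+1.
      by apply/ltW/truncnS_gt.
    apply: cvg_near_cst; exists k => // n /= kn; rewrite /v /clip.
    rewrite min_l; first by rewrite max_r//; lra.
    rewrite -ler_pdivrMr// mul1r (le_trans k0)// ler_nat//.
  have -> : v ^~ t = fun=> 0; last exact: cvg_cst.
  apply/funext => n; rewrite /v (_ : dist_set _ _ = 0).
    by rewrite mulr0 clip_id// normr0.
  apply/eqP; rewrite eq_le; apply/andP; split.
    rewrite (le_trans (@dist_set_le _ _ t t _))//.
      by move=> Ut; apply: tU; exact: mem_set.
    by rewrite /chord subrr Normc.normc0.
  by apply: dist_set_ge => // s _; exact: chord_ge0.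
- by move=> n h; exists (v n) => //; exact: lip_lipdense.
Qed.

(** Dynkin's argument: the sets with approximable indicator form a Dynkin class, and the open sets
    are a generator stable under intersection. A countable disjoint union is reached through its
    finite partial unions, whose indicators are sums. *)
Lemma lipdense_indic (A : set T) : measurable A -> lipdense (\1_A : T -> R).
Proof.
move=> mA; pose G := [set A : set T | measurable A /\ lipdense (\1_A : T -> R)].
have dG : dynkin G.
  split.
  - split => //; have -> : (\1_setT : T -> R) = fun=> 1.
      by apply/funext => t; rewrite indicE mem_set.
    exact: lip_lipdense (lip_cst 1).
  - move=> B [mB lB]; split; first exact: measurableC.
    have -> : (\1_(~` B) : T -> R) = fun t => 1 + (-1) * \1_B t.
      by apply/funext => t; rewrite !indicE in_setC; case: (_ \in _) => /=; lra.
    by apply: lipdenseD; [exact: lip_lipdense (lip_cst 1)|exact: lipdenseZ].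
  - move=> F tF GF; have mF n : measurable (F n) by case: (GF n).
    have mU : measurable (\bigcup_n F n) by exact: bigcup_measurable.
    split => //; apply: lipdense_lim; first exact: indic_rint.
    pose B n := [set t | exists2 i, (i < n)%N & F i t].
    have mB n : measurable (B n).
      have -> : B n = \bigcup_(i in `I_n) F i.
        by apply/seteqP; split => t [i ? ?]; exists i.
      by apply: bigcup_measurable.
    have lB n : lipdense (\1_(B n) : T -> R).
      elim: n => [|n IH].
        have -> : (\1_(B 0) : T -> R) = fun=> 0.
          by apply/funext => t; rewrite indicE memNset// => -[].
        exact: lip_lipdense (lip_cst 0).
      have -> : (\1_(B n.+1) : T -> R) = fun t => \1_(B n) t + \1_(F n) t.
        apply/funext => t; rewrite !indicE.
        have [Fnt|Fnt] := boolP (t \in F n).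
          rewrite mem_set; last by exists n => //; exact: set_mem.
          rewrite memNset ?add0r// => -[i ni Fit].
          have ein : i = n by apply: (tF i n) => //; exists t; split => //; exact: set_mem.
          by move: ni; rewrite ein ltnn.
        rewrite addr0; congr (_%:R); congr nat_of_bool.
        apply/idP/idP => /set_mem[i ni Fit]; apply: mem_set; exists i => //.
          rewrite ltn_neqAle -ltnS ni andbT; apply: contraNneq Fnt => <-.
          exact: mem_set.
        exact: ltnW.
      by apply: lipdenseD => //; case: (GF n).
    move=> e e0; have := @L1_lim (\1_(\bigcup_n F n)) (fun n => \1_(B n)) (fun=> 1) _
      (indic_meas mU) (rint_cst nu 1) _ _ e e0.
    case.
    + by move=> n; exact: indic_meas.
    + by move=> n t; rewrite indicE; case: (_ \in _); rewrite ?normr1 ?normr0.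
    + move=> t; rewrite indicE; have [/set_mem[k _ Fk]|nt] := boolP (t \in _).
        apply: cvg_near_cst; exists k.+1 => // n /= kn.
        by rewrite indicE mem_set//; exists k.
      rewrite (_ : (fun n => _) = fun=> 0); first exact: cvg_cst.
      apply/funext => n; rewrite indicE memNset// => -[i _ Fi].
      by move/negP: nt; apply; apply: mem_set; exists i.
    + by move=> n h; exists (\1_(B n)).
have sub : (<<s @circle_open R >>) `<=` G.
  rewrite -setI_closed_g_dynkin_g_sigma_algebra; last first.
    by move=> B D; exact: openI.
  apply: smallest_sub => //.
  by move=> B oB; split; [exact: circle_measurable_open|exact: lipdense_open].
by have [] := sub A mA.
Qed.

Lemma rint_lipdense u : rint nu u -> lipdense u.
Proof.
move=> ru; apply: lipdense_lim => // e e0.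
have [g_ [ig _ /fine_cvgP[_ /cvgrPdist_le /(_ _ e0)]]] :=
  approximation_sfun_integrable measurableT ru.
move=> [N _ /(_ N (leqnn N))] /=; rewrite sub0r normrN => H.
exists (fun t : T => g_ N t); last by apply: le_trans H; rewrite (le_trans _ (ler_norm _)).
have E t := fimfunEord (g_ N) t.
rewrite (funext E) /=.
apply: lipdense_sum => y; apply: lipdenseZ; apply: lipdense_indic.
exact: measurable_sfunP.
Qed.
End density.

(** * Herglotz and Poisson integrals *)

Section modulus.
Context (R : realType).
Implicit Types z w a b : R[i].

Lemma normc_ge0 z : 0 <= normc z. Proof. by rewrite normc_sqrt sqrtr_ge0. Qed.
Lemma normcD z w : normc (z + w) <= normc z + normc w. Proof. exact: le_normcD. Qed.
Lemma normc_opp z : normc (- z) = normc z. Proof. by rewrite !normc_sqrt n2N. Qed.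
Lemma normcB z w : normc (z - w) <= normc z + normc w.
Proof. by rewrite -(normc_opp w) normcD. Qed.
Lemma normc_dist z w : normc (z - w) = normc (w - z).
Proof. by rewrite -opprB normc_opp. Qed.
Lemma normc_mul z w : normc (z * w) = normc z * normc w. Proof. exact: Normc.normcM. Qed.
Lemma normc_real (x : R) : normc x%:C = `|x|.
Proof. by rewrite normc_sqrt n2C sqrtr_sqr. Qed.
Lemma normc_exp z k : normc (z ^+ k) = normc z ^+ k.
Proof. by elim: k => [|k IH]; rewrite ?expr0 ?Normc.normc1// !exprS normc_mul IH. Qed.
Lemma normc_conj z : normc z^* = normc z. Proof. by rewrite !normc_sqrt n2conj. Qed.
Lemma normc_eq0 z : (normc z == 0) = (z == 0).
Proof. by rewrite -n2_eq0 -normc_n2 sqrf_eq0. Qed.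
Lemma Re_normc z : `|Re z| <= normc z.
Proof. by rewrite normc_sqrt -sqrtr_sqr ler_wsqrtr// Re_n2. Qed.
Lemma Im_normc z : `|Im z| <= normc z.
Proof. by rewrite normc_sqrt -sqrtr_sqr ler_wsqrtr// Im_n2. Qed.
Lemma n2_le_normc z (c : R) : 0 <= c -> (n2 z <= c ^+ 2) = (normc z <= c).
Proof. by move=> c0; rewrite -normc_n2 ler_pXn2r ?nnegrE// normc_ge0. Qed.
Lemma normc_sum (I : Type) (r : seq I) (F : I -> R[i]) :
  normc (\sum_(i <- r) F i) <= \sum_(i <- r) normc (F i).
Proof.
elim: r => [|i r IH]; first by rewrite !big_nil Normc.normc0.
by rewrite !big_cons (le_trans (normcD _ _))// lerD2l.
Qed.

(** Telescoping, where [1 <= m] allows the single factor [m ^+ n] to dominate every mixed product.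
    In [adisc_cexp] it is used with [m ^+ n] bounded independently of [n], in [adisc_cvg] with
    [m = 1]. *)
Lemma normc_expB a b (m : R) n : 1 <= m -> normc a <= m -> normc b <= m ->
  normc (a ^+ n - b ^+ n) <= n%:R * m ^+ n * normc (a - b).
Proof.
move=> m1 am bm; have m0 : 0 <= m by rewrite (le_trans _ m1).
elim: n => [|n IH]; first by rewrite !expr0 subrr Normc.normc0 !mul0r.
have -> : a ^+ n.+1 - b ^+ n.+1 = a * (a ^+ n - b ^+ n) + (a - b) * b ^+ n.
  by rewrite !exprS; ring.
rewrite (le_trans (normcD _ _))// !normc_mul normc_exp -natr1 mulrDl mul1r mulrDl.
apply: lerD.
  rewrite exprS mulrCA -mulrA; apply: ler_pM => //; first exact: normc_ge0.
    exact: normc_ge0.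
rewrite mulrC ler_wpM2r ?normc_ge0//.
apply: (@le_trans _ _ (m ^+ n)); first by rewrite lerXn2r ?nnegrE ?normc_ge0.
by rewrite exprS ler_peMl// exprn_ge0.
Qed.
End modulus.

Section complex_exponential.
Context (R : realType).
Implicit Types z w : R[i].

Lemma cexpE z : cexp z = (expR (Re z) * cos (Im z) +i* (expR (Re z) * sin (Im z)))%C.
Proof. by case: z => x y; apply: complexP; rewrite /cexp !partsE; ring. Qed.
Lemma cexpD z w : cexp (z + w) = cexp z * cexp w.
Proof.
rewrite !cexpE ReD ImD expRD cosD sinD.
by apply: complexP; rewrite !partsE; ring.
Qed.
Lemma cexp0 : cexp (0 : R[i]) = 1.
Proof. by rewrite cexpE /= expR0 cos0 sin0 mulr1 mulr0. Qed.
Lemma normc_cexp z : normc (cexp z) = expR (Re z).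
Proof.
rewrite normc_sqrt cexpE /n2 /= !exprMn -mulrDr cos2Dsin2 mulr1 sqrtr_sqr.
by rewrite ger0_norm ?expR_ge0.
Qed.
Lemma cexpMn z n : cexp (z *+ n) = cexp z ^+ n.
Proof. by elim: n => [|n IH]; rewrite ?mulr0n ?cexp0// mulrS cexpD IH exprS. Qed.
Lemma cexp_real (x : R) : cexp x%:C = (expR x)%:C.
Proof. by rewrite cexpE /= cos0 sin0 mulr1 mulr0. Qed.
Lemma sin_le_norm (y : R) : `|sin y| <= `|y|.
Proof.
wlog y0 : y / 0 <= y.
  move=> H; have [/H//|y0] := leP 0 y.
  by rewrite -normrN -sinN -(normrN y) H// oppr_ge0 ltW.
have [->|yn0] := eqVneq y 0; first by rewrite sin0.
have yp : 0 < y by rewrite lt_neqAle eq_sym yn0.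
have [c _] := @MVT R sin cos 0 y yp (fun x _ => is_derive_sin x)
  (continuous_subspaceT (@continuous_sin R)).
by rewrite sin0 !subr0 => ->; rewrite normrM ler_piMl// cos_max.
Qed.

Lemma cos_sub1 (y : R) : `|1 - cos y| <= y ^+ 2.
Proof.
have -> : 1 - cos y = 2 * sin (y / 2) ^+ 2.
  rewrite [in cos y](_ : y = y / 2 *+ 2); last by rewrite -mulr_natr mulfVK// pnatr_eq0.
  by rewrite cos_mulr2n cos2sin2 -mulr_natr; ring.
rewrite ger0_norm; last by rewrite mulr_ge0// sqr_ge0.
have := sin_le_norm (y / 2); rewrite -(ler_pXn2r (n := 2)) ?nnegrE// !real_normK ?num_real//.
have := sqr_ge0 y; rewrite exprMn exprVn; lra.
Qed.

Lemma sin_sub (y : R) : `|y| <= 1 -> `|sin y - y| <= y ^+ 2.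
Proof.
wlog y0 : y / 0 <= y.
  move=> H; have [/H//|y0] := leP 0 y => y1.
  have := H (- y); rewrite sinN sqrrN normrN -opprD normrN; apply => //.
  by rewrite oppr_ge0 ltW.
rewrite ger0_norm// => y1.
have [->|yn0] := eqVneq y 0; first by rewrite sin0 subrr normr0 sqr_ge0.
have yp : 0 < y by rewrite lt_neqAle eq_sym yn0.
have [c] := @MVT R sin cos 0 y yp (fun x _ => is_derive_sin x)
  (continuous_subspaceT (@continuous_sin R)).
rewrite in_itv /= sin0 !subr0 => /andP[c0 cy] ->.
rewrite -{2}[y]mul1r -mulrBl normrM (ger0_norm y0) distrC.
rewrite expr2 ler_wpM2r// (le_trans (cos_sub1 c))// expr2.
nra.
Qed.

(** Both sides come from [1 + x <= expR x]: at [x] it gives the sign of the remainder, and at [- x]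
    it gives [expR x * (1 - x) <= 1]. *)
Lemma expR_sub (x : R) : `|x| <= 2^-1 -> `|expR x - 1 - x| <= 2 * x ^+ 2.
Proof.
rewrite ler_norml => /andP[xl xr].
have h1 := expR_ge1Dx x; have h2 := expR_ge1Dx (- x).
have h3 : expR x * expR (- x) = 1 by rewrite -expRD subrr expR0.
have h0 := expR_gt0 x.
have h4 : expR x * (1 - x) <= 1 by rewrite -[leRHS]h3 ler_wpM2l// ltW.
rewrite ger0_norm; last by lra.
have : (expR x - 1 - x) * (1 - x) <= x ^+ 2 by rewrite expr2; lra.
move=> h5; have : (expR x - 1 - x) * 2^-1 <= (expR x - 1 - x) * (1 - x).
  by rewrite ler_wpM2l//; lra.
lra.
Qed.

Lemma cexp_sub w : normc w <= 2^-1 -> normc (cexp w - 1 - w) <= 16 * normc w ^+ 2.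
Proof.
move=> w2; rewrite normc_n2 -(@normc_n2 _ w) normc_n2.
have xw := le_trans (Re_normc w) w2; have yw := le_trans (Im_normc w) w2.
have y1 : `|Im w| <= 1 by rewrite (le_trans yw)//; lra.
rewrite /n2; set x := Re w in xw *; set y := Im w in yw y1 *.
have e1 := expR_sub xw; have c1 := cos_sub1 y; have s1 := sin_sub y1.
have ex : expR x <= 2.
  have := sqr_ge0 x; have : x ^+ 2 <= 2^-1 * 2^-1.
    by rewrite -real_normK ?num_real// expr2 ler_pM.
  move: e1 xw; rewrite !ler_norml; lra.
have e0 := expR_gt0 x.
have -> : cexp w - 1 - w = ((expR x - 1 - x) + expR x * (cos y - 1))%:C +
    'i%C * ((expR x * (sin y - y)) + (expR x - 1) * y)%:C.
  rewrite cexpE -/x -/y; apply: complexP; rewrite !partsE ?(_ : Re 1 = 1) // ?(_ : Im 1 = 0) // -/x -/y; ring.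
rewrite (le_trans (normcD _ _))// normc_mul !normc_real.
have -> : normc ('i%C : R[i]) = 1 by rewrite normc_sqrt /n2 /= expr0n expr1n add0r sqrtr1.
rewrite mul1r.
have a1 : `|expR x - 1 - x + expR x * (cos y - 1)| <= 2 * x ^+ 2 + 2 * y ^+ 2.
  rewrite (le_trans (ler_normD _ _))// lerD// normrM (ger0_norm (ltW e0)).
  by rewrite distrC ler_pM// ltW.
have xx : `|expR x - 1| <= 2 * `|x|.
  rewrite -(subrK x (expR x - 1)) (le_trans (ler_normD _ _))//.
  rewrite (le_trans (lerD e1 (lexx _)))// -(real_normK (num_real x)) expr2.
  have := ler_wpM2r (normr_ge0 x) xw; lra.
have a2 : `|expR x * (sin y - y) + (expR x - 1) * y| <= 2 * y ^+ 2 + 2 * (`|x| * `|y|).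
  rewrite (le_trans (ler_normD _ _))// !normrM (ger0_norm (ltW e0)).
  apply: lerD; first by rewrite ler_pM// ltW.
  by rewrite mulrA ler_wpM2r.
rewrite (le_trans (lerD a1 a2))//.
rewrite -(real_normK (num_real x)) -(real_normK (num_real y)).
have := sqr_ge0 (`|x| - `|y|); have := sqr_ge0 `|x|; have := sqr_ge0 `|y|; nra.
Qed.
End complex_exponential.

(** * Locally uniform limits of polynomials on the disc *)

Section disc_analytic.
Context (R : realType).
Implicit Types (f g : R[i] -> R[i]) (p q : {poly R[i]}) (z : R[i]).

(* Stands in for holomorphy on the open unit disc. *)
Definition adisc g := forall rho, 0 <= rho -> rho < 1 -> forall e, 0 < e ->
  exists p, forall z, normc z <= rho -> normc (g z - p.[z]) <= e.

Lemma poly_bdd p (rho : R) : 0 <= rho -> exists2 M, 0 <= M & forall z, normc z <= rho -> normc p.[z] <= M.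
Proof.
move=> r0; exists (\sum_(i < size p) normc p`_i * rho ^+ i).
  by apply: sumr_ge0 => i _; rewrite mulr_ge0 ?normc_ge0 ?exprn_ge0.
move=> z zr; rewrite horner_coef (le_trans (normc_sum _ _))//.
apply: ler_sum => i _; rewrite normc_mul normc_exp ler_wpM2l ?normc_ge0//.
by rewrite lerXn2r ?nnegrE ?normc_ge0.
Qed.

Lemma adisc_bdd g rho : adisc g -> 0 <= rho -> rho < 1 ->
  exists2 M, 0 <= M & forall z, normc z <= rho -> normc (g z) <= M.
Proof.
move=> ag r0 r1; have [p gp] := ag _ r0 r1 1 ltr01.
have [M M0 pM] := poly_bdd p r0; exists (1 + M); first by rewrite addr_ge0.
move=> z zr; rewrite -(subrK p.[z] (g z)) (le_trans (normcD _ _))//.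
by rewrite lerD ?gp ?pM.
Qed.

Lemma adisc_poly p : adisc (horner p).
Proof. by move=> rho _ _ e e0; exists p => z _; rewrite subrr Normc.normc0 ltW. Qed.

Lemma adisc_cst c : adisc (fun=> c).
Proof. by have := adisc_poly c%:P; rewrite (_ : horner _ = fun=> c)//; apply/funext => z; rewrite hornerC. Qed.

Lemma adiscD f g : adisc f -> adisc g -> adisc (fun z => f z + g z).
Proof.
move=> af ag rho r0 r1 e e0; have e2 : 0 < e / 2 by rewrite divr_gt0.
have [p fp] := af _ r0 r1 _ e2; have [q gq] := ag _ r0 r1 _ e2.
exists (p + q) => z zr; rewrite hornerD opprD addrACA (le_trans (normcD _ _))//.
by rewrite (splitr e) lerD ?fp ?gq.
Qed.

Lemma adiscM f g : adisc f -> adisc g -> adisc (fun z => f z * g z).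
Proof.
move=> af ag rho r0 r1 e e0.
have [M M0 gM] := adisc_bdd ag r0 r1.
have [p fp] : exists p, forall z, normc z <= rho -> normc (f z - p.[z]) <= e / 2 / (M + 1).
  by apply: af => //; rewrite !divr_gt0// ltr_wpDl.
(* The order matters: the accuracy required of [q] depends on a bound for the polynomial [p] already
   chosen. *)
have [N N0 pN] := poly_bdd p r0.
have [q gq] : exists q, forall z, normc z <= rho -> normc (g z - q.[z]) <= e / 2 / (N + 1).
  by apply: ag => //; rewrite !divr_gt0// ltr_wpDl.
exists (p * q) => z zr; rewrite hornerM.
have -> : f z * g z - p.[z] * q.[z] = (f z - p.[z]) * g z + p.[z] * (g z - q.[z]) by ring.
rewrite (le_trans (normcD _ _))// !normc_mul (splitr e).
have e2 : 0 < e / 2 by rewrite divr_gt0.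
apply: lerD.
  rewrite (le_trans (y := e / 2 / (M + 1) * M))//.
    by rewrite ler_pM ?normc_ge0 ?fp ?gM.
  by rewrite mulrAC ler_pdivrMr ?ltr_wpDl// ler_wpM2l// ?ltW// ltrDl.
rewrite (le_trans (y := N * (e / 2 / (N + 1))))//.
  by rewrite ler_pM ?normc_ge0 ?gq ?pN.
by rewrite mulrA ler_pdivrMr ?ltr_wpDl// mulrC ler_wpM2l// ?ltW// ltrDl.
Qed.

Lemma adiscX f n : adisc f -> adisc (fun z => f z ^+ n).
Proof.
move=> af; elim: n => [|n IH]; first exact: adisc_cst.
by rewrite (_ : (fun z => _) = fun z => f z * f z ^+ n); [exact: adiscM|apply/funext => z; rewrite exprS].
Qed.

Lemma adisc_lim g : (forall rho, 0 <= rho -> rho < 1 -> forall e, 0 < e ->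
    exists2 f, adisc f & forall z, normc z <= rho -> normc (g z - f z) <= e) -> adisc g.
Proof.
move=> H rho r0 r1 e e0; have e2 : 0 < e / 2 by rewrite divr_gt0.
have [f af gf] := H _ r0 r1 _ e2; have [p fp] := af _ r0 r1 _ e2.
exists p => z zr; rewrite -(subrKA (f z)) (le_trans (normcD _ _))//.
by rewrite (splitr e) lerD ?fp ?gf.
Qed.

(* [exp w] is the limit of [(1 + w / n)^n], uniformly for bounded [w]. *)
Lemma adisc_cexp g : adisc g -> adisc (fun z => cexp (g z)).
Proof.
move=> ag; apply: adisc_lim => rho r0 r1 e e0.
have [M M0 gM] := adisc_bdd ag r0 r1.
pose K := 16 * M ^+ 2 * expR M.
have K0 : 0 <= K by rewrite !mulr_ge0 ?sqr_ge0 ?expR_ge0.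
(* [2 * M <= n] brings [w] into the range of [cexp_sub]. The final error is [K / n]: the quadratic
   remainder [16 * (M / n) ^+ 2], times the [n] factors of the telescoping, times the growth
   [expR M]. *)
pose n := (maxn (Num.trunc (2 * M)) (Num.trunc (K / e))).+1.
have n0 : 0 < n%:R :> R by rewrite ltr0n.
have n1 : 2 * M <= n%:R.
  by rewrite ltW// (lt_le_trans (truncnS_gt _))// ler_nat ltnS leq_maxl.
have n2 : K / e <= n%:R.
  by rewrite ltW// (lt_le_trans (truncnS_gt _))// ler_nat ltnS leq_maxr.
exists (fun z => (1 + (n%:R^-1)%:C * g z) ^+ n).
  apply: adiscX; apply: adiscD; first exact: adisc_cst.
  by apply: adiscM => //; exact: adisc_cst.
move=> z zr; set w := (n%:R^-1)%:C * g z.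
have wM : normc w <= M / n%:R.
  rewrite normc_mul normc_real ger0_norm ?invr_ge0// mulrC ler_wpM2r ?invr_ge0//.
  exact: gM.
have w2 : normc w <= 2^-1.
  rewrite (le_trans wM)// ler_pdivrMr// mulrC ler_pdivlMr//; lra.
have -> : cexp (g z) = cexp w ^+ n.
  rewrite -cexpMn; congr cexp; rewrite -[w *+ n]mulr_natl /w mulrA.
  rewrite (_ : n%:R = (n%:R : R)%:C); last by rewrite rmorph_nat.
  by rewrite -rmorphM /= mulfV ?gt_eqF// mul1r.
have a1 : normc (cexp w) <= expR (M / n%:R).
  by rewrite normc_cexp ler_expR (le_trans (ler_norm _))// (le_trans (Re_normc _)).
have a2 : normc (1 + w) <= expR (M / n%:R).
  rewrite (le_trans (normcD _ _))// Normc.normc1 (le_trans (expR_ge1Dx _))//.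
  by rewrite ler_expR.
have m1 : 1 <= expR (M / n%:R).
  by rewrite -expR0 ler_expR divr_ge0// ltW.
rewrite (le_trans (normc_expB n m1 a1 a2))// -expRM_natl.
rewrite opprD addrA (le_trans (ler_wpM2l _ (cexp_sub w2)))//.
have -> : n%:R * (M / n%:R) = M by rewrite mulrC mulfVK// gt_eqF.
have w3 : normc w ^+ 2 <= M ^+ 2 / n%:R ^+ 2.
  by rewrite -expr_div_n lerXn2r ?nnegrE ?normc_ge0 ?divr_ge0// ltW.
rewrite (le_trans (y := n%:R * expR M * (16 * (M ^+ 2 / n%:R ^+ 2))))//.
  by apply: ler_wpM2l; [rewrite mulr_ge0 ?expR_ge0// ltW|exact: ler_wpM2l].
have -> : n%:R * expR M * (16 * (M ^+ 2 / n%:R ^+ 2)) = K / n%:R.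
  by rewrite /K; field; rewrite gt_eqF.
by rewrite ler_pdivrMr// mulrC -ler_pdivrMr.
Qed.
End disc_analytic.

(** * The Herglotz and Poisson kernels *)

Section herglotz.
Context (R : realType).
Local Notation T := (circle R).
Local Notation lambda := (@circle_lebesgue R).
Local Notation C := R[i].
Implicit Types (z : C) (f : T -> C) (s t : T).

Definition ker z s : C := (e_ 1 s + z) / (e_ 1 s - z).
Definition herglotz f z : C := cintegral lambda (fun s => ker z s * f s).
Definition poisson_ker z s : R := Re (ker z s).

Lemma normc_e n s : normc (e_ n s) = 1.
Proof. by rewrite normc_sqrt n2_e sqrtr1. Qed.
Lemma e_sub_neq0 z s : normc z < 1 -> e_ 1 s - z != 0.
Proof.
by move=> z1; apply: contraTneq z1 => /eqP; rewrite subr_eq0 => /eqP <-; rewrite normc_e ltxx.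
Qed.
Lemma normc_e_sub z s : 1 - normc z <= normc (e_ 1 s - z).
Proof. by rewrite lerBlDr -(normc_e 1 s) -{1}(subrK z (e_ 1 s)) normcD. Qed.

Lemma kerE z s : normc z < 1 -> ker z s = 1 + 2 * (z / (e_ 1 s - z)).
Proof. by move=> /(e_sub_neq0 s) h; rewrite /ker; field. Qed.

Lemma e_neq0 n s : e_ n s != 0 :> C.
Proof. by rewrite -n2_eq0 n2_e oner_eq0. Qed.

(** A finite geometric series with its exact remainder, so that no sum has to be exchanged with an
    integral; the remainder is uniformly small for [z] in a smaller disc. *)
Lemma ker_expand N z s : normc z < 1 ->
  ker z s = 1 + 2 * (\sum_(i < N) z ^+ i.+1 * (e_ (Posz i.+1) s)^*)
    + 2 * (z ^+ N.+1 * (e_ (Posz N) s)^* / (e_ 1 s - z)).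
Proof.
move=> z1; have h := e_sub_neq0 s z1; elim: N => [|N IH].
  by rewrite big_ord0 mulr0 addr0 expr1 e_0 conjR mulr1 kerE.
rewrite IH big_ord_recr /= mulrDr !addrA -!addrA; congr (_ + (_ + _)).
rewrite -mulrDr; congr (_ * _).
have -> : (e_ (Posz N) s)^* = (e_ (Posz N.+1) s)^* * e_ 1 s.
  rewrite -addn1 PoszD e_D conjM -mulrA [_ * e_ 1 s]mulrC e_conj mulr1 //.
by rewrite [z ^+ N.+2]exprS; field.
Qed.

Lemma ker_meas z : normc z < 1 -> cmeas (ker z).
Proof.
move=> z1; have -> : ker z = fun s => (e_ 1 s + z) * ((n2 (e_ 1 s - z))^-1%:C * (e_ 1 s - z)^*).
  apply/funext => s; rewrite /ker; congr (_ * _).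
  have h := e_sub_neq0 s z1; apply: (mulfI h); rewrite mulfV// mulrCA mul_conj.
  by rewrite -rmorphM /= mulVf ?n2_eq0.
have m1 : cmeas (fun s => e_ 1 s + z) by apply: cmeasD; [exact: cmeas_e|exact: cmeas_cst].
have m2 : cmeas (fun s => e_ 1 s - z) by apply: cmeasD; [exact: cmeas_e|exact: cmeas_cst].
apply: cmeasM => //; apply: cmeasM; last exact: cmeas_conj.
apply: cmeas_real; apply: circle_cont_meas.
have -> : (fun s : T => (n2 (e_ 1 s - z))^-1) \o (@circle_pi R) = fun x : R =>
    ((Re (e_ 1 (circle_pi x)) - Re z) * (Re (e_ 1 (circle_pi x)) - Re z) +
     (Im (e_ 1 (circle_pi x)) - Im z) * (Im (e_ 1 (circle_pi x)) - Im z))^-1.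
  by apply/funext => x; rewrite [LHS]/comp /n2 !expr2 !(ReD, ImD, ReN, ImN).
have [cr ci] := cont_e_pi R 1; move=> x; apply: (@cvgV R R).
  have := e_sub_neq0 (circle_pi x) z1; rewrite -n2_eq0 /n2 !expr2.
  by rewrite !(ReD, ImD, ReN, ImN).
apply: cvgD; apply: cvgM; apply: cvgB; (exact: cvg_cst || exact: cr || exact: ci).
Qed.

Lemma ker_le z s : normc z < 1 -> normc (ker z s) <= 2 / (1 - normc z).
Proof.
move=> z1; have d0 : 0 < 1 - normc z by rewrite subr_gt0.
have d1 := lt_le_trans d0 (normc_e_sub z s).
rewrite /ker normc_mul Normc.normcV ler_pM ?normc_ge0 ?invr_ge0 ?normc_ge0//.
  by rewrite (le_trans (normcD _ _))// normc_e; lra.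
by rewrite lef_pV2 ?posrE// normc_e_sub.
Qed.

Lemma cintM_bdd f (k : T -> C) (M : R) : cint lambda f -> cmeas k ->
  (forall s, normc (k s) <= M) -> cint lambda (fun s => k s * f s).
Proof.
move=> cf mk kM; have [a b] := cint_meas cf.
apply: (@cint_le _ _ _ _ _ (fun s => M * normc (f s))).
- by apply: cmeasM => //; exact: cint_meas cf.
- move=> s; rewrite n2_le_normc.
    by rewrite normc_mul ler_wpM2r ?normc_ge0.
  by rewrite mulr_ge0 ?normc_ge0// (le_trans (normc_ge0 _) (kM s)).
- by move=> s; rewrite mulr_ge0 ?normc_ge0// (le_trans (normc_ge0 _) (kM s)).
- apply: rintZ; under eq_fun do rewrite normc_sqrt; exact: cint_normc.
Qed.

Definition L1norm f : R := \int[lambda]_s normc (f s).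
Lemma L1norm_ge0 f : 0 <= L1norm f.
Proof. by apply: Rintegral_ge0 => t _; exact: normc_ge0. Qed.
Lemma normc_cintegral f : cint lambda f -> normc (cintegral lambda f) <= L1norm f.
Proof.
move=> cf; rewrite -n2_le_normc ?L1norm_ge0// (le_trans (n2_cintegral_le cf))//.
rewrite (_ : L1norm f = \int[lambda]_t Num.sqrt (n2 (f t)))//.
by apply: eq_Rintegral => s _; rewrite normc_sqrt.
Qed.

Lemma normc_cintegralM f (k : T -> C) (M : R) : cint lambda f -> cmeas k ->
  (forall s, normc (k s) <= M) ->
  normc (cintegral lambda (fun s => k s * f s)) <= M * L1norm f.
Proof.
move=> cf mk kM; rewrite (le_trans (normc_cintegral (cintM_bdd cf mk kM)))//.
rewrite /L1norm -RintegralZl//; last first.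
  under eq_fun do rewrite normc_sqrt; exact: cint_normc.
apply: le_Rintegral => //.
- by under eq_fun do rewrite normc_sqrt; exact: cint_normc (cintM_bdd cf mk kM).
- by apply: rintZ; under eq_fun do rewrite normc_sqrt; exact: cint_normc.
- by move=> s _; rewrite normc_mul ler_wpM2r ?normc_ge0.
Qed.

Lemma fourier_cint f n : cint lambda f -> cint lambda (fun s => f s * (e_ n s)^*).
Proof.
move=> cf; have := @cintM_bdd f (fun s => (e_ n s)^*) 1 cf.
rewrite (_ : (fun s => _ * f s) = fun s => f s * (e_ n s)^*); last by apply/funext => s; rewrite mulrC.
apply; first exact: cmeas_conj (cmeas_e _ _).
by move=> s; rewrite normc_conj normc_e.
Qed.

Lemma herglotz_expand N f z : cint lambda f -> normc z < 1 ->
  normc (herglotz f z - (fourier_coef f 0 + 2 * \sum_(i < N) fourier_coef f (Posz i.+1) * z ^+ i.+1))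
  <= 2 * normc z ^+ N.+1 / (1 - normc z) * L1norm f.
Proof.
move=> cf z1; pose rem s := 2 * (z ^+ N.+1 * (e_ (Posz N) s)^* / (e_ 1 s - z)) : C.
pose main s := 1 + 2 * (\sum_(i < N) z ^+ i.+1 * (e_ (Posz i.+1) s)^*) : C.
have cmain : cint lambda (fun s => main s * f s).
  have -> : (fun s => main s * f s) = fun s => f s + 2 * \sum_(i < N) (z ^+ i.+1 * (f s * (e_ (Posz i.+1) s)^*)).
    apply/funext => s; rewrite /main mulrDl mul1r -mulrA mulr_suml; congr (_ + _ * _).
    by apply: eq_bigr => i _; ring.
  apply: cintD => //; apply: cintZ; apply: cint_sum => i; apply: cintZ.
  exact: fourier_cint.
have mrem : cmeas rem.
  have -> : rem = fun s => ker z s - main s.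
    by apply/funext => s; rewrite (ker_expand N)// /main /rem; ring.
  apply: cmeasD; first exact: ker_meas.
  apply: cmeasN; apply: cmeasD; first exact: cmeas_cst.
  apply: cmeasM; first exact: cmeas_cst.
  apply: cmeas_sum => i; apply: cmeasM; first exact: cmeas_cst.
  by apply: cmeas_conj; exact: cmeas_e.
have d0 : 0 < 1 - normc z by rewrite subr_gt0.
have brem s : normc (rem s) <= 2 * normc z ^+ N.+1 / (1 - normc z).
  rewrite /rem !normc_mul normc_exp normc_conj normc_e mulr1 Normc.normcV.
  rewrite (_ : normc 2 = 2) ?mulrA; last first.
    by rewrite (_ : 2 = (2 : R)%:C) ?normc_real ?ger0_norm// rmorph_nat.
  rewrite ler_wpM2l ?mulr_ge0 ?exprn_ge0 ?normc_ge0// lef_pV2 ?posrE ?normc_e_sub//.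
  exact: lt_le_trans d0 (normc_e_sub z s).
have -> : herglotz f z = cintegral lambda (fun s => main s * f s) + cintegral lambda (fun s => rem s * f s).
  rewrite -cintegralD//; last exact: cintM_bdd brem.
  by apply: eq_cintegral => s; rewrite (ker_expand N)// mulrDl.
have -> : cintegral lambda (fun s => main s * f s) = fourier_coef f 0 + 2 * \sum_(i < N) fourier_coef f (Posz i.+1) * z ^+ i.+1.
  transitivity (cintegral lambda (fun s => f s * (e_ 0 s)^* + 2 * \sum_(i < N) (z ^+ i.+1 * (f s * (e_ (Posz i.+1) s)^*)))).
    apply: eq_cintegral => s; rewrite /main e_0 conjR mulr1 mulrDl mul1r -mulrA mulr_suml; congr (_ + _ * _).
    by apply: eq_bigr => i _; ring.
  rewrite cintegralD ?cintegralZ ?cintegral_sum//.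
  - congr (_ + _ * _); apply: eq_bigr => i _.
    by rewrite cintegralZ; [rewrite -/(fourier_coef f (Posz i.+1)) mulrC|exact: fourier_cint].
  - by move=> i; apply: cintZ; exact: fourier_cint.
  - by apply: cint_sum => i; apply: cintZ; exact: fourier_cint.
  - exact: fourier_cint.
  - by apply: cintZ; apply: cint_sum => i; apply: cintZ; exact: fourier_cint.
by rewrite addrAC subrr add0r normc_cintegralM.
Qed.

Lemma expr_small (rho K e : R) : 0 <= rho -> rho < 1 -> 0 <= K -> 0 < e ->
  exists N, K * rho ^+ N.+1 <= e.
Proof.
move=> r0 r1 K0 e0.
have : (rho ^+ n) @[n --> \oo] --> 0 by apply: cvg_expr; rewrite ger0_norm.
move=> /cvgrPdist_le /(_ (e / (K + 1))) []; first by rewrite divr_gt0// ltr_wpDl.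
move=> N _ /(_ N.+1 (leqnSn N)); rewrite sub0r normrN ger0_norm ?exprn_ge0// => h.
exists N; rewrite ler_pdivlMr ?ltr_wpDl// in h; rewrite (le_trans _ h)// mulrC.
by rewrite ler_wpM2l ?exprn_ge0// lerDl.
Qed.

Lemma adisc_herglotz f : cint lambda f -> adisc (herglotz f).
Proof.
move=> cf; apply: adisc_lim => rho r0 r1 e e0; have d0 : 0 < 1 - rho by rewrite subr_gt0.
have K0 : 0 <= 2 / (1 - rho) * L1norm f by rewrite mulr_ge0 ?L1norm_ge0// divr_ge0// ltW.
have [N hN] := expr_small r0 r1 K0 e0.
exists (fun z => fourier_coef f 0 + 2 * \sum_(i < N) fourier_coef f (Posz i.+1) * z ^+ i.+1).
  apply: adiscD; first exact: adisc_cst.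
  apply: adiscM; first exact: adisc_cst.
  elim: {hN} N => [|N IH].
    by under eq_fun do rewrite big_ord0; exact: adisc_cst.
  under eq_fun do rewrite big_ord_recr /=; apply: adiscD => //.
  apply: adiscM; first exact: adisc_cst.
  apply: adiscX; have := @adisc_poly R 'X; rewrite (_ : horner 'X = id)//.
  by apply/funext => z; rewrite hornerX.
move=> z zr; have z1 := le_lt_trans zr r1.
rewrite (le_trans (herglotz_expand N cf z1))// (le_trans _ hN)//.
rewrite [leRHS]mulrAC ler_wpM2r ?L1norm_ge0// [leRHS]mulrAC.
have zp : normc z ^+ N.+1 <= rho ^+ N.+1 by rewrite lerXn2r ?nnegrE ?normc_ge0.
apply: ler_pM; rewrite ?mulr_ge0 ?invr_ge0 ?exprn_ge0 ?normc_ge0 ?subr_ge0 ?(ltW z1)//.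
  by rewrite ler_wpM2l.
by rewrite lef_pV2 ?posrE ?subr_gt0// lerB.
Qed.

Lemma fourier_e k n : fourier_coef (@e_ R k) n = (k == n)%:R.
Proof.
rewrite /fourier_coef -subr_eq0 -cintegral_e; apply: eq_cintegral => s.
by rewrite -e_N -e_D.
Qed.

Lemma herglotz_e k z : normc z < 1 ->
  herglotz (@e_ R k) z = match k with Posz 0 => 1 | Posz j => 2 * z ^+ j | _ => 0 end.
Proof.
move=> z1; set v := (X in _ = X).
have d0 : 0 < 1 - normc z by rewrite subr_gt0.
have ck : cint lambda (@e_ R k) by exact: cint_e.
apply/eqP; rewrite -subr_eq0 -normc_eq0 eq_le normc_ge0 andbT.
apply/ler_addgt0Pl => e e0; rewrite addr0.
have K0 : 0 <= 2 / (1 - normc z) * L1norm (@e_ R k) by rewrite mulr_ge0 ?L1norm_ge0// divr_ge0// ltW.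
have [N hN] := expr_small (normc_ge0 z) z1 K0 e0.
(* [M >= N] keeps the remainder below [e], and [M >= |k|] ensures that the truncated series already
   contains the only nonzero coefficient. *)
pose M := maxn N `|k|%N.
have -> : v = fourier_coef (@e_ R k) 0 + 2 * \sum_(i < M) fourier_coef (@e_ R k) (Posz i.+1) * z ^+ i.+1.
  rewrite fourier_e /v; case: (k) @M => [[|j]|j] M.
  - rewrite eqxx big1 ?mulr0 ?addr0// => i _.
    by rewrite fourier_e mul0r.
  - have jM : (j < M)%N by rewrite leq_max ltnSn orbT.
    rewrite add0r (bigD1 (Ordinal jM))//= fourier_e eqxx mul1r big1 ?addr0// => i ij.
    by rewrite fourier_e eqz_nat eqSS (_ : (j == i) = false) ?mul0r//; apply/negbTE; apply: contraNneq ij => ji; apply/eqP/val_inj.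
  - rewrite add0r big1 ?mulr0// => i _.
    by rewrite fourier_e mul0r.
rewrite (le_trans (herglotz_expand M ck z1))// (le_trans _ hN)//.
rewrite (_ : 2 * _ / _ * _ = 2 / (1 - normc z) * L1norm (@e_ R k) * normc z ^+ M.+1); last by ring.
by apply: ler_wpM2l => //; rewrite ler_wiXn2l ?normc_ge0 ?(ltW z1)// ltnS leq_maxl.
Qed.

Lemma poisson_kerE z s : normc z < 1 ->
  poisson_ker z s = (1 - normc z ^+ 2) / normc (e_ 1 s - z) ^+ 2.
Proof.
move=> z1; have h := e_sub_neq0 s z1.
rewrite /poisson_ker /ker (_ : (e_ 1 s - z)^-1 = (n2 (e_ 1 s - z))^-1%:C * (e_ 1 s - z)^*); last first.
  by apply: (mulfI h); rewrite mulfV// mulrCA mul_conj -rmorphM /= mulVf ?n2_eq0.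
rewrite mulrCA [Re _]ReM ReC ImC mul0r subr0 [RHS]mulrC !normc_n2; congr (_ * _).
rewrite -(n2_e 1 s) /n2 !partsE; ring.
Qed.

Lemma poisson_ker_ge0 z s : normc z < 1 -> 0 <= poisson_ker z s.
Proof.
move=> z1; rewrite poisson_kerE// divr_ge0 ?sqr_ge0// subr_ge0.
by rewrite expr_le1 ?normc_ge0// ltW.
Qed.

Lemma poisson_ker_meas z : normc z < 1 -> measurable_fun setT (poisson_ker z).
Proof. by move=> /ker_meas[]. Qed.

Lemma poisson_ker_le z s : normc z < 1 -> poisson_ker z s <= 2 / (1 - normc z).
Proof.
move=> z1; rewrite (le_trans (ler_norm _))// (le_trans (Re_normc _))//.
exact: ker_le.
Qed.

Definition poisson f z : C := cintegral lambda (fun s => (poisson_ker z s)%:C * f s).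

Lemma cint_poisson f z : cint lambda f -> normc z < 1 ->
  cint lambda (fun s => (poisson_ker z s)%:C * f s).
Proof.
move=> cf z1; apply: (@cintM_bdd _ _ (2 / (1 - normc z))) => //.
  by apply: cmeas_real; exact: poisson_ker_meas.
by move=> s; rewrite normc_real ger0_norm ?poisson_ker_ge0// poisson_ker_le.
Qed.

Lemma cint_herglotz f z : cint lambda f -> normc z < 1 ->
  cint lambda (fun s => ker z s * f s).
Proof.
move=> cf z1; apply: (cintM_bdd cf (ker_meas z1)) => s; exact: ker_le.
Qed.

(** The Poisson kernel is half the sum of the Herglotz kernel and its conjugate. On a character of
    positive index the conjugated transform vanishes, which is how [poisson_e] obtains exact
    powers. *)
Lemma poissonE f z : cint lambda f -> normc z < 1 ->
  poisson f z = 2^-1 * (herglotz f z + (herglotz (fun s => (f s)^*) z)^*).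
Proof.
move=> cf z1; have cf' := cint_conj cf.
rewrite /herglotz -cintegral_conj; last exact: cint_herglotz.
rewrite -cintegralD; first last.
- by apply: cint_conj; exact: cint_herglotz.
- exact: cint_herglotz.
rewrite -cintegralZ; last first.
  by apply: cintD; [exact: cint_herglotz|apply: cint_conj; exact: cint_herglotz].
apply: eq_cintegral => s; rewrite conjM conjK -mulrDl mulrA; congr (_ * _).
rewrite -[X in X * _](_ : (2^-1 : R)%:C = _); last by rewrite fmorphV rmorph_nat.
by rewrite /poisson_ker; apply: complexP; rewrite !partsE; lra.
Qed.

Lemma poisson_e k z : normc z < 1 -> poisson (@e_ R (Posz k)) z = z ^+ k.
Proof.
move=> z1; rewrite poissonE//; last exact: cint_e.
have -> : (fun s => (@e_ R (Posz k) s)^*) = @e_ R (- (Posz k)).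
  by apply/funext => s; rewrite e_N.
rewrite !herglotz_e//; case: k => [|k]; first by rewrite oppr0 conjR expr0; field.
rewrite (_ : - (Posz k.+1) = Negz k) ?NegzE// conjR addr0; by field.
Qed.
End herglotz.

(** * Radial limits of Poisson integrals *)

Section finite_sums.
Context (R : realType) d (T : measurableType d) (m : {measure set T -> \bar R}) (D : set T).
Hypothesis mD : measurable D.

Lemma integrable_cmul (c : R) (f : T -> R) : m.-integrable D (EFin \o f) ->
  m.-integrable D (EFin \o (fun y => c * f y)).
Proof. by move=> /(integrableZl mD c); apply: eq_integrable. Qed.

Lemma integrable_add (f g : T -> R) : m.-integrable D (EFin \o f) ->
  m.-integrable D (EFin \o g) -> m.-integrable D (EFin \o (fun y => f y + g y)).
Proof. by move=> f_ g_; have := integrableD mD f_ g_; apply: eq_integrable. Qed.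

Lemma Rintegral_fsum (F : nat -> T -> R) n :
  (forall k, m.-integrable D (EFin \o F k)) ->
  m.-integrable D (EFin \o (fun y => \sum_(k < n) F k y)) /\
  \int[m]_(y in D) (\sum_(k < n) F k y) = \sum_(k < n) \int[m]_(y in D) F k y.
Proof.
move=> iF; elim: n => [|n [IH1 IH2]].
  split; first by apply: eq_integrable (integrable0 m D) => //= y _; rewrite big_ord0.
  by rewrite big_ord0; under eq_Rintegral do rewrite big_ord0; rewrite /Rintegral integral0.
split.
  have := integrableD mD IH1 (iF n); apply: eq_integrable => //= y _.
  by rewrite big_ord_recr.
by under eq_Rintegral do rewrite big_ord_recr /=; rewrite RintegralD// IH2 big_ord_recr.
Qed.
End finite_sums.

(** * A Borel section of the projection from the line to the circle *)

Section section_of_circle.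
Context (R : realType).
Local Notation T := (circle R).
Local Notation lambda := (@circle_lebesgue R).
Local Notation leb := (@lebesgue_measure R).

Definition frac (x : R) : R := x - (Num.floor x)%:~R.
(** [repr] is an arbitrary choice of representative; reducing it modulo 1 gives a section that is
    determined and measurable. *)
Definition csec (t : T) : R := frac (repr t).

Lemma frac_itv x : 0 <= frac x < 1.
Proof.
have := floorD1_gt x; have := floor_le x; rewrite /frac intrD.
by move: (Num.floor _)%:~R => k; lra.
Qed.
Lemma circle_pi_frac x : circle_pi (frac x) = circle_pi x :> T.
Proof. by apply/circle_piP; rewrite /frac addrAC subrr sub0r rpredN intr_int. Qed.
Lemma frac_id x : 0 <= x < 1 -> frac x = x.
Proof.
move=> x01; rewrite /frac (_ : Num.floor x = 0) ?subr0//.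
by apply: floor_def; rewrite add0r.
Qed.
Lemma fracD_int x (k : int) : frac (x + k%:~R) = frac x.
Proof. by rewrite /frac floorDrz ?intr_int// intrD intrKfloor; ring. Qed.
Lemma csecK t : circle_pi (csec t) = t.
Proof. by rewrite /csec circle_pi_frac circle_reprK. Qed.
Lemma csec_pi x : csec (circle_pi x) = frac x.
Proof.
rewrite /csec; have /circle_piP/intrP[k hk] := circle_reprK (circle_pi x : T).
by rewrite (_ : repr _ = x + k%:~R) ?fracD_int// -hk; ring.
Qed.
Lemma csec_itv t : 0 <= csec t < 1. Proof. exact: frac_itv. Qed.

(** For [a >= 0] the preimage of an upper ray pulls back to the union of the intervals []a + k, 1 +
    k[], which is open. Upper rays as generators avoid the jump of [csec] at 0. *)
Lemma csec_meas : measurable_fun setT csec.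
Proof.
apply: (@measurability _ _ _ _ setT csec (@RGenOInfty.G R)).
  exact: RGenOInfty.measurableE.
move=> _ [_ [a ->] <-]; rewrite setTI; apply: circle_measurable_open.
have [a0|a0] := ltP a 0.
  have -> : csec @^-1` `]a, +oo[ = setT; last exact: openT.
  apply/seteqP; split => // t _ /=; rewrite in_itv /= andbT.
  by apply: (lt_le_trans a0); case/andP: (csec_itv t).
rewrite circle_open_pi.
have -> : (@circle_pi R) @^-1` (csec @^-1` `]a, +oo[) = \bigcup_(k in [set: int]) `]a + k%:~R, 1 + k%:~R[%classic.
  apply/seteqP; split => x /=; rewrite csec_pi in_itv /= andbT.
    move=> ax; exists (Num.floor x) => //=; rewrite in_itv /=.
    by case/andP: (frac_itv x); move: ax; rewrite /frac; lra.
  move=> [k _]; rewrite /= in_itv /= => /andP[xl xr].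
  have -> : frac x = x - k%:~R.
    rewrite -{1}(subrK k%:~R x) fracD_int frac_id//; lra.
  lra.
by apply: bigcup_open => k _; exact: interval_open.
Qed.

Lemma ae_circle (P : T -> Prop) :
  {ae leb, forall x : R, 0 < x < 1 -> P (circle_pi x)} -> {ae lambda, forall t, P t}.
Proof.
move=> [N [mN N0 sub]].
(* The hypothesis concerns the open interval only; the point 0 is thrown into the null set. *)
pose N' := N `|` [set 0].
have mN' : measurable N' by exact: measurableU.
have N'0 : leb N' = 0%E.
  by rewrite /N' measureU0//; exact: lebesgue_measure_set1.
exists (csec @^-1` N'); split.
- by rewrite -[X in measurable X]setTI; exact: csec_meas.
- rewrite /= /circle_lebesgue /pushforward /mrestr.
  apply/eqP; rewrite eq_le measure_ge0 andbT -N'0 le_measure ?inE//.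
    apply: measurableI => //.
    have mc : measurable (csec @^-1` N').
      by rewrite -[X in measurable X]setTI; exact: csec_meas.
    have := @measurable_circle_pi R measurableT _ mc.
    by rewrite setTI.
  move=> x [/= Nx]; rewrite in_itv /= => x01; move: Nx.
  by rewrite csec_pi frac_id.
- move=> t /= nP; have [e0|n0] := eqVneq (csec t) 0; [by right|left].
  apply: sub => /= H; apply: nP; rewrite -(csecK t); apply: H.
  by case/andP: (csec_itv t) => h1 ->; rewrite lt_neqAle eq_sym n0 h1.
Qed.
End section_of_circle.

(** * Convergence of Poisson integrals at Lebesgue points *)

Section poisson_ae.
Context (R : realType).
Local Notation T := (circle R).
Local Notation lambda := (@circle_lebesgue R).
Local Notation leb := (@lebesgue_measure R).
Local Notation pi := (@trigo.pi R).
Local Notation I01 := (`[0%R, 1%R[%classic : set R).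

Lemma chord_pi (x y : R) :
  n2 (e_ 1 (circle_pi y) - e_ 1 (circle_pi x) : R[i]) = 4 * sin (pi * (y - x)) ^+ 2.
Proof.
rewrite !e_pi !mulr1 /n2 !partsE.
have -> : 4 * sin (pi * (y - x)) ^+ 2 = 2 - 2 * cos (2 * pi * y - 2 * pi * x).
  have -> : 2 * pi * y - 2 * pi * x = (pi * (y - x)) *+ 2 by rewrite -mulr_natr; ring.
  by rewrite cos_mulr2n cos2sin2 -mulr_natr; ring.
by rewrite cosB; have := cos2Dsin2 (2 * pi * y); have := cos2Dsin2 (2 * pi * x); lra.
Qed.

Definition rad (r : R) (t : T) : R[i] := r%:C * e_ 1 t.
Lemma normc_rad r t : 0 <= r -> normc (rad r t) = r.
Proof. by move=> r0; rewrite normc_mul normc_e mulr1 normc_real ger0_norm. Qed.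

Lemma poisson_ker_rad r t s : 0 <= r -> r < 1 ->
  poisson_ker (rad r t) s <= 2 / (1 - r).
Proof. by move=> r0 r1; have := @poisson_ker_le R (rad r t) s; rewrite normc_rad//; apply. Qed.

Lemma poisson_ker_far r x y : 0 <= r -> r < 1 -> sin (pi * (y - x)) != 0 ->
  poisson_ker (rad r (circle_pi x)) (circle_pi y) <= 2 * (1 - r) / sin (pi * (y - x)) ^+ 2.
Proof.
move=> r0 r1 s0; rewrite poisson_kerE normc_rad//.
set z := rad r (circle_pi x).
have s2 : 0 < sin (pi * (y - x)) ^+ 2 by rewrite lt_neqAle eq_sym sqrf_eq0 s0 sqr_ge0.
have key : sin (pi * (y - x)) ^+ 2 <= normc (e_ 1 (circle_pi y) - z) ^+ 2.
  (* The point [z] lies at distance [1 - r] from the boundary point [e_ 1 (circle_pi x)], and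
     [1 - r] is itself at most [normc (e_ 1 (circle_pi y) - z)]. *)
  have h1 : normc (e_ 1 (circle_pi y) - e_ 1 (circle_pi x) : R[i]) <= 2 * normc (e_ 1 (circle_pi y) - z).
    rewrite -(subrKA z) (le_trans (normcD _ _))// mulr_natl mulr2n lerD2l.
    have -> : z - e_ 1 (circle_pi x) = - ((1 - r)%:C * e_ 1 (circle_pi x)).
      by rewrite /z /rad rmorphB /= rmorph1; ring.
    rewrite normc_opp normc_rad; last by rewrite subr_ge0 ltW.
    by have := @normc_e_sub R z (circle_pi y); rewrite normc_rad.
  have : normc (e_ 1 (circle_pi y) - e_ 1 (circle_pi x) : R[i]) ^+ 2 <= (2 * normc (e_ 1 (circle_pi y) - z)) ^+ 2.
    by rewrite lerXn2r ?nnegrE ?mulr_ge0 ?normc_ge0.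
  by rewrite [in X in X -> _]normc_n2 chord_pi exprMn; lra.
have d1 : 0 < normc (e_ 1 (circle_pi y) - z) ^+ 2 by exact: lt_le_trans key.
apply: ler_pM.
- by rewrite subr_ge0 expr_le1// ltW.
- by rewrite invr_ge0 ltW.
- by rewrite expr2; nra.
- by rewrite lef_pV2 ?posrE.
Qed.

(** Since [pi <= 4], the bound [8^-1] puts [pi * h] in [[-1/2, 1/2]], where [sin_sub] yields
    [|y| <= 2 * |sin y|]; the factor 2 is then absorbed by [pi >= 2]. *)
Lemma sin_lower (h : R) : `|h| <= 8^-1 -> h ^+ 2 <= sin (pi * h) ^+ 2.
Proof.
move=> h8; have p2 := @pi_ge2 R; have p4 : pi <= 4.
  by have := @pihalf_lt2 R; lra.
have hp : `|pi * h| <= 2^-1.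
  rewrite normrM ger0_norm ?pi_ge0// (le_trans (y := 4 * 8^-1))//; last by lra.
  by rewrite ler_pM ?pi_ge0.
have := @sin_sub R (pi * h); rewrite (le_trans hp); last by lra.
move=> /(_ isT); rewrite -(real_normK (num_real (pi * h))).
set y := pi * h => sy.
have y2 : `|y| ^+ 2 <= `|y| / 2 by rewrite expr2 ler_wpM2l.
have y1 : `|y| <= `|sin y| + `|sin y - y|.
  by rewrite -{1}(subKr (sin y) y) (le_trans (ler_normB _ _)).
have y3 : `|y| <= 2 * `|sin y| by lra.
have y4 : `|h| <= `|sin y|.
  have : 2 * `|h| <= `|y| by rewrite normrM ger0_norm ?pi_ge0// ler_wpM2r.
  lra.
by rewrite -(real_normK (num_real h)) -(real_normK (num_real (sin y))) lerXn2r ?nnegrE.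
Qed.

(** The conditions [d <= x] and [d <= 1 - x] prevent wrapping around: [|y - x|] stays in
    [[d, 1 - d]], where the sine of [pi] times it is smallest at the ends. *)
Lemma sin_far (x d y : R) : 0 < d -> d <= x -> d <= 1 - x -> 0 <= y < 1 -> d <= `|y - x| ->
  sin (pi * d) ^+ 2 <= sin (pi * (y - x)) ^+ 2 /\ 0 < sin (pi * d) ^+ 2.
Proof.
move=> d0 dx dx1 /andP[y0 y1] dy; have p0 := @pi_gt0 R.
have d1 : d < 1 by lra.
have sd : 0 < sin (pi * d).
  by apply: sin_gt0_pi; rewrite mulr_gt0//= -[ltRHS]mulr1 ltr_pM2l.
split; last by rewrite exprn_gt0.
have -> : sin (pi * (y - x)) ^+ 2 = sin (pi * `|y - x|) ^+ 2.
  have [h|h] := leP 0 (y - x); first by rewrite ger0_norm.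
  by rewrite ltr0_norm// mulrN sinN sqrrN.
set a := `|y - x| in dy *.
have a1 : a <= 1 - d by rewrite /a ler_norml; lra.
rewrite !sin2cos2 lerD2l lerN2.
have din : pi * d \in `[0, pi] by rewrite in_itv /= mulr_ge0 ?(ltW p0) ?(ltW d0)//= ler_piMr ?(ltW p0) ?(ltW d1).
have ain : pi * a \in `[0, pi].
  have a0 : 0 <= a by exact: normr_ge0.
  rewrite in_itv /=; apply/andP; split; nra.
have bin : pi * (1 - d) \in `[0, pi].
  by rewrite in_itv /=; apply/andP; split; nra.
have c1 : cos (pi * a) <= cos (pi * d).
  by rewrite leNgt ltr_cos// -leNgt ler_pM2l.
have c2 : - cos (pi * d) <= cos (pi * a).
  have -> : - cos (pi * d) = cos (pi * (1 - d)).
    by rewrite mulrBr mulr1 cosB cospi sinpi; ring.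
  by rewrite leNgt ltr_cos// -leNgt ler_pM2l.
by rewrite -(real_normK (num_real (cos (pi * a)))) -[leRHS](real_normK (num_real _)) lerXn2r ?nnegrE// (le_trans _ (ler_norm _))// ler_norml; lra.
Qed.

Lemma integrableB_cst (A : set (measurableTypeR R)) (U : measurableTypeR R -> R) c :
  measurable A -> (leb A < +oo)%E -> leb.-integrable A (EFin \o U) ->
  leb.-integrable A (EFin \o (fun y => U y - c)).
Proof.
move=> mA Aoo iU; suff ic : leb.-integrable A (EFin \o cst c).
  by have := integrableB mA iU ic; apply: eq_integrable.
apply/integrableP; split; first by apply/measurable_EFinP; exact: measurable_cst.
have -> : (\int[leb]_(x in A) `|(EFin \o cst c) x| = `|c|%:E * leb A)%E by rewrite -integral_cst.
by rewrite lte_mul_pinfty// lee_fin normr_ge0.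
Qed.

Lemma lebesgue_pt_ball (U : R -> R) (x : R) : lebesgue_pt U x ->
  (forall h, leb.-integrable (ball x h) (EFin \o U)) ->
  forall e, 0 < e -> exists2 d, 0 < d & forall h, 0 < h -> h < d ->
  \int[leb]_(y in ball x h) `|U y - U x| <= e * (2 * h).
Proof.
move=> /fine_cvgP[fin /cvgrPdist_le /= H] iU e e0.
have [d1 d10 h1] := fin.
have [d2 d20 h2] := H _ e0.
exists (Num.min d1 d2); first by rewrite lt_min d10 d20.
move=> h h0; rewrite lt_min => /andP[hd1 hd2].
have := h1 h; have := h2 h; rewrite /ball_ /= !sub0r !normrN (ger0_norm (ltW h0)).
move=> /(_ hd2 h0) b1 /(_ hd1 h0) b2.
move: b1 b2; rewrite /davg /iavg lebesgue_measure_ball ?(ltW h0)// inver.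
rewrite gt_eqF ?mulrn_wgt0//.
set I := integral _ _ _ => b1 b2.
have iV : leb.-integrable (ball x h) (EFin \o (fun y => U y - U x)).
  apply: integrableB_cst; [exact: measurable_ball| |exact: iU].
  by rewrite lebesgue_measure_ball ?(ltW h0)// ltry.
have II : I = (\int[leb]_(y in ball x h) `|U y - U x|)%:E.
  rewrite /I /Rintegral fineK.
    by apply: eq_integral => y _ /=.
  apply: integrable_fin_num; [exact: measurable_ball|].
  exact: integrable_abse iV.
move: b1; rewrite II -EFinM /= => b1.
move: (le_trans (ler_norm _) b1); rewrite mulrC ler_pdivrMr ?mulrn_wgt0//.
by rewrite mulr_natl.
Qed.

Lemma Rintegral_subset (A B : set (measurableTypeR R)) (f : measurableTypeR R -> R) :
  measurable A -> measurable B ->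
  A `<=` B -> (forall y, 0 <= f y) -> leb.-integrable B (EFin \o f) ->
  \int[leb]_(y in A) f y <= \int[leb]_(y in B) f y.
Proof.
move=> mA mB AB f0 ifB; have ifA := integrableS mB mA AB ifB.
rewrite /Rintegral fine_le ?integrable_fin_num//.
apply: ge0_subset_integral => //; first exact: measurable_int ifB.
by move=> y _; rewrite lee_fin.
Qed.

Lemma sum_half n : \sum_(k < n) (2 ^+ k)^-1 <= 2 :> R.
Proof.
suff -> : \sum_(k < n) (2 ^+ k)^-1 = 2 - 2 * (2 ^+ n)^-1 :> R.
  by rewrite gerBl mulr_ge0// invr_ge0 exprn_ge0.
elim: n => [|n IH]; first by rewrite big_ord0 expr0 invr1; lra.
rewrite big_ord_recr /= IH exprS invfM; lra.
Qed.

Lemma pow2_between (delta d : R) : 0 < delta -> delta < d ->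
  exists K, d <= 2 ^+ K * delta /\ 2 ^+ K * delta < 2 * d.
Proof.
move=> d0 dd; have ex : exists K, d <= 2 ^+ K * delta.
  exists (Num.trunc (d / delta)).+1; rewrite -ler_pdivrMr//.
  rewrite (le_trans (ltW (truncnS_gt _)))// -natrX ler_nat ltnW//.
  exact: ltn_expl.
exists (ex_minn ex); case: ex_minnP => K dK minK; split => //.
case: K dK minK => [|K] dK minK; first by move: dK; rewrite expr0 mul1r leNgt dd.
rewrite exprS -mulrA ltr_pM2l// ltNge; apply/negP => /minK.
by rewrite ltnn.
Qed.

(** Majorant by balls of radius [2 ^+ k * (1 - r)]. A point whose first ball has index [k = j.+1] is
    at distance at least [2 ^+ j * (1 - r)], so the kernel there is at most
    [2 / (4 ^+ j * (1 - r))], which is the constant 8 after the shift of index. Since the radius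
    grows like [2 ^+ k], averages over the balls contribute a summable series. *)
Lemma poisson_dyadic (r x d y : R) K : 0 <= r -> r < 1 -> 0 < d -> d <= x -> d <= 1 - x ->
  d <= 2 ^+ K * (1 - r) -> 2 ^+ K * (1 - r) <= 8^-1 -> 0 <= y < 1 ->
  poisson_ker (rad r (circle_pi x)) (circle_pi y) <=
    2 * (1 - r) / sin (pi * d) ^+ 2 +
    \sum_(k < K.+1) 8 / (4 ^+ k * (1 - r)) * \1_(ball x (2 ^+ k * (1 - r))) y.
Proof.
move=> r0 r1 d0 dx dx1 dK K8 y01; set delta := 1 - r.
have de0 : 0 < delta by rewrite subr_gt0.
have term0 k : 0 <= 8 / (4 ^+ k * delta) * \1_(ball x (2 ^+ k * delta)) y.
  by rewrite mulr_ge0 ?divr_ge0 ?mulr_ge0 ?exprn_ge0 ?(ltW de0).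
have far_ge0 : 0 <= 2 * delta / sin (pi * d) ^+ 2.
  by rewrite divr_ge0 ?sqr_ge0// mulr_ge0// ltW.
have [yf|yn] := leP (2 ^+ K * delta) `|y - x|.
  have [sd sd0] := sin_far d0 dx dx1 y01 (le_trans dK yf).
  have sy0 : 0 < sin (pi * (y - x)) ^+ 2 by exact: lt_le_trans sd.
  have syn : sin (pi * (y - x)) != 0 by move: sy0; rewrite lt_neqAle eq_sym sqrf_eq0 => /andP[].
  apply: (@le_trans _ _ (2 * delta / sin (pi * d) ^+ 2)); last first.
    by rewrite lerDl sumr_ge0.
  apply: (le_trans (poisson_ker_far r0 r1 syn)).
  rewrite ler_wpM2l//; first by rewrite mulr_ge0// ltW.
  by rewrite lef_pV2 ?posrE.
apply: (@le_trans _ _ (\sum_(k < K.+1) 8 / (4 ^+ k * delta) * \1_(ball x (2 ^+ k * delta)) y)); last first.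
  by rewrite lerDr.
have ex : exists k, `|y - x| < 2 ^+ k * delta by exists K.
pose k := ex_minn ex.
have [kK yk mk] : [/\ (k <= K)%N, `|y - x| < 2 ^+ k * delta & forall j, `|y - x| < 2 ^+ j * delta -> (k <= j)%N].
  by rewrite /k; case: ex_minnP => m hm mm; split => //; exact: mm.
have kK1 : (k < K.+1)%N by [].
rewrite (bigD1 (Ordinal kK1))//=.
apply: (@le_trans _ _ (8 / (4 ^+ k * delta) * \1_(ball x (2 ^+ k * delta)) y)); last first.
  by rewrite lerDl sumr_ge0.
rewrite indicE mem_set ?mulr1; last by rewrite /ball /= distrC.
case: (k) yk mk {kK kK1} => [|j] yk mk.
  rewrite (le_trans (poisson_ker_rad _ _ r0 r1))// expr0 mul1r -/delta.
  by rewrite ler_pM2r ?invr_gt0//; lra.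
have yj : 2 ^+ j * delta <= `|y - x|.
  by rewrite leNgt; apply/negP => /mk; rewrite ltnn.
have j0 : 0 < 2 ^+ j * delta by rewrite mulr_gt0// exprn_gt0.
have yx0 : 0 < `|y - x| by exact: lt_le_trans yj.
have y8 : `|y - x| <= 8^-1 by rewrite (le_trans (ltW yn)).
have sl := sin_lower y8.
have yx2 : 0 < (y - x) ^+ 2 by rewrite -(real_normK (num_real _)) exprn_gt0.
have s2 : 0 < sin (pi * (y - x)) ^+ 2 by exact: lt_le_trans sl.
have syn : sin (pi * (y - x)) != 0 by move: s2; rewrite lt_neqAle eq_sym sqrf_eq0 => /andP[].
apply: (le_trans (poisson_ker_far r0 r1 syn)); rewrite -/delta.
apply: (@le_trans _ _ (2 * delta / (2 ^+ j * delta) ^+ 2)); last first.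
  rewrite le_eqVlt; apply/orP; left; apply/eqP.
  rewrite exprMn -exprM mulnC exprM (_ : 2 ^+ 2 = 4); last by rewrite expr2; lra.
  rewrite [4 ^+ j.+1]exprS; field.
  by rewrite (gt_eqF de0) expf_neq0// pnatr_eq0.
rewrite ler_wpM2l//; first by rewrite mulr_ge0// ltW.
rewrite lef_pV2 ?posrE//; last by rewrite exprn_gt0.
apply: le_trans sl; rewrite -(real_normK (num_real (y - x))) lerXn2r ?nnegrE//.
exact: ltW.
Qed.

Lemma poisson_ker1 z : normc z < 1 -> \int[lambda]_s poisson_ker z s = 1.
Proof.
move=> z1; have := @poisson_e R 0 z z1; rewrite expr0 /poisson.
rewrite (_ : (fun s => _) = fun s => (poisson_ker z s)%:C); last first.
  by apply/funext => s; rewrite e_0 mulr1.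
by rewrite cintegral_real => /(congr1 (@complex.Re R)).
Qed.

Lemma poisson_ker_rint z (u : T -> R) : rint lambda u -> normc z < 1 ->
  rint lambda (fun s => poisson_ker z s * u s).
Proof.
move=> ru z1; apply: (rint_le _ _ (rintZ (2 / (1 - normc z)) (rint_abs ru))).
  by apply: measurable_funM; [exact: poisson_ker_meas|exact: rint_meas ru].
move=> s; rewrite normrM ler_wpM2r// ger0_norm ?poisson_ker_ge0//.
exact: poisson_ker_le.
Qed.
Lemma poisson_pt (u : T -> R) (x : R) : rint lambda u -> 0 < x < 1 ->
  lebesgue_pt ((u \o (@circle_pi R)) \_ I01) x ->
  forall e, 0 < e -> exists2 eta, 0 < eta & forall r, 0 <= r -> r < 1 -> 1 - eta < r ->
  `|\int[lambda]_s (poisson_ker (rad r (circle_pi x)) s * u s) - u (circle_pi x)| <= e.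
Proof.
move=> ru /andP[x0 x1] lx e e0; set c := u (circle_pi x).
pose U := (u \o (@circle_pi R)) \_ I01.
have x01 : x \in I01 by apply: mem_set; rewrite /= in_itv /= (ltW x0).
have Ux : U x = c by rewrite /U patchE x01.
have iU : leb.-integrable [set: measurableTypeR R] (EFin \o U).
  have := rint_circle ru; move/(integrable_mkcond _ _).1 => H.
  have := H (measurable_itv _); apply: eq_integrable => // y _.
  by rewrite /U /= !patchE; case: ifP.
have iUh h : leb.-integrable (ball x h) (EFin \o U).
  by apply: integrableS iU => //; exact: measurable_ball.
(* With [e / 128] the ball of index [k] contributes [8 / (4 ^+ k * delta)] times [e / 128] times its
   length [2 * 2 ^+ k * delta], that is [e / 8 * (2 ^+ k)^-1]; the sum is at most [e / 4]. *)
have [d1 d10 H1] := lebesgue_pt_ball lx iUh (divr_gt0 e0 (ltr0Sn R 127)).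
(* The largest radius used is below [2 * d]: [d1 / 4] keeps it in the range of the Lebesgue-point
   estimate, [32^-1] in the range of [sin_lower], and [x], [1 - x] keep the far region away from the
   cut. *)
pose d := Num.min (Num.min (d1 / 4) (32^-1)) (Num.min x (1 - x)).
have d0 : 0 < d by rewrite !lt_min divr_gt0//= invr_gt0 ltr0n x0 subr_gt0.
have [dd1 d32 dx dx1] : [/\ d <= d1 / 4, d <= 32^-1, d <= x & d <= 1 - x].
  by rewrite /d !ge_min !lexx !orbT.
pose W s := `|u s - c|.
have rW : rint lambda W by apply: rint_abs; apply: rintB => //; exact: rint_cst.
pose S := \int[lambda]_s W s.
have S0 : 0 <= S by apply: Rintegral_ge0 => s _; exact: normr_ge0.
pose kap := sin (pi * d) ^+ 2.
have kap0 : 0 < kap.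
  by have [] := @sin_far x d 0 d0 dx dx1 _ _; rewrite ?lexx ?ltr01// sub0r normrN ger0_norm ?(ltW x0).
(* Chosen so that the far term [2 * delta / kap * S] is at most [e / 2]; [S + 1] avoids a division
   by zero. *)
pose eta := Num.min d (e * kap / (4 * (S + 1))).
have S1 : 0 < 4 * (S + 1) by rewrite mulr_gt0// (le_lt_trans S0)// ltrDl.
have eta0 : 0 < eta by rewrite lt_min d0 /= divr_gt0// mulr_gt0.
exists eta => // r r0 r1 re.
set delta := 1 - r.
have de0 : 0 < delta by rewrite subr_gt0.
have ded : delta < d by rewrite /delta ltrBlDr addrC -ltrBlDr (le_lt_trans _ re)// lerD2l lerN2 ge_min lexx.
have dee : delta <= e * kap / (4 * (S + 1)).
  by rewrite ltW// /delta ltrBlDr addrC -ltrBlDr (le_lt_trans _ re)// lerD2l lerN2 ge_min lexx orbT.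
have [K [dK Kd]] := pow2_between de0 ded.
set z := rad r (circle_pi x).
have z1 : normc z < 1 by rewrite normc_rad.
have rP := poisson_ker_rint rW z1.
have step1 : `|\int[lambda]_s (poisson_ker z s * u s) - c| <= \int[lambda]_s (poisson_ker z s * W s).
  have -> : c = \int[lambda]_s (poisson_ker z s * c).
    under eq_Rintegral do rewrite mulrC.
    rewrite RintegralZl ?poisson_ker1 ?mulr1//.
    have := poisson_ker_rint (rint_cst lambda 1) z1; apply: eq_integrable => // s _ /=.
    by rewrite mulr1.
  rewrite -RintegralB//; first last.
  - exact: poisson_ker_rint (rint_cst lambda c) z1.
  - exact: poisson_ker_rint.
  apply: (le_trans (le_normr_Rintegral _ _)) => //.
    by apply: rintB; [exact: poisson_ker_rint|exact: poisson_ker_rint (rint_cst lambda c) z1].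
  rewrite le_eqVlt; apply/orP; left; apply/eqP; apply: eq_Rintegral => s _.
  by rewrite -mulrBr normrM ger0_norm ?poisson_ker_ge0.
apply: (le_trans step1).
rewrite Rintegral_circle//.
pose ck k := 8 / (4 ^+ k * delta).
have ck0 k : 0 <= ck k by rewrite divr_ge0// mulr_ge0 ?exprn_ge0// ltW.
pose V y := `|U y - U x|.
have VW y : I01 y -> W (circle_pi y) = V y.
  by move=> yI; rewrite /W /V Ux /U patchE mem_set.
have iV : leb.-integrable I01 (EFin \o V).
  have := rint_circle rW; apply: eq_integrable => //= y yI.
  by rewrite /= VW//; exact: set_mem.
have iVB k : leb.-integrable I01 (EFin \o (fun y => \1_(ball x (2 ^+ k * delta)) y * V y)).
  apply: (le_integrable _ _ _ iV) => //.
    apply/measurable_EFinP; apply: measurable_funM.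
      by apply: measurable_indic; exact: measurable_ball.
    by apply/measurable_EFinP; exact: measurable_int iV.
  move=> y _ /=; rewrite lee_fin normrM ler_piMl// indicE.
  by case: (_ \in _); rewrite ?normr1 ?normr0.
have ickV k : leb.-integrable I01 (EFin \o (fun y => ck k * (\1_(ball x (2 ^+ k * delta)) y * V y))).
  exact: integrable_cmul.
have mI : measurable (I01 : set (measurableTypeR R)) by exact: measurable_itv.
pose Fk (k : nat) (y : measurableTypeR R) : R := ck k * (\1_(ball x (2 ^+ k * delta)) (y : R) * V y).
have sumF n := @Rintegral_fsum R _ (measurableTypeR R) leb I01 mI Fk n ickV.
have iSum n := (sumF n).1.
have intSum n : \int[leb]_(y in I01) (\sum_(k < n) ck k * (\1_(ball x (2 ^+ k * delta)) y * V y)) =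
   \sum_(k < n) ck k * \int[leb]_(y in I01) (\1_(ball x (2 ^+ k * delta)) y * V y).
  apply: etrans (sumF n).2 _; apply: eq_bigr => k _.
  by rewrite RintegralZl.
have intB k : (k < K.+1)%N -> ck k * \int[leb]_(y in I01) (\1_(ball x (2 ^+ k * delta)) y * V y) <= e / 8 * (2 ^+ k)^-1.
  move=> kK; have kd0 : 0 < 2 ^+ k * delta by rewrite mulr_gt0// exprn_gt0.
  have kd1 : 2 ^+ k * delta < d1.
    apply: (@le_lt_trans _ _ (2 ^+ K * delta)).
      by rewrite ler_wpM2r ?(ltW de0)// ler_weXn2l// ler1n.
    by apply: (lt_le_trans Kd); clear - dd1 d10; lra.
  have HB := H1 _ kd0 kd1.
  have IB : \int[leb]_(y in I01) (\1_(ball x (2 ^+ k * delta)) y * V y) <= e / 128 * (2 * (2 ^+ k * delta)).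
    apply: le_trans HB.
    have -> : \int[leb]_(y in I01) (\1_(ball x (2 ^+ k * delta)) y * V y) = \int[leb]_(y in I01 `&` ball x (2 ^+ k * delta)) V y.
      rewrite Rintegral_mkcondr; apply: eq_Rintegral => y _; rewrite patchE indicE.
      by case: ifP => _; rewrite ?mul1r ?mul0r.
    apply: Rintegral_subset.
    - by apply: measurableI => //; exact: measurable_ball.
    - exact: measurable_ball.
    - exact: subIsetr.
    - by move=> y; exact: normr_ge0.
    - have iUc : leb.-integrable (ball x (2 ^+ k * delta)) (EFin \o (fun y => U y - U x)).
        apply: integrableB_cst; [exact: measurable_ball| |exact: iUh].
        by rewrite lebesgue_measure_ball ?(ltW kd0)// ltry.
      exact: (integrable_abse iUc).
  apply: (le_trans (ler_wpM2l (ck0 k) IB)); rewrite /ck le_eqVlt; apply/orP; left; apply/eqP.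
  have p2 : 2 ^+ k != 0 :> R by rewrite expf_neq0// pnatr_eq0.
  have -> : 4 ^+ k = 2 ^+ k * 2 ^+ k :> R by rewrite -expr2 -exprM mulnC exprM expr2 -natrM.
  by field; rewrite p2 gt_eqF.
have iVf : leb.-integrable I01 (EFin \o (fun y => 2 * delta / kap * V y)).
  exact: integrable_cmul.
apply: (@le_trans _ _ (\int[leb]_(y in I01) (2 * delta / kap * V y + \sum_(k < K.+1) ck k * (\1_(ball x (2 ^+ k * delta)) y * V y)))).
  apply: le_Rintegral => //.
  - exact: rint_circle rP.
  - apply: (@integrable_add R _ (measurableTypeR R)) => //; exact: iSum.
  - move=> y yI; rewrite VW//.
    have -> : \sum_(k < K.+1) ck k * (\1_(ball x (2 ^+ k * delta)) y * V y) = (\sum_(k < K.+1) ck k * \1_(ball x (2 ^+ k * delta)) y) * V y.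
      by rewrite mulr_suml; apply: eq_bigr => k _; rewrite mulrA.
    rewrite -mulrDl ler_wpM2r//; first exact: normr_ge0.
    by apply: poisson_dyadic => //; apply: (le_trans (ltW Kd)); clear - d32; lra.
rewrite RintegralD// RintegralZl// intSum.
have -> : \int[leb]_(y in I01) V y = S.
  rewrite /S Rintegral_circle//; apply: eq_Rintegral => y yI; rewrite VW//; exact: set_mem.
have far : 2 * delta / kap * S <= e / 2.
  rewrite mulrAC ler_pdivrMr//.
  move: dee; rewrite ler_pdivlMr// => dee.
  have := mulr_ge0 (ltW de0) S0; clear - dee de0; nra.
have near : \sum_(k < K.+1) ck k * \int[leb]_(y in I01) (\1_(ball x (2 ^+ k * delta)) y * V y) <= e / 4.
  apply: (@le_trans _ _ (\sum_(k < K.+1) e / 8 * (2 ^+ k)^-1)).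
    by apply: ler_sum => k _; exact: intB.
  rewrite -mulr_sumr; have := ler_wpM2l (_ : 0 <= e / 8) (sum_half K.+1).
  by move=> /(_ (divr_ge0 (ltW e0) (ler0n _ 8))) h; apply: (le_trans h); clear - e0; lra.
apply: (le_trans (lerD far near)); clear - e0; lra.
Qed.

Lemma poisson_ae (u : T -> R) : rint lambda u ->
  {ae lambda, forall t, \int[lambda]_s (poisson_ker (rad r t) s * u s) @[r --> (1 : R)^'-] --> u t}.
Proof.
move=> ru; apply: ae_circle.
have iU := rint_circle ru.
have lU : locally_integrable [set: R] ((u \o (@circle_pi R)) \_ I01).
  by apply: integrable_locally_restrict.
have [N [mN N0 sub]] := lebesgue_differentiation lU; exists N; split => //.
move=> x nx; apply: sub => lx; apply: nx => x01.
apply/cvgrPdist_le => e e0; have [eta eta0 H] := poisson_pt ru x01 lx e0.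
near=> r; rewrite distrC; apply: H.
- near: r; apply: nbhs_left_ge; exact: ltr01.
- near: r; exact: nbhs_left_lt.
- near: r; apply: nbhs_left_gt; lra.
Unshelve. all: by end_near.
Qed.
End poisson_ae.

(** * Boundary values of bounded analytic functions *)

Section complex_limits.
Context (R : realType).

(** Convergence of both parts, so that limits are handled in [R]; the topology of [R[i]] as a
    numeric field is reached only through [ccvg_cvg]. *)
Definition ccvg (I : Type) (F : set_system I) (x : I -> R[i]) (l : R[i]) :=
  Re (x i) @[i --> F] --> Re l /\ Im (x i) @[i --> F] --> Im l.

Lemma ccvg_dist (I : Type) (F : set_system I) (FF : ProperFilter F) (x : I -> R[i]) l :
  (forall e, 0 < e -> \forall i \near F, normc (x i - l) <= e) -> ccvg F x l.
Proof.
move=> H; split; apply/cvgrPdist_le => e /H; apply: filterS => i xl.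
- by rewrite -ReN -ReD (le_trans (Re_normc _))// normc_dist.
- by rewrite -ImN -ImD (le_trans (Im_normc _))// normc_dist.
Qed.

Lemma normc_le_sum (z : R[i]) : normc z <= `|Re z| + `|Im z|.
Proof.
rewrite -(@ler_pXn2r _ 2) ?nnegrE ?addr_ge0 ?normc_ge0// normc_n2 sqrrD.
rewrite !real_normK ?num_real// /n2 -mulr_natr.
by have := mulr_ge0 (normr_ge0 (Re z)) (normr_ge0 (Im z)); lra.
Qed.

Lemma ccvg_distP (I : Type) (F : set_system I) (FF : ProperFilter F) (x : I -> R[i]) l :
  ccvg F x l -> forall e, 0 < e -> \forall i \near F, normc (x i - l) <= e.
Proof.
move=> [/cvgrPdist_le cr /cvgrPdist_le ci] e e0.
have e2 : 0 < e / 2 by rewrite divr_gt0.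
near=> i; rewrite (le_trans (normc_le_sum _))// ReD ImD ReN ImN (splitr e) lerD// distrC.
- by near: i; exact: cr.
- by near: i; exact: ci.
Unshelve. all: by end_near.
Qed.

Lemma ccvg_unique (I : Type) (F : set_system I) (FF : ProperFilter F) (x : I -> R[i]) l m :
  ccvg F x l -> ccvg F x m -> l = m.
Proof.
by move=> [a b] [c d]; apply: complexP; [exact: (cvg_unique _ a c)|exact: (cvg_unique _ b d)].
Qed.

Lemma ccvgM (I : Type) (F : set_system I) (FF : ProperFilter F) (x y : I -> R[i]) l m :
  ccvg F x l -> ccvg F y m -> ccvg F (fun i => x i * y i) (l * m).
Proof.
move=> [a b] [c d]; split.
- by under eq_fun do rewrite ReM; rewrite ReM; apply: cvgB; apply: cvgM.
- by under eq_fun do rewrite ImM; rewrite ImM; apply: cvgD; apply: cvgM.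
Qed.

Lemma ccvg_cst (I : Type) (F : set_system I) (FF : ProperFilter F) (l : R[i]) : ccvg F (fun=> l) l.
Proof. by split; exact: cvg_cst. Qed.

Lemma ccvg_n2 (I : Type) (F : set_system I) (FF : ProperFilter F) (x : I -> R[i]) l :
  ccvg F x l -> n2 (x i) @[i --> F] --> n2 l.
Proof.
move=> [a b]; rewrite /n2; apply: cvgD; rewrite expr2; under eq_fun do rewrite expr2;
by apply: cvgM.
Qed.

Lemma ccvg_inv (I : Type) (F : set_system I) (FF : ProperFilter F) (x : I -> R[i]) l :
  l != 0 -> ccvg F x l -> ccvg F (fun i => (x i)^-1) l^-1.
Proof.
have invE (z : R[i]) : z^-1 = ((n2 z)^-1)%:C * z^*.
  have [->|z0] := eqVneq z 0; first by rewrite invr0 conjR mulr0.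
  by apply: (mulfI z0); rewrite mulfV// mulrCA mul_conj -rmorphM /= mulVf ?n2_eq0.
move=> l0 xl; rewrite invE; under eq_fun do rewrite invE.
apply: ccvgM; split.
- by rewrite ReC; under eq_fun do rewrite ReC; apply: cvgV; rewrite ?n2_eq0//; exact: ccvg_n2.
- by rewrite ImC; under eq_fun do rewrite ImC; exact: cvg_cst.
- by rewrite Reconj; under eq_fun do rewrite Reconj; case: xl.
- by rewrite Imconj; under eq_fun do rewrite Imconj; apply: cvgN; case: xl.
Qed.

Lemma ccvg_cvg (I : Type) (F : set_system I) (FF : ProperFilter F) (x : I -> R[i]) l :
  ccvg F x l -> (x i : (R[i] : numFieldType)) @[i --> F] --> (l : (R[i] : numFieldType)).
Proof.
move=> xl; apply/cvgrPdist_le => e e0.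
(* In the order of [R[i]], [0 < e] forces [e] to be real, so the tolerance is a positive element of
   [R]. *)
have e0' : 0 < Re e by move: e0; rewrite ltcE /= => /andP[].
have eE : e = (Re e)%:C.
  by move: e0; rewrite ltcE /= => /andP[/eqP im0 _]; apply: complexP => //=; rewrite im0.
have := ccvg_distP FF xl e0'; apply: filterS => i; rewrite normc_dist => h.
by rewrite eE; rewrite lecE /= eqxx.
Qed.

Lemma ccvg_lim (I : Type) (F : set_system I) (FF : ProperFilter F) (x : I -> R[i]) l :
  ccvg F x l -> lim (((x i : (R[i] : numFieldType)) @[i --> F]) : set_system (R[i] : numFieldType)) = l.
Proof. move=> /ccvg_cvg; apply: cvg_lim; exact: norm_hausdorff. Qed.

Lemma normc_small (a b : R[i]) : (forall e, 0 < e -> normc (a - b) <= e) -> a = b.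
Proof.
move=> H; apply/eqP; rewrite -subr_eq0 -normc_eq0 eq_le normc_ge0 andbT.
by apply/ler_addgt0Pl => e e0; rewrite addr0 H.
Qed.
End complex_limits.

(** * Means of disc-analytic functions over circles *)

Section boundary.
Context (R : realType).
Local Notation T := (circle R).
Local Notation lambda := (@circle_lebesgue R).
Local Notation C := R[i].

Lemma rad_cmeas r : cmeas (@rad R r).
Proof. by apply: cmeasM; [exact: cmeas_cst|exact: cmeas_e]. Qed.

Lemma poly_rad_cmeas (p : {poly C}) r : cmeas (fun t : T => p.[rad r t]).
Proof.
under eq_fun do rewrite horner_coef; apply: cmeas_sum => i.
apply: cmeasM; first exact: cmeas_cst.
by apply: cmeas_exp; exact: rad_cmeas.
Qed.

Lemma poly_radE (p : {poly C}) r (t : T) :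
  p.[rad r t] = \sum_(i < size p) (p`_i * r%:C ^+ i) * e_ (Posz i) t.
Proof.
rewrite horner_coef; apply: eq_bigr => i _; rewrite /rad exprMn mulrA.
by rewrite (e_nat i).
Qed.

Lemma adisc_rad B r e : adisc B -> 0 <= r -> r < 1 -> 0 < e ->
  exists p : {poly C}, forall s (t : T), 0 <= s -> s <= r -> normc (B (rad s t) - p.[rad s t]) <= e.
Proof.
move=> aB r0 r1 e0; have [p Bp] := aB _ r0 r1 _ e0.
by exists p => s t s0 sr; apply: Bp; rewrite normc_rad.
Qed.

Lemma adisc_cmeas B r : adisc B -> 0 <= r -> r < 1 -> cmeas (fun t : T => B (rad r t)).
Proof.
move=> aB r0 r1.
have H n : exists p : {poly C}, forall t : T, normc (B (rad r t) - p.[rad r t]) <= n.+1%:R^-1.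
  have [|p Bp] := @adisc_rad B r n.+1%:R^-1 aB r0 r1; first by rewrite invr_gt0.
  by exists p => t; exact: Bp.
have [p_ Bp] := choice H.
have cv (t : T) : ccvg \oo (fun n => (p_ n).[rad r t]) (B (rad r t)).
  apply: ccvg_dist => e e0; exists (Num.trunc e^-1) => // n /= en.
  rewrite normc_dist (le_trans (Bp n t))// invf_ple ?posrE//.
  by rewrite (le_trans (ltW (truncnS_gt _)))// ler_nat ltnS.
split.
- apply: (@measurable_fun_cvg _ _ _ _ (fun n t => Re (p_ n).[rad r t])).
    by move=> n; case: (poly_rad_cmeas (p_ n) r).
  by move=> t _; case: (cv t).
- apply: (@measurable_fun_cvg _ _ _ _ (fun n t => Im (p_ n).[rad r t])).
    by move=> n; case: (poly_rad_cmeas (p_ n) r).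
  by move=> t _; case: (cv t).
Qed.

Lemma cint_bdd (nu : {finite_measure set T -> \bar R}) (f : T -> C) (M : R) : cmeas f -> (forall t, normc (f t) <= M) -> cint nu f.
Proof.
move=> mf fM; have M0 : 0 <= M := le_trans (normc_ge0 _) (fM point).
apply: (@cint_le _ _ _ _ _ (fun=> M)) => //; last exact: rint_cst.
by move=> t; rewrite n2_le_normc.
Qed.

Lemma L1norm_le (f : T -> C) (M : R) : cmeas f -> (forall t, normc (f t) <= M) -> L1norm f <= M.
Proof.
move=> mf fM; have -> : M = \int[lambda]_t (fun=> M) t.
  by rewrite /Rintegral integral_cst// [X in (_ * X)%E](@circle_lebesgue_setT R) mule1.
apply: le_Rintegral => //; last exact: rint_cst.
by under eq_fun do rewrite normc_sqrt; apply: cint_normc; exact: cint_bdd fM.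
Qed.

Lemma normc_cintegral_le (f : T -> C) (M : R) : cmeas f -> (forall t, normc (f t) <= M) ->
  normc (cintegral lambda f) <= M.
Proof.
move=> mf fM; apply: le_trans (L1norm_le mf fM); apply: normc_cintegral.
exact: cint_bdd fM.
Qed.

Lemma cintegral_close (f g k : T -> C) (M e : R) : cmeas f -> cmeas g -> cmeas k ->
  (forall t, normc (f t) <= M) -> (forall t, normc (k t) <= 1) ->
  (forall t, normc (f t - g t) <= e) ->
  normc (cintegral lambda (fun t => f t * k t) - cintegral lambda (fun t => g t * k t)) <= e.
Proof.
move=> mf mg mk fM k1 fg.
have gM t : normc (g t) <= M + e.
  rewrite -(subKr (f t) (g t)) (le_trans (normcB _ _))//.
  by rewrite lerD.
rewrite -cintegralB; first last.
- apply: (@cint_bdd _ _ (M + e)); first exact: cmeasM.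
  by move=> t; rewrite normc_mul (le_trans _ (gM t))// ler_piMr ?normc_ge0.
- apply: (@cint_bdd _ _ M); first exact: cmeasM.
  by move=> t; rewrite normc_mul (le_trans _ (fM t))// ler_piMr ?normc_ge0.
apply: normc_cintegral_le.
  by apply: cmeasD; [exact: cmeasM|apply: cmeasN; exact: cmeasM].
by move=> t; rewrite -mulrBl normc_mul (le_trans _ (fg t))// ler_piMr ?normc_ge0.
Qed.

Lemma poly_fourier (p : {poly C}) r k :
  cintegral lambda (fun t => p.[rad r t] * e_ (Posz k) t) = if k == 0%N then p.[0] else 0.
Proof.
under eq_fun do rewrite poly_radE mulr_suml.
rewrite cintegral_sum; last first.
  move=> i; apply: (@cint_bdd _ _ (normc (p`_i * r%:C ^+ i))).
    by apply: cmeasM; [apply: cmeasM; [exact: cmeas_cst|exact: cmeas_e]|exact: cmeas_e].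
  by move=> t; rewrite !(normc_mul, normc_e) !mulr1.
have E (i : 'I_(size p)) : cintegral lambda (fun t => p`_i * r%:C ^+ i * e_ (Posz i) t * e_ (Posz k) t) =
    p`_i * r%:C ^+ i * (i + k == 0)%N%:R.
  rewrite -eqz_nat PoszD -cintegral_e -cintegralZ; last exact: cint_e.
  by apply: eq_cintegral => t; rewrite e_D mulrA.
under eq_bigr do rewrite E.
case: k E => [|k] _; last by rewrite big1// => i _; rewrite addnS mulr0.
rewrite horner_coef0 /=; case: (size p) (@nth_default _ 0 p) => [|n] pn.
  by rewrite big_ord0 pn.
by rewrite big_ord_recl /= expr0 !mulr1 big1 ?addr0// => i _; rewrite mulr0.
Qed.

Lemma adisc_fourier B r k : adisc B -> 0 <= r -> r < 1 ->
  cintegral lambda (fun t => B (rad r t) * e_ (Posz k) t) = if k == 0%N then B 0 else 0.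
Proof.
move=> aB r0 r1; apply: normc_small => e e0; have e2 : 0 < e / 2 by rewrite divr_gt0.
have [p Bp] := aB _ r0 r1 _ e2.
have [M M0 BM] := adisc_bdd aB r0 r1.
have Bp' t : normc (B (rad r t) - p.[rad r t]) <= e / 2 by apply: Bp; rewrite normc_rad.
have BM' t : normc (B (rad r t)) <= M by apply: BM; rewrite normc_rad.
have := @cintegral_close _ _ (e_ (Posz k)) M (e / 2) (adisc_cmeas aB r0 r1)
  (poly_rad_cmeas p r) (cmeas_e _ _) BM' (fun t => _) Bp'.
rewrite poly_fourier => H.
rewrite -(subrKA (if k == 0%N then p.[0] else 0)) (le_trans (normcD _ _))// (splitr e) lerD//.
  by apply: H => t; rewrite normc_e.
case: ifP => _; last by rewrite subrr Normc.normc0 ltW.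
by rewrite normc_dist Bp// Normc.normc0.
Qed.

Lemma poissonD f g z : cint lambda f -> cint lambda g -> normc z < 1 ->
  poisson (fun s => f s + g s) z = poisson f z + poisson g z.
Proof.
move=> cf cg z1; rewrite /poisson -cintegralD; try exact: cint_poisson.
by apply: eq_cintegral => s; rewrite mulrDr.
Qed.
Lemma poissonZ c f z : cint lambda f -> normc z < 1 ->
  poisson (fun s => c * f s) z = c * poisson f z.
Proof.
move=> cf z1; rewrite /poisson -cintegralZ; last exact: cint_poisson.
by apply: eq_cintegral => s; rewrite mulrCA.
Qed.

Lemma poisson_bdd f z (M : R) : cmeas f -> (forall s : T, normc (f s) <= M) -> normc z < 1 ->
  normc (poisson f z) <= M.
Proof.
move=> mf fM z1; have cf := cint_bdd lambda mf fM.
rewrite (le_trans (normc_cintegral (cint_poisson cf z1)))//.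
have iP := poisson_ker_rint (rint_cst lambda M) z1.
have -> : M = \int[lambda]_s (poisson_ker z s * M).
  under eq_Rintegral do rewrite mulrC.
  rewrite RintegralZl ?poisson_ker1 ?mulr1//.
  by have := poisson_ker_rint (rint_cst lambda 1) z1; under eq_fun do rewrite mulr1.
apply: le_Rintegral => //.
  by under eq_fun do rewrite normc_sqrt; apply: cint_normc; exact: cint_poisson.
by move=> s _; rewrite normc_mul normc_real ger0_norm ?poisson_ker_ge0// ler_wpM2l// poisson_ker_ge0.
Qed.

Lemma poisson_sum (I : Type) (l : seq I) (F : I -> T -> C) z : (forall i, cint lambda (F i)) -> normc z < 1 ->
  poisson (fun s => \sum_(i <- l) F i s) z = \sum_(i <- l) poisson (F i) z.
Proof.
move=> cF z1; rewrite /poisson -cintegral_sum; last by move=> i; exact: cint_poisson.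
by apply: eq_cintegral => s; rewrite mulr_sumr.
Qed.

Lemma poly_poisson (p : {poly C}) r z : normc z < 1 ->
  poisson (fun t : T => p.[rad r t]) z = p.[r%:C * z].
Proof.
move=> z1.
have -> : (fun t : T => p.[rad r t]) = (fun t => \sum_(i < size p) (p`_i * r%:C ^+ i) * e_ (Posz i) t).
  by apply/funext => t; rewrite poly_radE.
rewrite poisson_sum//; last by move=> i; apply: cintZ; exact: cint_e.
rewrite horner_coef; apply: eq_bigr => i _.
by rewrite poissonZ ?poisson_e// ?exprMn ?mulrA//; exact: cint_e.
Qed.

Lemma adisc_poisson B r z : adisc B -> 0 <= r -> r < 1 -> normc z < 1 ->
  poisson (fun t : T => B (rad r t)) z = B (r%:C * z).
Proof.
move=> aB r0 r1 z1; apply: normc_small => e e0; have e2 : 0 < e / 2 by rewrite divr_gt0.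
have [p Bp] := aB _ r0 r1 _ e2.
have [M M0 BM] := adisc_bdd aB r0 r1.
have Bp' (t : T) : normc (B (rad r t) - p.[rad r t]) <= e / 2 by apply: Bp; rewrite normc_rad.
have BM' (t : T) : normc (B (rad r t)) <= M by apply: BM; rewrite normc_rad.
have mB := adisc_cmeas aB r0 r1; have mp := poly_rad_cmeas p r.
have m2 : cmeas (fun t : T => B (rad r t) - p.[rad r t]) by apply: cmeasD => //; exact: cmeasN.
have -> : poisson (fun t : T => B (rad r t)) z = poisson (fun t : T => p.[rad r t]) z +
    poisson (fun t : T => B (rad r t) - p.[rad r t]) z.
  rewrite -poissonD//; first last.
  - exact: cint_bdd Bp'.
  - apply: (@cint_bdd _ _ (M + e / 2)) => // t.
    by rewrite -(subKr (B (rad r t)) p.[_]) (le_trans (normcB _ _))// lerD.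
  by congr poisson; apply/funext => t; rewrite addrC subrK.
rewrite poly_poisson// addrAC (le_trans (normcD _ _))// (splitr e) lerD//.
  rewrite normc_dist Bp// normc_mul normc_real ger0_norm// ler_piMr// ltW//.
exact: poisson_bdd.
Qed.

Lemma nrm2_e_sum n (c : nat -> C) :
  nrm2 lambda (fun t => \sum_(i < n) c i * e_ (Posz i) t) = \sum_(i < n) n2 (c i).
Proof.
pose f t := \sum_(i < n) c i * e_ (Posz i) t.
have Le i : L2 lambda (@e_ R (Posz i)) by exact: L2_e.
have ipe (i j : nat) : ip lambda (@e_ R (Posz i)) (@e_ R (Posz j)) = (i == j)%:R.
  by rewrite -[RHS](fourier_e _ (Posz i) (Posz j)).
have : ip lambda f f = (\sum_(i < n) n2 (c i))%:C.
  have Lf : L2 lambda f by apply: L2_sum => i; exact: L2Z.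
  rewrite {1}/f ip_suml//.
  rewrite rmorph_sum /=; apply: eq_bigr => i _.
  rewrite /f ip_sumr//.
  rewrite (bigD1 i)//= ipe eqxx mulr1 big1 ?addr0 ?mul_conj// => j ji.
  by rewrite ipe (_ : (_ == _) = false) ?mulr0//; apply/negbTE; apply: contraNneq ji => ij; apply/eqP/val_inj.
by rewrite ip_nrm2 => /(congr1 (@complex.Re R)).
Qed.

(** By Parseval it reduces to [(s ^+ i - r ^+ i) ^+ 2 <= (s ^+ i) ^+ 2 - (r ^+ i) ^+ 2]. Circle
    means thus increase with the radius, and once they are nearly maximal the functions themselves
    are Cauchy. *)
Lemma poly_nrm2_incr (p : {poly C}) r s : 0 <= r -> r <= s ->
  nrm2 lambda (fun t => p.[rad s t] - p.[rad r t]) <=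
  nrm2 lambda (fun t => p.[rad s t]) - nrm2 lambda (fun t => p.[rad r t]).
Proof.
move=> r0 rs; have s0 := le_trans r0 rs.
have E1 q : nrm2 lambda (fun t => p.[rad q t]) = \sum_(i < size p) n2 (p`_i) * (q ^+ i) ^+ 2.
  under eq_fun do rewrite poly_radE.
  rewrite (nrm2_e_sum _ (fun i => p`_i * q%:C ^+ i)); apply: eq_bigr => i _.
  by rewrite n2M n2X n2C -!exprM mulnC.
have -> : nrm2 lambda (fun t => p.[rad s t] - p.[rad r t]) =
    \sum_(i < size p) n2 (p`_i) * (s ^+ i - r ^+ i) ^+ 2.
  under eq_fun do rewrite !poly_radE -sumrB.
  have -> : (fun t : T => \sum_(i < size p) (p`_i * s%:C ^+ i * e_ (Posz i) t - p`_i * r%:C ^+ i * e_ (Posz i) t)) =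
      fun t => \sum_(i < size p) (p`_i * (s ^+ i - r ^+ i)%:C) * e_ (Posz i) t.
    by apply/funext => t; apply: eq_bigr => i _; rewrite rmorphB !rmorphXn /=; ring.
  rewrite (nrm2_e_sum _ (fun i => p`_i * (s ^+ i - r ^+ i)%:C)); apply: eq_bigr => i _.
  by rewrite n2M n2C.
rewrite !E1 -sumrB; apply: ler_sum => i _; rewrite -mulrBr ler_wpM2l ?n2_ge0//.
have a0 : 0 <= r ^+ i by exact: exprn_ge0.
have ab : r ^+ i <= s ^+ i by rewrite lerXn2r ?nnegrE.
nra.
Qed.

Lemma n2_close (a b : C) (M e : R) : normc a <= M -> normc b <= M -> normc (a - b) <= e ->
  `|n2 a - n2 b| <= 2 * M * e.
Proof.
move=> aM bM ab; have M0 := le_trans (normc_ge0 _) aM.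
rewrite -!normc_n2 subr_sqr normrM mulrC ler_pM//.
  rewrite ger0_norm ?addr_ge0 ?normc_ge0//; lra.
apply: le_trans ab; rewrite ler_norml; apply/andP; split.
  by rewrite lerNl opprB lerBlDr -{1}(subrK a b) normc_dist normcD.
by rewrite lerBlDr -{1}(subrK b a) normcD.
Qed.

Lemma nrm2_close (f g : T -> C) (M e : R) : cmeas f -> cmeas g ->
  (forall t, normc (f t) <= M) -> (forall t, normc (g t) <= M) ->
  (forall t, normc (f t - g t) <= e) -> `|nrm2 lambda f - nrm2 lambda g| <= 2 * M * e.
Proof.
move=> mf mg fM gM fg.
have Lf : L2 lambda f.
  by apply: (@L2_bdd _ _ _ (M ^+ 2)) => // t; rewrite n2_le_normc// (le_trans (normc_ge0 _) (fM t)).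
have Lg : L2 lambda g.
  by apply: (@L2_bdd _ _ _ (M ^+ 2)) => // t; rewrite n2_le_normc// (le_trans (normc_ge0 _) (gM t)).
rewrite /nrm2 -RintegralB//; try exact: L2_n2.
have rd := rintB (L2_n2 Lf) (L2_n2 Lg).
rewrite (le_trans (le_normr_Rintegral _ rd))//.
have -> : 2 * M * e = \int[lambda]_t (fun=> 2 * M * e) t.
  by rewrite /Rintegral integral_cst// [X in (_ * X)%E](@circle_lebesgue_setT R) mule1.
apply: le_Rintegral => //; [exact: rint_abs rd|exact: rint_cst|].
by move=> t _; exact: n2_close.
Qed.

Lemma adisc_nrm2_incr B r s : adisc B -> 0 <= r -> r <= s -> s < 1 ->
  nrm2 lambda (fun t => B (rad s t) - B (rad r t)) <=
  nrm2 lambda (fun t => B (rad s t)) - nrm2 lambda (fun t => B (rad r t)).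
Proof.
move=> aB r0 rs s1; have s0 := le_trans r0 rs; have r1 := le_lt_trans rs s1.
have [M M0 BM] := adisc_bdd aB s0 s1.
have BMr q (t : T) : 0 <= q -> q <= s -> normc (B (rad q t)) <= M.
  by move=> q0 qs; apply: BM; rewrite normc_rad.
apply/ler_addgt0Pl => e e0.
(* Replacing the three norms by those of a polynomial costs [12 * (M + 1) * d] in all, below
   [K * d <= e]. *)
pose K := 16 * M + 16; have K0 : 0 < K by rewrite /K; lra.
pose d := Num.min 1 (e / K); have d0 : 0 < d by rewrite lt_min ltr01 divr_gt0.
have [p Bp] := @adisc_rad B s d aB s0 s1 d0.
have pM q (t : T) : 0 <= q -> q <= s -> normc p.[rad q t] <= M + 1.
  move=> q0 qs; rewrite -(subKr (B (rad q t)) p.[_]) (le_trans (normcB _ _))//.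
  by rewrite lerD ?BMr// (le_trans (Bp q t q0 qs))// ge_min lexx.
have BM1 q (t : T) : 0 <= q -> q <= s -> normc (B (rad q t)) <= M + 1.
  by move=> q0 qs; rewrite (le_trans (BMr q t q0 qs))// lerDl.
have mB q : 0 <= q -> q <= s -> cmeas (fun t : T => B (rad q t)).
  by move=> q0 qs; apply: adisc_cmeas => //; exact: le_lt_trans s1.
have mp q := poly_rad_cmeas p q.
have c1 := @nrm2_close _ _ (M + 1) d (mB s s0 (lexx s)) (mp s)
  (fun t => BM1 s t s0 (lexx s)) (fun t => pM s t s0 (lexx s)) (fun t => Bp s t s0 (lexx s)).
have c2 := @nrm2_close _ _ (M + 1) d (mB r r0 rs) (mp r)
  (fun t => BM1 r t r0 rs) (fun t => pM r t r0 rs) (fun t => Bp r t r0 rs).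
have c3 : `|nrm2 lambda (fun t => B (rad s t) - B (rad r t)) -
      nrm2 lambda (fun t => p.[rad s t] - p.[rad r t])| <= 2 * (2 * (M + 1)) * (2 * d).
  apply: nrm2_close.
  - by apply: cmeasD; [exact: mB|apply: cmeasN; exact: mB].
  - by apply: cmeasD => //; exact: cmeasN.
  - by move=> t; rewrite (le_trans (normcB _ _))//; have := BM1 s t s0 (lexx s); have := BM1 r t r0 rs; lra.
  - by move=> t; rewrite (le_trans (normcB _ _))//; have := pM s t s0 (lexx s); have := pM r t r0 rs; lra.
  - move=> t; have -> : B (rad s t) - B (rad r t) - (p.[rad s t] - p.[rad r t]) =
        (B (rad s t) - p.[rad s t]) - (B (rad r t) - p.[rad r t]) by ring.
    by rewrite (le_trans (normcB _ _))//; have := Bp s t s0 (lexx s); have := Bp r t r0 rs; lra.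
have inc := poly_nrm2_incr p r0 rs.
have de : K * d <= e by rewrite -ler_pdivlMl// mulrC ge_min lexx orbT.
move: c1 c2 c3 inc de; rewrite /K !ler_norml; clear - M0 d0; nra.
Qed.
End boundary.

Section dominated.
Context (R : realType).
Local Notation T := (circle R).
Variable nu : {finite_measure set T -> \bar R}.

Lemma real_dominated (u_ : nat -> T -> R) (u G : T -> R) :
  (forall n, measurable_fun setT (u_ n)) -> measurable_fun setT u ->
  {ae nu, forall t, u_ n t @[n --> \oo] --> u t} -> rint nu G ->
  (forall n t, `|u_ n t| <= G t) ->
  rint nu u /\ \int[nu]_t u_ n t @[n --> \oo] --> \int[nu]_t u t.
Proof.
move=> mu_ mu cu rG uG.
have [] := @dominated_convergence _ _ _ nu setT measurableT
   (fun n t => (u_ n t)%:E) (EFin \o u) (EFin \o G).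
- by move=> n; exact/measurable_EFinP.
- exact/measurable_EFinP.
- by apply: filterS cu => t ut _; apply: cvg_EFin => //; near=> n.
- by [].
- by apply: aeW => t n _ /=; rewrite lee_fin.
move=> iu _ H; split => //.
have iE : (\int[nu]_x (EFin \o u) x = (\int[nu]_t u t)%:E)%E.
  by rewrite /Rintegral fineK//; exact: integrable_fin_num.
by move: H; rewrite iE => /fine_cvg.
Unshelve. all: by end_near.
Qed.

Lemma complex_dominated (f_ : nat -> T -> R[i]) (f : T -> R[i]) (G : T -> R) :
  (forall n, cmeas (f_ n)) -> cmeas f ->
  {ae nu, forall t, ccvg \oo (f_ ^~ t) (f t)} -> rint nu G ->
  (forall n t, normc (f_ n t) <= G t) ->
  cint nu f /\ ccvg \oo (fun n => cintegral nu (f_ n)) (cintegral nu f).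
Proof.
move=> mf_ mf cf rG fG.
have cf1 : {ae nu, forall t, Re (f_ n t) @[n --> \oo] --> Re (f t)} by apply: filterS cf => t [].
have cf2 : {ae nu, forall t, Im (f_ n t) @[n --> \oo] --> Im (f t)} by apply: filterS cf => t [].
have [i1 c1] := @real_dominated (fun n t => Re (f_ n t)) (fun t => Re (f t)) G
  (fun n => (mf_ n).1) mf.1 cf1 rG
  (fun n t => le_trans (Re_normc _) (fG n t)).
have [i2 c2] := @real_dominated (fun n t => Im (f_ n t)) (fun t => Im (f t)) G
  (fun n => (mf_ n).2) mf.2 cf2 rG
  (fun n t => le_trans (Im_normc _) (fG n t)).
by split.
Qed.
End dominated.

(** * Radial limits of a function bounded by one *)

Section fatou.
Context (R : realType).
Local Notation T := (circle R).
Local Notation lambda := (@circle_lebesgue R).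
Local Notation C := R[i].
Variable B : C -> C.
Hypothesis aB : adisc B.
Hypothesis B1 : forall z, normc z < 1 -> normc (B z) <= 1.

Let A r := nrm2 lambda (fun t => B (rad r t)).

Let A_le1 r : 0 <= r -> r < 1 -> A r <= 1.
Proof.
move=> r0 r1; have -> : 1 = \int[lambda]_t (fun=> 1) t :> R.
  by rewrite /Rintegral integral_cst// [X in (_ * X)%E](@circle_lebesgue_setT R) mule1.
have Bt (t : T) : n2 (B (rad r t)) <= 1.
  by rewrite -(expr1n R 2) n2_le_normc// B1// normc_rad.
apply: le_Rintegral => //; last exact: rint_cst.
by apply: L2_n2; apply: (@L2_bdd _ _ _ 1) => //; exact: adisc_cmeas.
Qed.

Let A_mono r s : 0 <= r -> r <= s -> s < 1 -> A r <= A s.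
Proof.
move=> r0 rs s1; rewrite -subr_ge0; apply: le_trans (adisc_nrm2_incr aB r0 rs s1).
exact: nrm2_ge0.
Qed.

Let supA := sup [set A r | r in [set r | 0 <= r < 1]].

Let A_sup r : 0 <= r -> r < 1 -> A r <= supA.
Proof.
move=> r0 r1; apply: ub_le_sup; last by exists r => //=; rewrite r0 r1.
by exists 1 => _ [s /andP[s0 s1] <-]; exact: A_le1.
Qed.

Let A_close e : 0 < e -> exists r, [/\ 0 <= r, r < 1 & supA - e < A r].
Proof.
move=> e0; have hs : has_sup [set A r | r in [set r | 0 <= r < 1]].
  split; first by exists (A 0), 0 => //=; rewrite lexx ltr01.
  by exists 1 => _ [s /andP[s0 s1] <-]; exact: A_le1.
by have [_ [r /andP[r0 r1] <-] h] := sup_adherent e0 hs; exists r.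
Qed.

(* Radii along which the circle means are Cauchy fast enough for a.e. convergence. *)
Lemma fatou_radii : exists s : nat -> R,
  [/\ forall k, 0 <= s k < 1, forall k, 1 - k.+1%:R^-1 <= s k &
   forall k, nrm2 lambda (fun t => B (rad (s k.+1) t) - B (rad (s k) t)) <= (4 ^+ k)^-1 ].
Proof.
have H k : exists r, [/\ 0 <= r, r < 1 & supA - (4 ^+ k)^-1 < A r].
  by apply: A_close; rewrite invr_gt0 exprn_gt0.
have [r_ hr] := choice H.
have rk1 k : 0 <= 1 - (k.+1%:R^-1 : R) < 1.
  by rewrite subr_ge0 invf_le1// ler1n /= ltrBlDr ltrDl invr_gt0.
(* The maximum forces the radii to tend to 1, which a nearly maximal mean alone does not; by
   [A_mono] a larger radius stays nearly maximal. *)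
pose s k := Num.max (r_ k) (1 - k.+1%:R^-1).
have s01 k : 0 <= s k < 1.
  have [r0 r1 _] := hr k; have /andP[a b] := rk1 k.
  by rewrite /s le_max r0 /= gt_max r1 b.
exists s; split => //; first by move=> k; rewrite /s le_max lexx orbT.
have As k : supA - (4 ^+ k)^-1 <= A (s k).
  have [r0 r1 h] := hr k; apply: (le_trans (ltW h)); apply: A_mono => //.
    by rewrite le_max lexx.
  by case/andP: (s01 k).
have p4 k : (4 ^+ k.+1)^-1 <= (4 ^+ k)^-1 :> R.
  by rewrite lef_pV2 ?posrE ?exprn_gt0// ler_weXn2l// ler1n.
move=> k; have /andP[a0 a1] := s01 k; have /andP[b0 b1] := s01 k.+1.
(* The radii need not increase. In either order the larger mean is at most [supA] and the smaller
   one is at least [supA - (4 ^+ k)^-1]. *)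
have [ss|ss] := leP (s k) (s k.+1).
  have inc : _ <= A (s k.+1) - A (s k) := adisc_nrm2_incr aB a0 ss b1.
  by apply: (le_trans inc); have := A_sup b0 b1; have := As k; lra.
have -> : nrm2 lambda (fun t => B (rad (s k.+1) t) - B (rad (s k) t)) =
    nrm2 lambda (fun t => B (rad (s k) t) - B (rad (s k.+1) t)).
  by apply: eq_Rintegral => t _; rewrite -n2N opprB.
have inc : _ <= A (s k) - A (s k.+1) := adisc_nrm2_incr aB b0 (ltW ss) a1.
by apply: (le_trans inc); have := A_sup a0 a1; have := As k.+1; have := p4 k; lra.
Qed.

Lemma real_telescope_cvg (x : nat -> R) (D : nat -> R) (M : R) :
  (forall k, `|x k.+1 - x k| <= D k) -> (forall n, \sum_(k < n) D k <= M) ->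
  cvg (x n @[n --> \oo]).
Proof.
move=> xD DM.
have cs : cvgn (series (telescope x)).
  apply: normed_cvg; apply: nondecreasing_is_cvgn.
    apply/nondecreasing_seqP => n; rewrite /normed_series_of !seriesEord /=.
    by rewrite big_ord_recr /= lerDl.
  exists M => _ [n _ <-]; rewrite /normed_series_of seriesEord /=.
  by apply: le_trans (DM n); apply: ler_sum => k _; exact: xD.
rewrite (_ : x = fun n => x 0%N + series (telescope x) n); last first.
  by apply/funext => n; rewrite -eq_sum_telescope.
by apply: is_cvgD => //; exact: is_cvg_cst.
Qed.

(** The sum of the [2 ^+ k * D k] is integrable, its terms having integral at most [(2 ^+ k)^-1],
    hence it is finite almost everywhere. The arithmetic-geometric inequality bounds each increment
    by [(2 ^+ k * D k t + (2 ^+ k)^-1) / 2], so the increments are summable. *)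
Lemma ae_cvg_fast (f : nat -> T -> C) : (forall k, L2 lambda (f k)) ->
  (forall k, nrm2 lambda (fun t => f k.+1 t - f k t) <= (4 ^+ k)^-1) ->
  {ae lambda, forall t, exists l, ccvg \oo (f ^~ t) l}.
Proof.
move=> Lf fk; pose D k t := n2 (f k.+1 t - f k t).
have LD k : L2 lambda (fun t => f k.+1 t - f k t) by exact: L2B.
pose S t := (\sum_(0 <= k <oo) (2 ^+ k * D k t)%:E)%E.
have mD k : measurable_fun setT (fun t => (2 ^+ k * D k t)%:E).
  apply/measurable_EFinP; apply: measurable_funM; first exact: measurable_cst.
  by apply: cmeas_n2; exact: L2_meas.
have D0 k t : (0 <= (2 ^+ k * D k t)%:E)%E.
  by rewrite lee_fin mulr_ge0 ?exprn_ge0 ?n2_ge0.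
have iS : lambda.-integrable setT S.
  apply/integrableP; split.
    by apply: ge0_emeasurable_sum.
  have -> : (\int[lambda]_t `|S t| = \int[lambda]_t S t)%E.
    by apply: eq_integral => t _; rewrite gee0_abs// nneseries_ge0.
  rewrite integral_nneseries//.
  apply: (@le_lt_trans _ _ 2%:E); last exact: ltry.
  apply: lime_le; first by apply: is_cvg_nneseries => k _ _; exact: integral_ge0.
  near=> n; rewrite big_mkord.
  apply: (@le_trans _ _ (\sum_(k < n) (2 ^+ k)^-1%:E)%E); last first.
    by rewrite sumEFin lee_fin; exact: sum_half.
  apply: lee_sum => k _.
  have iD : rint lambda (fun t => 2 ^+ k * D k t) by apply: rintZ; exact: L2_n2.
  rewrite -[X in (X <= _)%E]fineK ?integrable_fin_num// lee_fin.
  rewrite -/(Rintegral _ _ _) RintegralZl//; last exact: L2_n2.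
  rewrite (le_trans (ler_wpM2l _ (fk k)))//.
  have -> : 4 ^+ k = 2 ^+ k * 2 ^+ k :> R by rewrite -expr2 -exprM mulnC exprM expr2 -natrM.
  by rewrite invfM mulrA mulfV ?mul1r// expf_neq0// pnatr_eq0.
have := integrable_ae measurableT iS; apply: filterS => t /(_ I) fS.
have SM n : \sum_(k < n) (2 ^+ k * D k t) <= fine (S t).
  rewrite -lee_fin fineK// -sumEFin -(big_mkord xpredT (fun k => (2 ^+ k * D k t)%:E)).
  by apply: nneseries_lim_ge => k _ _; exact: D0.
have Dk k : normc (f k.+1 t - f k t) <= (2 ^+ k * D k t + (2 ^+ k)^-1) / 2.
  rewrite /D -normc_n2; set a := normc _; set p := 2 ^+ k.
  have p0 : 0 < p :> R by rewrite exprn_gt0.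
  have := sqr_ge0 (p * a - 1); rewrite sqrrB1 => h.
  rewrite ler_pdivlMr// -(ler_pM2l p0) [leRHS]mulrDr mulfV ?gt_eqF//.
  by move: h; rewrite exprMn !expr2 -mulr_natr; lra.
have bdd n : \sum_(k < n) (2 ^+ k * D k t + (2 ^+ k)^-1) / 2 <= fine (S t) + 2.
  rewrite -mulr_suml big_split /=; have := SM n; have := sum_half R n.
  have : 0 <= \sum_(k < n) (2 ^+ k * D k t) by apply: sumr_ge0 => k _; rewrite -lee_fin.
  lra.
pose E k := (2 ^+ k * D k t + (2 ^+ k)^-1) / 2.
have tel (x : nat -> R) (h : forall k, `|x k.+1 - x k| <= E k) := @real_telescope_cvg x E _ h bdd.
have c1 : cvg (Re (f n t) @[n --> \oo]).
  by apply: tel => k; rewrite -ReN -ReD; exact: le_trans (Re_normc _) (Dk k).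
have c2 : cvg (Im (f n t) @[n --> \oo]).
  by apply: tel => k; rewrite -ImN -ImD; exact: le_trans (Im_normc _) (Dk k).
by exists (lim (Re (f n t) @[n --> \oo]) +i* lim (Im (f n t) @[n --> \oo]))%C; split.
Unshelve. all: by end_near.
Qed.

Lemma adisc_cvg (s : nat -> R) z : normc z < 1 -> (forall k, 0 <= s k < 1) ->
  (forall k, 1 - k.+1%:R^-1 <= s k) -> ccvg \oo (fun k => B ((s k)%:C * z)) (B z).
Proof.
move=> z1 s01 s1; apply: ccvg_dist => e e0; have e3 : 0 < e / 3 by rewrite divr_gt0.
have [p Bp] := aB (normc_ge0 z) z1 e3.
(* A Lipschitz constant of [p] on the closed unit disc, by [normc_expB] with [m = 1]. *)
pose K := \sum_(i < size p) normc p`_i * i%:R.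
have K0 : 0 <= K by apply: sumr_ge0 => i _; rewrite mulr_ge0 ?normc_ge0.
exists (Num.trunc (3 * K / e)) => // k /= hk.
have kK : K * (1 - s k) <= e / 3.
  have h1 : 3 * K / e <= k.+1%:R by rewrite (le_trans (ltW (truncnS_gt _)))// ler_nat ltnS.
  have h2 : 1 - s k <= k.+1%:R^-1 by rewrite lerBlDr -lerBlDl.
  apply: (@le_trans _ _ (K * k.+1%:R^-1)); first by rewrite ler_wpM2l.
  rewrite ler_pdivrMr// mulrC; move: h1; rewrite ler_pdivrMr//; lra.
have /andP[s0 sl1] := s01 k.
have pc : normc (p.[(s k)%:C * z] - p.[z]) <= e / 3.
  apply: le_trans kK; rewrite !horner_coef -sumrB (le_trans (normc_sum _ _))// /K mulr_suml.
  apply: ler_sum => i _; rewrite -mulrBr normc_mul -mulrA ler_wpM2l ?normc_ge0//.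
  have n1 : normc ((s k)%:C * z) <= 1.
    by rewrite normc_mul normc_real ger0_norm// mulr_ile1 ?normc_ge0// ltW.
  rewrite (le_trans (normc_expB i (lexx 1) n1 (ltW z1)))// expr1n mulr1 ler_wpM2l//.
  rewrite -{2}[z]mul1r -mulrBl normc_mul normc_dist -[1](rmorph1 (real_complex R)) -rmorphB normc_real.
  by rewrite ger0_norm ?subr_ge0 ?(ltW sl1)// ler_piMr ?subr_ge0 ?(ltW z1) ?(ltW sl1).
have n1 : normc ((s k)%:C * z) <= normc z.
  by rewrite normc_mul normc_real ger0_norm// ler_piMl ?normc_ge0// ltW.
have -> : B ((s k)%:C * z) - B z = (B ((s k)%:C * z) - p.[(s k)%:C * z]) + (p.[(s k)%:C * z] - p.[z]) + (p.[z] - B z) by ring.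
rewrite (le_trans (normcD _ _))//.
have := normcD (B ((s k)%:C * z) - p.[(s k)%:C * z]) (p.[(s k)%:C * z] - p.[z]).
have := Bp _ n1; have := Bp z (lexx _); rewrite [normc (p.[z] - B z)]normc_dist; move: pc.
move: (normc _) (normc _) (normc _) (normc _) => a b c d; lra.
Qed.

(* Fatou's theorem for bounded analytic functions. *)
Lemma fatou : exists b : T -> C,
  [/\ cmeas b, forall t, n2 (b t) <= 2,
   {ae lambda, forall t, ccvg (1 : R)^'- (fun r => B (rad r t)) (b t)} &
   forall k, cintegral lambda (fun t => b t * e_ (Posz k) t) = if k == 0%N then B 0 else 0].
Proof.
have [s [s01 s1 sfast]] := fatou_radii.
have mf k : cmeas (fun t : T => B (rad (s k) t)).
  by have /andP[s0 sl] := s01 k; exact: adisc_cmeas.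
have f1 k (t : T) : normc (B (rad (s k) t)) <= 1.
  by have /andP[s0 sl] := s01 k; apply: B1; rewrite normc_rad.
have Lf k : L2 lambda (fun t : T => B (rad (s k) t)).
  by apply: (@L2_bdd _ _ _ (1 ^+ 2)) => // t; rewrite n2_le_normc.
have aec := ae_cvg_fast Lf sfast.
(* The upper limit exists at every point, so [b] is measurable and bounded everywhere. The parts are
   bounded separately, whence 2 and not 1 in the bound on [n2 (b t)]. *)
pose b1 t := limn_sup (fun k => Re (B (rad (s k) t))).
pose b2 t := limn_sup (fun k => Im (B (rad (s k) t))).
pose b (t : T) := (b1 t +i* b2 t)%C.
have bRe k (t : T) : `|Re (B (rad (s k) t))| <= 1 by exact: le_trans (Re_normc _) (f1 k t).
have bIm k (t : T) : `|Im (B (rad (s k) t))| <= 1 by exact: le_trans (Im_normc _) (f1 k t).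
have ub (u : nat -> R) : (forall k, `|u k| <= 1) -> has_ubound (range u).
  by move=> h; exists 1 => _ [k _ <-]; have := h k; rewrite ler_norml => /andP[].
have lb (u : nat -> R) : (forall k, `|u k| <= 1) -> has_lbound (range u).
  by move=> h; exists (-1) => _ [k _ <-]; have := h k; rewrite ler_norml => /andP[].
have mb : cmeas b.
  split.
  - apply: (@measurable_fun_limn_sup _ _ _ _ (fun k t => Re (B (rad (s k) t)))).
    + by move=> t _; apply: ub.
    + by move=> t _; apply: lb.
    + by move=> k; case: (mf k).
  - apply: (@measurable_fun_limn_sup _ _ _ _ (fun k t => Im (B (rad (s k) t)))).
    + by move=> t _; apply: ub.
    + by move=> t _; apply: lb.
    + by move=> k; case: (mf k).
have lsup (u : nat -> R) : (forall k, `|u k| <= 1) -> `|limn_sup u| <= 1.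
  move=> h; have bu : bounded_fun (u : R^o ^nat).
    exists 1; split => // M M1 k _; rewrite /=; exact: le_trans (h k) (ltW M1).
  rewrite (limn_supE bu) ler_norml; apply/andP; split.
    apply: lb_le_inf; first by exists (sups u 0%N), 0%N.
    move=> _ [n _ <-]; apply: le_trans (_ : u n <= _).
      by have := h n; rewrite ler_norml => /andP[].
    apply: ub_le_sup; last by exists n => //=.
    by exists 1 => _ [k _ <-]; have := h k; rewrite ler_norml => /andP[].
  apply: (@le_trans _ _ (sups u 0%N)).
    apply: ge_inf; last by exists 0%N.
    exists (-1) => _ [n _ <-]; apply: le_trans (_ : u n <= _).
      by have := h n; rewrite ler_norml => /andP[].
    apply: ub_le_sup; last by exists n => //=.
    by exists 1 => _ [k _ <-]; have := h k; rewrite ler_norml => /andP[].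
  apply: ge_sup; first by exists (u 0%N), 0%N => //=.
  by move=> _ [n _ <-]; have := h n; rewrite ler_norml => /andP[].
have cb : {ae lambda, forall t, ccvg \oo (fun k => B (rad (s k) t)) (b t)}.
  apply: filterS aec => t [l [c1 c2]]; split; rewrite /b ?ReE ?ImE /b1 /b2.
  - by rewrite (cvg_limn_inf_sup c1).2.
  - by rewrite (cvg_limn_inf_sup c2).2.
have b2le t : n2 (b t) <= 2.
  rewrite /n2 /b ReE ImE -(real_normK (num_real (b1 t))) -(real_normK (num_real (b2 t))).
  have h1 : `|b1 t| <= 1 by apply: lsup.
  have h2 : `|b2 t| <= 1 by apply: lsup.
  have := normr_ge0 (b1 t); have := normr_ge0 (b2 t); nra.
have nb t : normc (b t) <= 2.
  by rewrite -n2_le_normc// (le_trans (b2le t))// expr2; lra.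
have cbint : cint lambda b by exact: cint_bdd nb.
(* Dominated convergence along the radii [s]. Once [B] is the Poisson integral of [b], [poisson_ae]
   upgrades convergence along a sequence to the full radial limit. *)
have PB z : normc z < 1 -> poisson b z = B z.
  move=> z1; have [] := @complex_dominated R lambda
    (fun k t => (poisson_ker z t)%:C * B (rad (s k) t)) (fun t => (poisson_ker z t)%:C * b t)
    (fun=> 2 / (1 - normc z)).
  - by move=> n; apply: cmeasM => //; apply: cmeas_real; exact: poisson_ker_meas.
  - by apply: cmeasM => //; apply: cmeas_real; exact: poisson_ker_meas.
  - by apply: filterS cb => t h; apply: ccvgM => //; exact: ccvg_cst.
  - exact: rint_cst.
  - move=> n t; rewrite normc_mul normc_real ger0_norm ?poisson_ker_ge0//.
    rewrite -[leRHS]mulr1 ler_pM ?normc_ge0 ?poisson_ker_ge0//.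
    exact: poisson_ker_le.
  - move=> _ H; apply: (ccvg_unique _ H).
    have -> : (fun n => cintegral lambda (fun t => (poisson_ker z t)%:C * B (rad (s n) t))) =
      (fun n => B ((s n)%:C * z)); last exact: adisc_cvg.
    apply/funext => n; have /andP[s0 sl] := s01 n.
    exact: adisc_poisson.
exists b; split => //.
- have [i1 i2] := cbint.
  have p1 := poisson_ae i1; have p2 := poisson_ae i2.
  apply: filterS2 p1 p2 => t h1 h2.
  have eqn : \forall r \near (1 : R)^'-, B (rad r t) = poisson b (rad r t).
    near=> r; rewrite PB// normc_rad.
      by near: r; exact: nbhs_left_lt.
    by near: r; apply: nbhs_left_ge; exact: ltr01.
  split.
  + apply: cvg_trans h1; apply: near_eq_cvg; near=> r.
    rewrite (near eqn r)//= /poisson /=; apply: eq_Rintegral => u _.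
    by rewrite mul0r subr0.
  + apply: cvg_trans h2; apply: near_eq_cvg; near=> r.
    rewrite (near eqn r)//= /poisson /=; apply: eq_Rintegral => u _.
    by rewrite mul0r addr0.
- move=> k; have [] := @complex_dominated R lambda
    (fun n t => B (rad (s n) t) * e_ (Posz k) t) (fun t => b t * e_ (Posz k) t)
    (fun=> 1).
  + by move=> n; apply: cmeasM => //; exact: cmeas_e.
  + by apply: cmeasM => //; exact: cmeas_e.
  + by apply: filterS cb => t h; apply: ccvgM => //; exact: ccvg_cst.
  + exact: rint_cst.
  + by move=> n t; rewrite normc_mul normc_e mulr1.
  + move=> _ H; apply: (ccvg_unique _ H).
    have -> : (fun n => cintegral lambda (fun t => B (rad (s n) t) * e_ (Posz k) t)) =
      (fun n => if k == 0%N then B 0 else 0); last exact: ccvg_cst.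
    apply/funext => n; have /andP[s0 sl] := s01 n.
    exact: adisc_fourier.
Unshelve. all: by end_near.
Qed.
End fatou.

(** * Outer functions *)

Section almost_everywhere.
Context (R : realType) d (T : measurableType d) (mu : {measure set T -> \bar R}).

Lemma ae_Rintegral (u v : T -> R) : measurable_fun setT u -> measurable_fun setT v ->
  {ae mu, forall t, u t = v t} -> \int[mu]_t u t = \int[mu]_t v t.
Proof.
move=> mu_ mv uv; rewrite /Rintegral; congr fine; apply: ae_eq_integral => //.
- exact/measurable_EFinP.
- exact/measurable_EFinP.
- by apply: filterS uv => t -> _.
Qed.

Lemma ae_rint (u v : T -> R) : measurable_fun setT v ->
  {ae mu, forall t, u t = v t} -> rint mu u -> rint mu v.
Proof.
move=> mv uv ru; have mu_ := rint_meas ru; apply/integrableP; split; first exact/measurable_EFinP.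
move/integrableP : ru => [_]; congr (_ < _)%E; apply: ae_eq_integral => //.
- by apply: measurableT_comp => //; exact/measurable_EFinP.
- by apply: measurableT_comp => //; exact/measurable_EFinP.
- by apply: filterS uv => t /= -> _.
Qed.

Lemma ae_cintegral (f g : T -> R[i]) : cmeas f -> cmeas g ->
  {ae mu, forall t, f t = g t} -> cintegral mu f = cintegral mu g.
Proof.
move=> [f1 f2] [g1 g2] fg; apply: complexP => /=; apply: ae_Rintegral => //;
by apply: filterS fg => t ->.
Qed.
End almost_everywhere.

Section herglotz_exponential.
Context (R : realType).
Local Notation T := (circle R).
Local Notation lambda := (@circle_lebesgue R).
Local Notation C := R[i].
Implicit Types u v : T -> R.

(** With [c = 2^-1] and the logarithm of [w] for [u], this is the outer function ([hexp_outer]);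
    with [c = - 2^-1] and [u >= 0] it is bounded by 1. *)
Definition hexp (c : R) u (z : C) : C :=
  cexp (c%:C * herglotz (fun s => (u s)%:C) z).

Lemma cint_real u : rint lambda u -> cint lambda (fun s => (u s)%:C).
Proof. by move=> ru; split => //; exact: integrable0. Qed.

Lemma adisc_hexp c u : rint lambda u -> adisc (hexp c u).
Proof.
move=> ru; apply: adisc_cexp; apply: adiscM; first exact: adisc_cst.
by apply: adisc_herglotz; exact: cint_real.
Qed.

Lemma Re_herglotz u z : normc z < 1 ->
  Re (herglotz (fun s => (u s)%:C) z) = \int[lambda]_s (poisson_ker z s * u s).
Proof. by move=> z1; apply: eq_Rintegral => s _; rewrite ReM ReC ImC mulr0 subr0. Qed.

Lemma normc_hexp c u z : normc z < 1 ->
  normc (hexp c u z) = expR (c * \int[lambda]_s (poisson_ker z s * u s)).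
Proof.
by move=> z1; rewrite normc_cexp ReM ReC ImC mul0r subr0 Re_herglotz.
Qed.

Lemma hexp0 c u : rint lambda u -> hexp c u 0 = (expR (c * \int[lambda]_s u s))%:C.
Proof.
move=> ru; rewrite /hexp (_ : herglotz _ 0 = (\int[lambda]_s u s)%:C).
  rewrite (_ : _ * _ = (c * \int[lambda]_s u s)%:C) ?cexp_real//.
  by apply: complexP; rewrite !partsE; ring.
rewrite -cintegral_real; apply: eq_cintegral => s.
by rewrite /ker addr0 subr0 divff ?mul1r// e_neq0.
Qed.

Lemma herglotzD u v z : rint lambda u -> rint lambda v -> normc z < 1 ->
  herglotz (fun s => (u s + v s)%:C) z = herglotz (fun s => (u s)%:C) z + herglotz (fun s => (v s)%:C) z.
Proof.
move=> ru rv z1; rewrite /herglotz -cintegralD.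
- by apply: eq_cintegral => s; rewrite rmorphD /= mulrDr.
- by apply: cint_herglotz => //; exact: cint_real.
- by apply: cint_herglotz => //; exact: cint_real.
Qed.

Lemma herglotz_cst (c : R) z : normc z < 1 -> herglotz (fun=> c%:C) z = c%:C :> C.
Proof.
move=> z1; have := herglotz_e (Posz 0) z1; rewrite /herglotz => H.
rewrite -[RHS]mulr1 -[X in _ * X]H -cintegralZ.
- by apply: eq_cintegral => s; rewrite e_0 mulr1 mulrC.
- by apply: cint_herglotz => //; exact: cint_e.
Qed.

Lemma hexp_ge0 v : rint lambda v -> (forall t, 0 <= v t) -> exists b : T -> C,
  [/\ cmeas b, forall t, n2 (b t) <= 2,
   {ae lambda, forall t, ccvg (1 : R)^'- (fun r => hexp (- 2^-1) v (rad r t)) (b t)},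
   {ae lambda, forall t, n2 (b t) = expR (- v t)} &
   forall k, cintegral lambda (fun t => b t * e_ (Posz k) t) =
     if k == 0%N then (expR (- 2^-1 * \int[lambda]_t v t))%:C else 0].
Proof.
move=> rv v0; have B1 z : normc z < 1 -> normc (hexp (- 2^-1) v z) <= 1.
  move=> z1; rewrite normc_hexp// -expR0 ler_expR mulNr oppr_le0 mulr_ge0//.
  by apply: Rintegral_ge0 => s _; rewrite mulr_ge0// poisson_ker_ge0.
have [b [mb b2 cb fb]] := fatou (adisc_hexp (- 2^-1) rv) B1.
exists b; split => //; last by move=> k; rewrite fb hexp0.
apply: filterS2 cb (poisson_ae rv) => t cbt pt.
have h1 := ccvg_n2 (at_left_proper_filter (1 : R)) cbt.
have h2 : n2 (hexp (- 2^-1) v (rad r t)) @[r --> (1 : R)^'-] --> expR (- v t).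
  have h3 : expR (- (\int[lambda]_s (poisson_ker (rad r t) s * v s))) @[r --> (1 : R)^'-] --> expR (- v t).
    by apply: (cvg_comp _ _ (cvgN pt)); exact: continuous_expR.
  apply: cvg_trans h3; apply: near_eq_cvg; near=> r.
  have r1 : normc (rad r t) < 1.
    rewrite normc_rad; first by near: r; exact: nbhs_left_lt.
    by near: r; apply: nbhs_left_ge; exact: ltr01.
  rewrite -normc_n2 normc_hexp// -expRM_natl; congr expR.
  by field.
by rewrite -(cvg_unique _ h1 h2).
Unshelve. all: by end_near.
Qed.

(** The parts of [u] below and above the level [M]. By [pospq], [u] is [M + posq M u - posp M u], so
    its exponential is a quotient of two functions to which [hexp_ge0] applies. *)
Definition posp (M : R) u (t : T) : R := Num.max (M - u t) 0.
Definition posq (M : R) u (t : T) : R := Num.max (u t - M) 0.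

Lemma posp_rint M u : rint lambda u -> rint lambda (posp M u).
Proof.
move=> ru; have rm := rintB (rint_cst lambda M) ru.
apply: (rint_le _ _ (rint_abs rm)).
  apply: measurable_maxr; [exact: rint_meas rm|exact: measurable_cst].
move=> t; rewrite /posp; case: (lerP (M - u t) 0) => h; rewrite ?normr0//.
Qed.
Lemma posq_rint M u : rint lambda u -> rint lambda (posq M u).
Proof.
move=> ru; have rm := rintB ru (rint_cst lambda M).
apply: (rint_le _ _ (rint_abs rm)).
  apply: measurable_maxr; [exact: rint_meas rm|exact: measurable_cst].
move=> t; rewrite /posq; case: (lerP (u t - M) 0) => h; rewrite ?normr0//.
Qed.
Lemma posp_ge0 M u t : 0 <= posp M u t. Proof. by rewrite le_max lexx orbT. Qed.
Lemma posq_ge0 M u t : 0 <= posq M u t. Proof. by rewrite le_max lexx orbT. Qed.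
Lemma pospq M u t : u t + posp M u t = M + posq M u t.
Proof. by rewrite /posp /posq; case: (lerP (M - u t) 0); case: (lerP (u t - M) 0) => *; lra. Qed.

Lemma hexp_split M u z : rint lambda u -> normc z < 1 ->
  hexp 2^-1 u z * hexp (- 2^-1) (posq M u) z = (expR (M / 2))%:C * hexp (- 2^-1) (posp M u) z.
Proof.
move=> ru z1; rewrite /hexp -cexpD -cexp_real -cexpD; congr cexp.
have := herglotzD ru (posp_rint M ru) z1; rewrite (_ : (fun s => (u s + posp M u s)%:C) = fun s => (M + posq M u s)%:C); last first.
  by apply/funext => s; rewrite pospq.
rewrite (herglotzD (rint_cst lambda M) (posq_rint M ru) z1) herglotz_cst// => H.
rewrite rmorphM /= rmorphN mulNr mulNr [M%:C * _]mulrC -mulrBr -mulrBr; congr (_ * _).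
by apply/eqP; rewrite subr_eq addrAC eq_sym subr_eq H addrC.
Qed.

Lemma hexp_neq0 c u z : hexp c u z != 0.
Proof. by rewrite -normc_eq0 normc_cexp gt_eqF// expR_gt0. Qed.

Lemma rad_near (P : R -> Prop) : (forall r, 0 <= r -> r < 1 -> P r) -> \forall r \near (1 : R)^'-, P r.
Proof.
move=> H; near=> r; apply: H.
- by near: r; apply: nbhs_left_ge; exact: ltr01.
- by near: r; exact: nbhs_left_lt.
Unshelve. all: by end_near.
Qed.

Lemma ccvg_near (x y : R -> C) l : (forall r, 0 <= r -> r < 1 -> x r = y r) ->
  ccvg (1 : R)^'- x l -> ccvg (1 : R)^'- y l.
Proof.
move=> xy [a b]; split.
- by apply: cvg_trans a; apply: near_eq_cvg; apply: rad_near => r r0 r1; rewrite xy.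
- by apply: cvg_trans b; apply: near_eq_cvg; apply: rad_near => r r0 r1; rewrite xy.
Qed.

Lemma posq_lim u : rint lambda u -> \int[lambda]_t posq n%:R u t @[n --> \oo] --> 0.
Proof.
move=> ru; have [] := @real_dominated R lambda (fun n => posq n%:R u) (fun=> 0) (fun t => `|u t|).
- by move=> n; exact: rint_meas (posq_rint _ ru).
- exact: measurable_cst.
- apply: aeW => t; apply: cvg_near_cst; exists (Num.trunc (u t)).+1 => // n /= hn.
  rewrite /posq max_r// subr_le0 (le_trans (ltW (truncnS_gt _)))// ler_nat //.
- exact: rint_abs.
- move=> n t; rewrite ger0_norm ?posq_ge0// /posq ge_max normr_ge0 andbT.
  by rewrite lerBlDr (le_trans (ler_norm _))// lerDl.
by move=> _; rewrite /Rintegral integral0.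
Qed.

(* The quotient [b_p / b_q] of the bounded boundary functions belonging to [posp 0 u]
   and [posq 0 u].  Its Fourier coefficients come from
   [phi * hexp (- 2^-1) (posq n u) = exp (n / 2) * hexp (- 2^-1) (posp n u)]
   as [n --> oo]. *)
Lemma outer_boundary u : rint lambda u -> exists phi : T -> C,
  [/\ cmeas phi,
   {ae lambda, forall t, ccvg (1 : R)^'- (fun r => hexp 2^-1 u (rad r t)) (phi t)},
   {ae lambda, forall t, n2 (phi t) = expR (u t)} &
   rint lambda (fun t => expR (u t)) -> forall k,
   cintegral lambda (fun t => phi t * e_ (Posz k) t) =
     if k == 0%N then (expR (2^-1 * \int[lambda]_t u t))%:C else 0].
Proof.
move=> ru.
have Hp M := hexp_ge0 (posp_rint M ru) (posp_ge0 M u).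
have Hq M := hexp_ge0 (posq_rint M ru) (posq_ge0 M u).
have [p [mp p2 cp np fp]] := Hp 0.
have [q [mq q2 cq nq fq]] := Hq 0.
(* Equal to [p t / q t] almost everywhere, because [n2 (q t) = expR (- posq 0 u t)]; without an
   inverse the measurability is immediate. *)
pose phi t := p t * ((expR (posq 0 u t))%:C * (q t)^*).
have phiE : {ae lambda, forall t, phi t = p t / q t}.
  apply: filterS nq => t nqt; rewrite /phi; congr (_ * _).
  have q0 : q t != 0 by rewrite -n2_eq0 nqt gt_eqF// expR_gt0.
  apply: (mulfI q0); rewrite mulfV// mulrCA mul_conj -(rmorphM (real_complex R)) /= nqt expRN.
  by rewrite mulfV// gt_eqF// expR_gt0.
have mphi : cmeas phi.
  apply: cmeasM => //; apply: cmeasM; last exact: cmeas_conj.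
  apply: cmeas_real; apply: measurableT_comp => //; exact: rint_meas (posq_rint _ ru).
have cphi : {ae lambda, forall t, ccvg (1 : R)^'- (fun r => hexp 2^-1 u (rad r t)) (phi t)}.
  have cpq : {ae lambda, forall t, ccvg (1 : R)^'- (fun r => hexp (- 2^-1) (posp 0 u) (rad r t)) (p t) /\
      ccvg (1 : R)^'- (fun r => hexp (- 2^-1) (posq 0 u) (rad r t)) (q t)}.
    by apply: filterS2 cp cq.
  apply: filterS3 phiE cpq nq => t -> [cpt cqt] nqt.
  have q0 : q t != 0 by rewrite -n2_eq0 nqt gt_eqF// expR_gt0.
  have FF := at_left_proper_filter (1 : R).
  apply: ccvg_near (ccvgM FF cpt (ccvg_inv FF q0 cqt)) => r r0 r1.
  have := @hexp_split 0 u (rad r t) ru; rewrite normc_rad// => /(_ r1).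
  rewrite mul0r expR0 mul1r => <-.
  by rewrite mulfK// hexp_neq0.
have nphi : {ae lambda, forall t, n2 (phi t) = expR (u t)}.
  apply: filterS3 phiE np nq => t -> npt nqt.
  rewrite n2M n2_inv npt nqt -expRN opprK -expRD; congr expR.
  by have := pospq 0 u t; lra.
exists phi; split; [exact: mphi|exact: cphi|exact: nphi|move=> re k].
have Lphi : L2 lambda phi.
  apply/L2P; split => //; apply: ae_rint re; first exact: cmeas_n2.
  by apply: filterS nphi => t ->.
set I := cintegral lambda (fun t => phi t * e_ (Posz k) t).
set J := (X in I = X).
pose x n := \int[lambda]_t posq n%:R u t.
have x0 n : 0 <= x n by apply: Rintegral_ge0 => t _; exact: posq_ge0.
(* The coefficients of [phi * Q] are known, and the error is the pairing of [e_ k * phi] with the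
   conjugate of [1 - Q]. As [Q] has modulus at most 1 almost everywhere, the squared norm of [1 - Q]
   is at most 2 minus twice the real part of its mean, and that mean tends to 1. *)
have key (n : nat) : n2 (I - (expR (- 2^-1 * x n))%:C * J) <= nrm2 lambda phi * (2 - 2 * expR (- 2^-1 * x n)).
  have [P [mP P2 cP nP fP]] := Hp n%:R.
  have [Q [mQ Q2 cQ nQ fQ]] := Hq n%:R.
  have phiQ : {ae lambda, forall t, phi t * Q t = (expR (n%:R / 2))%:C * P t}.
    apply: filterS3 cphi cP cQ => t c1 c2 c3.
    have FF := at_left_proper_filter (1 : R).
    have h1 := ccvgM FF c1 c3; have h2 := ccvgM FF (ccvg_cst FF (expR (n%:R / 2))%:C) c2.
    apply: (ccvg_unique FF h1); apply: ccvg_near h2 => r r0 r1.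
    by rewrite hexp_split// normc_rad.
  have me := cmeas_e R (Posz k).
  have IQ : cintegral lambda (fun t => phi t * Q t * e_ (Posz k) t) = (expR (- 2^-1 * x n))%:C * J.
    have -> : cintegral lambda (fun t => phi t * Q t * e_ (Posz k) t) =
        cintegral lambda (fun t => (expR (n%:R / 2))%:C * (P t * e_ (Posz k) t)).
      apply: ae_cintegral.
      - by apply: cmeasM => //; exact: cmeasM.
      - by apply: cmeasM; [exact: cmeas_cst|exact: cmeasM].
      - by apply: filterS phiQ => t ->; rewrite mulrA.
    rewrite cintegralZ; last first.
      apply: (@cint_bdd _ _ _ 2); first exact: cmeasM.
      by move=> t; rewrite normc_mul normc_e mulr1 -n2_le_normc// (le_trans (P2 t))// expr2; lra.
    rewrite fP /J; case: ifP => _; last by rewrite !mulr0.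
    rewrite -!rmorphM /= -!expRD; congr (_%:C); congr expR.
    have : \int[lambda]_t (u t + posp n%:R u t) = \int[lambda]_t (n%:R + posq n%:R u t).
      by apply: eq_Rintegral => t _; rewrite pospq.
    rewrite !RintegralD//; [|exact: rint_cst|exact: posq_rint|exact: posp_rint].
    have -> : \int[lambda]_t (n%:R : R) = n%:R.
      by rewrite /Rintegral integral_cst// [X in (_ * X)%E](@circle_lebesgue_setT R) mule1.
    by rewrite -/(x n); lra.
  have LQ : L2 lambda Q by exact: L2_bdd Q2.
  have L1Q : L2 lambda (fun t => (1 - Q t)^*).
    by apply: L2_conj; apply: L2B => //; apply: (@L2_bdd _ _ _ 1) => [|t]; [exact: cmeas_cst|rewrite n2_1].
  have Lpe : L2 lambda (fun t => e_ (Posz k) t * phi t).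
    by apply: (L2M_bdd (M := 1)) => // t; rewrite n2_e.
  have -> : I - (expR (- 2^-1 * x n))%:C * J = ip lambda (fun t => e_ (Posz k) t * phi t) (fun t => (1 - Q t)^*).
    rewrite -IQ /I -cintegralB.
    - by apply: eq_cintegral => t; rewrite conjK; ring.
    - have := L2_cint Lphi (L2_conj (L2_e lambda (Posz k))).
      by under eq_fun do rewrite conjK.
    - have := L2_cint Lpe (L2_conj LQ).
      set A := (X in cint _ X); set B := (X in _ -> cint _ X); have -> : A = B; last by [].
      by apply/funext => t; rewrite /A /B conjK; ring.
  apply: (le_trans (ip_CS Lpe L1Q)); apply: ler_pM; rewrite ?nrm2_ge0//.
    by rewrite /nrm2; under eq_Rintegral do rewrite n2M n2_e mul1r.
  have cQ0 : cintegral lambda Q = (expR (- 2^-1 * x n))%:C.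
    have := fQ 0%N; rewrite eqxx => <-; apply: eq_cintegral => t.
    by rewrite e_0 mulr1.
  have [rQ1 rQ2] : cint lambda Q.
    apply: (@cint_bdd _ _ _ 2) => // t.
    by rewrite -n2_le_normc// (le_trans (Q2 t))// expr2; lra.
  have mE : measurable_fun setT (fun t => expR (- posq n%:R u t)).
    apply: measurableT_comp => //; apply: measurableT_comp => //.
    exact: rint_meas (posq_rint _ ru).
  have E1 : nrm2 lambda (fun t => (1 - Q t)^*) = \int[lambda]_t (1 - 2 * Re (Q t) + expR (- posq n%:R u t)).
    apply: ae_Rintegral.
    - exact: cmeas_n2 (L2_meas L1Q).
    - apply: measurable_funD => //; apply: measurable_funB; first exact: measurable_cst.
      by apply: measurable_funM; [exact: measurable_cst|case: mQ].
    - by apply: filterS nQ => t Qt; rewrite -Qt n2conj /n2 !partsE /=; ring.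
  rewrite E1; apply: (@le_trans _ _ (\int[lambda]_t (2 - 2 * Re (Q t)))).
    have r2 c : rint lambda (fun t => c - 2 * Re (Q t)).
      by apply: rintB; [exact: rint_cst|exact: rintZ].
    apply: le_Rintegral => //.
    - apply: rintD; first exact: r2.
      apply: (@rint_bdd _ _ _ 1) => // t; rewrite ger0_norm ?expR_ge0//.
      by rewrite -expR0 ler_expR oppr_le0 posq_ge0.
    - exact: r2.
    - move=> t _; have : expR (- posq n%:R u t) <= 1 by rewrite -expR0 ler_expR oppr_le0 posq_ge0.
      lra.
  rewrite RintegralB//; [|exact: rint_cst|exact: rintZ].
  rewrite RintegralZl//.
  have -> : \int[lambda]_t (2 : R) = 2.
    by rewrite /Rintegral integral_cst// [X in (_ * X)%E](@circle_lebesgue_setT R) mule1.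
  by rewrite (_ : \int[lambda]_t Re (Q t) = expR (- 2^-1 * x n))// -[RHS]ReC -cQ0.
have ex : expR (- 2^-1 * x n) @[n --> \oo] --> (1 : R).
  have x1 : (- 2^-1 * x n) @[n --> \oo] --> - 2^-1 * (0 : R) by apply: cvgMr; exact: posq_lim.
  by have := cvg_comp _ _ x1 (@continuous_expR R _); rewrite mulr0 expR0.
have l1 : ccvg \oo (fun n => I - (expR (- 2^-1 * x n))%:C * J) (I - J).
  have h : ccvg \oo (fun n => (expR (- 2^-1 * x n))%:C) (1 : C).
    by split; [exact: ex|exact: cvg_cst].
  have [a b] := ccvgM _ h (ccvg_cst _ J); rewrite mul1r in a b.
  split; first by under eq_fun do rewrite ReD ReN; rewrite ReD ReN; apply: cvgB => //; exact: cvg_cst.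
  by under eq_fun do rewrite ImD ImN; rewrite ImD ImN; apply: cvgB => //; exact: cvg_cst.
have l2 : n2 (I - (expR (- 2^-1 * x n))%:C * J) @[n --> \oo] --> n2 (I - J) by exact: ccvg_n2 l1.
have l3 : nrm2 lambda phi * (2 - 2 * expR (- 2^-1 * x n)) @[n --> \oo] --> (0 : R).
  have -> : 0 = nrm2 lambda phi * (2 - 2 * 1) by ring.
  apply: cvgMr; apply: cvgB; first exact: cvg_cst.
  by apply: cvgMr.
have : n2 (I - J) <= 0.
  apply: (ler_cvg_to l2 l3); apply: nearW => n; exact: key.
rewrite le_eqVlt ltNge n2_ge0 orbF n2_eq0 subr_eq0 => /eqP //.
Qed.

Lemma hexp_outer (w : T -> R) z : outer w z = hexp 2^-1 (fun s => ln (w s)) z.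
Proof. by rewrite /outer /hexp; congr (cexp (_ * _)); apply: complexP; rewrite -?real_complexE fmorphV rmorph_nat. Qed.

Lemma varphi_spec (w : T -> R) : measurable_fun setT w -> (forall t, 0 <= w t) ->
  rint lambda w -> lambda.-integrable setT (fun s => (lne (w s)%:E)) ->
  exists phi : T -> C,
  [/\ cmeas phi, {ae lambda, forall t, varphi w t = phi t},
   {ae lambda, forall t, n2 (phi t) = w t},
   rint lambda (fun t => ln (w t)) &
   forall k, cintegral lambda (fun t => phi t * e_ (Posz k) t) =
     if k == 0%N then (expR (2^-1 * \int[lambda]_t ln (w t)))%:C else 0].
Proof.
move=> mw w0 rw iw.
have mln : measurable_fun setT (fun t => ln (w t)) by exact: measurableT_comp.
(* [lne] is [-oo] at 0, so integrability already excludes the zeros of [w] up to a null set. *)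
have ae0 : {ae lambda, forall t, 0 < w t}.
  have := integrable_ae measurableT iw; apply: filterS => t /(_ I).
  by rewrite ltNge /lne; case: ifP.
have rl : rint lambda (fun t => ln (w t)).
  apply/integrableP; split; first exact/measurable_EFinP.
  move/integrableP : iw => [miw]; congr (_ < _)%E; apply: ae_eq_integral => //.
  - exact: measurableT_comp.
  - by apply: measurableT_comp => //; exact/measurable_EFinP.
  - by apply: filterS ae0 => t wt _; rewrite /= leNgt wt.
have [phi [mp cp np fp]] := outer_boundary rl.
have re : {ae lambda, forall t, expR (ln (w t)) = w t} by apply: filterS ae0 => t wt; rewrite lnK.
have re' : {ae lambda, forall t, w t = expR (ln (w t))} by apply: filterS re => t ->.
exists phi; split => //.
- apply: filterS cp => t ct; rewrite /varphi asboolT//.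
  apply: ccvg_lim; apply: ccvg_near ct => r r0 r1.
  by rewrite hexp_outer.
- by apply: filterS2 np re => t -> ->.
- by move=> k; apply: fp; apply: ae_rint re' rw; exact: measurableT_comp.
Qed.
End herglotz_exponential.

(** * Szego's theorem *)

Section szego_bounded.
Context (R : realType).
Local Notation T := (circle R).
Local Notation lambda := (@circle_lebesgue R).
Local Notation C := R[i].

Lemma Rintegral_lambda_cst (c : R) : \int[lambda]_t c = c.
Proof. by rewrite /Rintegral integral_cst// [X in (_ * X)%E](@circle_lebesgue_setT R) mule1. Qed.

Lemma le_Rint (nu : {measure set T -> \bar R}) (u v : T -> R) : rint nu u -> rint nu v ->
  (forall t, u t <= v t) -> \int[nu]_t u t <= \int[nu]_t v t.
Proof. by move=> ru rv uv; apply: le_Rintegral => // t _; exact: uv. Qed.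

Lemma chord_meas (t : T) : measurable_fun setT (fun s => chord s t).
Proof.
apply: lip_meas; exists 1; split => // s s'; rewrite mul1r ler_norml.
have := chord_tri s s' t; have := chord_tri s' s t; rewrite (chord_sym s' s) => h1 h2.
by apply/andP; split; lra.
Qed.

Lemma chord2_rint (nu : {finite_measure set T -> \bar R}) (t : T) : rint nu (fun s => chord s t ^+ 2).
Proof.
apply: (@rint_bdd _ _ _ 4) => [|s]; first by apply: measurable_funX; exact: chord_meas.
by rewrite ger0_norm ?sqr_ge0//; have := chord_ge0 s t; have := chord_le2 s t; nra.
Qed.

Lemma Re_realM (a : R) (z : C) : Re (a%:C * z) = a * Re z.
Proof. by rewrite ReM ReC ImC mul0r subr0. Qed.
Lemma Im_realM (a : R) (z : C) : Im (a%:C * z) = a * Im z.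
Proof. by rewrite ImM ReC ImC mul0r addr0. Qed.

(** The squared chord is affine in the real and imaginary parts of [e_ 1], whose Poisson integrals
    are exact. This is the second moment behind [poisson_lip]. *)
Lemma poisson_chord2 r t : 0 <= r -> r < 1 ->
  \int[lambda]_s (poisson_ker (rad r t) s * chord s t ^+ 2) = 2 - 2 * r.
Proof.
move=> r0 r1; have z1 : normc (rad r t) < 1 by rewrite normc_rad.
have re n : rint lambda (fun s => Re (e_ n s)) /\ rint lambda (fun s => Im (e_ n s)) by exact: cint_e.
have E s : chord s t ^+ 2 = 2 - 2 * (Re (e_ 1 s) * Re (e_ 1 t) + Im (e_ 1 s) * Im (e_ 1 t)).
  rewrite chord_sqr; have := n2_e 1 s; have := n2_e 1 t; rewrite /n2 !partsE.
  by move=> h1 h2; rewrite !sqrrD; lra.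
have [p1 p2] : \int[lambda]_s (poisson_ker (rad r t) s * Re (e_ 1 s)) = r * Re (e_ 1 t) /\
    \int[lambda]_s (poisson_ker (rad r t) s * Im (e_ 1 s)) = r * Im (e_ 1 t).
  have hp := poisson_e 1 z1; rewrite expr1 in hp.
  have := congr1 (@complex.Im R) hp; have := congr1 (@complex.Re R) hp.
  rewrite !partsE !mul0r subr0 addr0 => <- <-; split; apply: eq_Rintegral => s _.
    exact/esym/Re_realM.
  exact/esym/Im_realM.
have rP v : rint lambda v -> rint lambda (fun s => poisson_ker (rad r t) s * v s).
  by move=> rv; exact: poisson_ker_rint.
have [e1 e2] := re 1.
have -> : \int[lambda]_s (poisson_ker (rad r t) s * chord s t ^+ 2) =
    \int[lambda]_s (2 * poisson_ker (rad r t) s -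
      ((2 * Re (e_ 1 t)) * (poisson_ker (rad r t) s * Re (e_ 1 s)) +
      (2 * Im (e_ 1 t)) * (poisson_ker (rad r t) s * Im (e_ 1 s)))).
  by apply: eq_Rintegral => s _; rewrite E; ring.
have rk : rint lambda (poisson_ker (rad r t)).
  by have := rP _ (rint_cst lambda 1); under eq_fun do rewrite mulr1.
rewrite RintegralB//; [|exact: rintZ|by apply: rintD; apply: rintZ; exact: rP].
rewrite RintegralZl// poisson_ker1// RintegralD//; [|by apply: rintZ; exact: rP..].
rewrite !RintegralZl//; [|exact: rP..]; rewrite p1 p2.
have := n2_e 1 t; rewrite /n2 => h.
have -> : 2 * Re (e_ 1 t) * (r * Re (e_ 1 t)) + 2 * Im (e_ 1 t) * (r * Im (e_ 1 t)) =
  2 * r * (Re (e_ 1 t) ^+ 2 + Im (e_ 1 t) ^+ 2) by ring.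
by rewrite h; ring.
Qed.

(** Uniform in [t], unlike [poisson_ae]. The inequality [x <= c + x ^+ 2 / c] turns the Lipschitz
    bound into a quadratic one, which [poisson_chord2] integrates: the first term costs [e / 2], and
    the second becomes small with [1 - r]. *)
Lemma poisson_lip g e : lip g -> 0 < e -> exists r, [/\ 0 <= r, r < 1 &
  forall t, `|\int[lambda]_s (poisson_ker (rad r t) s * g s) - g t| <= e].
Proof.
move=> lg e0; have [L [L0 gL]] := lg; have rg := lip_rint lambda lg.
pose K := L + 1; have K0 : 0 < K by rewrite /K; lra.
pose c := e / 2 / K; have c0 : 0 < c by rewrite !divr_gt0.
pose eta := Num.min (e * c / (4 * K)) 1.
have eta0 : 0 < eta by rewrite lt_min ltr01 andbT divr_gt0// mulr_gt0.
have eta1 : eta <= 1 by rewrite ge_min lexx orbT.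
have etaK : K * (2 * eta) / c <= e / 2.
  have : eta <= e * c / (4 * K) by rewrite ge_min lexx.
  rewrite ler_pdivlMr ?mulr_gt0// => h; rewrite ler_pdivrMr//; lra.
exists (1 - eta); split; [lra|lra|] => t.
have r0 : 0 <= 1 - eta by lra. have r1 : 1 - eta < 1 by lra.
have z1 : normc (rad (1 - eta) t) < 1 by rewrite normc_rad.
have rP v : rint lambda v -> rint lambda (fun s => poisson_ker (rad (1 - eta) t) s * v s).
  by move=> rv; exact: poisson_ker_rint.
have rgt : rint lambda (fun s => g s - g t) by apply: rintB => //; exact: rint_cst.
have -> : \int[lambda]_s (poisson_ker (rad (1 - eta) t) s * g s) - g t =
    \int[lambda]_s (poisson_ker (rad (1 - eta) t) s * (g s - g t)).
  have -> : \int[lambda]_s (poisson_ker (rad (1 - eta) t) s * (g s - g t)) =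
    \int[lambda]_s (poisson_ker (rad (1 - eta) t) s * g s - g t * poisson_ker (rad (1 - eta) t) s).
    by apply: eq_Rintegral => s _; ring.
  have rk : rint lambda (poisson_ker (rad (1 - eta) t)).
    by have := rP _ (rint_cst lambda 1); under eq_fun do rewrite mulr1.
  rewrite RintegralB//; [|exact: rP|exact: rintZ].
  by rewrite RintegralZl// poisson_ker1// mulr1.
apply: le_trans (le_normr_Rintegral measurableT (rP _ rgt)) _.
have H (x : R) : 0 <= x -> L * x <= K * (c + x ^+ 2 / c).
  move=> x0; have : x <= c + x ^+ 2 / c.
    have [xc|cx] := lerP x c.
      by have : 0 <= x ^+ 2 / c; [rewrite divr_ge0// ?sqr_ge0// ltW|lra].
    have : x <= x ^+ 2 / c by rewrite ler_pdivlMr// expr2 ler_wpM2l// ltW.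
    lra.
  move=> h; apply: le_trans (_ : L * (c + x ^+ 2 / c) <= _); first by rewrite ler_wpM2l.
  by rewrite ler_wpM2r// ?/K; [exact: le_trans h|lra].
have rc : rint lambda (fun s => K * (c + chord s t ^+ 2 / c)).
  apply: rintZ; apply: rintD; first exact: rint_cst.
  by under eq_fun do rewrite mulrC; apply: rintZ; exact: chord2_rint.
apply: (@le_trans _ _ (\int[lambda]_s (poisson_ker (rad (1 - eta) t) s * (K * (c + chord s t ^+ 2 / c))))).
  apply: le_Rint; [exact: rint_abs (rP _ rgt)|exact: rP|] => s.
  rewrite normrM ger0_norm ?poisson_ker_ge0// ler_wpM2l ?poisson_ker_ge0//.
  exact: le_trans (gL s t) (H _ (chord_ge0 _ _)).
have -> : \int[lambda]_s (poisson_ker (rad (1 - eta) t) s * (K * (c + chord s t ^+ 2 / c))) =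
   \int[lambda]_s (K * c * poisson_ker (rad (1 - eta) t) s +
      K / c * (poisson_ker (rad (1 - eta) t) s * chord s t ^+ 2)).
  by apply: eq_Rintegral => s _; field; rewrite gt_eqF.
have rk : rint lambda (poisson_ker (rad (1 - eta) t)).
  by have := rP _ (rint_cst lambda 1); under eq_fun do rewrite mulr1.
have rk2 := rP _ (chord2_rint lambda t).
rewrite RintegralD//; [|exact: rintZ..].
rewrite !RintegralZl// poisson_ker1// poisson_chord2// mulr1.
have -> : K * c = e / 2 by rewrite /c mulrC divfK// gt_eqF.
have -> : K / c * (2 - 2 * (1 - eta)) = K * (2 * eta) / c by ring.
lra.
Qed.

Lemma szego_lip g K : lip g -> 1 < K -> exists p : {poly C}, p.[0] = 1 /\
  forall t, n2 p.[e_ 1 t] <= K * expR (g t - \int[lambda]_s g s).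
Proof.
move=> lg K1; have [M M0 gM] := lip_bdd lg; have rg := lip_rint lambda lg.
(* [(1 + d) ^+ 2] is the loss of the polynomial on the circle, [(1 - d) ^+ 2] its loss at 0 through
   the normalisation, and [expR d] the distance between the Poisson integral and [g]. *)
have [d [d0 d1 dK]] : exists d : R, [/\ 0 < d, d < 1 & ((1 + d) / (1 - d)) ^+ 2 * expR d <= K].
  have h : ((1 + x) / (1 - x)) ^+ 2 * expR x @[x --> (0 : R)^'+] --> ((1 + 0) / (1 - 0)) ^+ 2 * expR (0 : R).
    have cx : x @[x --> (0 : R)^'+] --> (0 : R) by exact: cvg_at_right_filter.
    apply: cvgM; last exact: cvg_comp _ _ cx (@continuous_expR R _).
    rewrite expr2; under eq_fun do rewrite expr2.
    by apply: cvgM; (apply: cvgM; [apply: cvgD => //; exact: cvg_cst|apply: cvgV; [lra|apply: cvgB => //; exact: cvg_cst]]).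
  rewrite subr0 addr0 divr1 expr1n mul1r expR0 in h.
  have [d []] : exists d : R, [/\ 0 < d, d < 1 & ((1 + d) / (1 - d)) ^+ 2 * expR d < K].
    apply: (@filter_ex _ (0 : R)^'+); near=> d; split.
    - by near: d; exact: nbhs_right_gt.
    - by near: d; exact: nbhs_right_lt.
    - by near: d; exact: (cvgr_lt _ h).
  by move=> ? ? ?; exists d; split => //; exact: ltW.
have [r [r0 r1 gr]] := poisson_lip lg d0.
pose G := hexp 2^-1 g.
have nG t s : 0 <= s -> s < 1 -> normc (G (rad s t)) = expR (2^-1 * \int[lambda]_u (poisson_ker (rad s t) u * g u)).
  by move=> s0 s1; rewrite normc_hexp// normc_rad.
have n2G t : n2 (G (rad r t)) <= expR (g t + d).
  rewrite -normc_n2 nG// -expRM_natl ler_expR.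
  by have := gr t; rewrite ler_norml => /andP[_]; lra.
have G0 : normc (G 0) = expR (2^-1 * \int[lambda]_u g u).
  by rewrite /G hexp0// normc_real ger0_norm ?expR_ge0.
have Glow t s : 0 <= s -> s < 1 -> expR (- (2^-1 * M)) <= normc (G (rad s t)).
  move=> s0 s1; rewrite nG// ler_expR -mulrN ler_pM2l//.
  have z1 : normc (rad s t) < 1 by rewrite normc_rad.
  have -> : - M = \int[lambda]_u (poisson_ker (rad s t) u * - M).
    have rk : rint lambda (poisson_ker (rad s t)).
      by have := poisson_ker_rint (rint_cst lambda 1) z1; under eq_fun do rewrite mulr1.
    by under eq_Rintegral do rewrite mulrC; rewrite RintegralZl// poisson_ker1// mulr1.
  apply: le_Rint; [apply: poisson_ker_rint => //; exact: rint_cst|exact: poisson_ker_rint|] => u.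
  by rewrite ler_wpM2l ?poisson_ker_ge0//; have := gM u; rewrite ler_norml => /andP[].
(* A lower bound for [normc (G z)] on the disc, where the Poisson integral of [g] is at least [- M];
   the absolute error [d * c] is therefore a relative error [d]. *)
pose c := expR (- (2^-1 * M)); have c0 : 0 < c by exact: expR_gt0.
have [p0 hp0] := @adisc_rad R G r (d * c) (adisc_hexp 2^-1 rg) r0 r1 (mulr_gt0 d0 c0).
have up t : normc p0.[rad r t] <= (1 + d) * normc (G (rad r t)).
  have := hp0 r t r0 (lexx _); rewrite normc_dist => h.
  have := normcD (p0.[rad r t] - G (rad r t)) (G (rad r t)); rewrite subrK => h2.
  have := Glow t r r0 r1; rewrite -/c => h3; nra.
have rad0 t : rad 0 t = 0 :> C by rewrite /rad mul0r.
have lo : (1 - d) * normc (G 0) <= normc p0.[0].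
  have := hp0 0 point (lexx _) r0; rewrite rad0 => h.
  have := normcD (G 0 - p0.[0]) p0.[0]; rewrite subrK => h2.
  have := Glow point 0 (lexx _) ltr01; rewrite rad0 -/c => h3; nra.
have p00 : 0 < normc p0.[0] by apply: lt_le_trans lo; rewrite G0 mulr_gt0 ?expR_gt0//; lra.
have comp z : (p0 \Po (r%:C *: 'X)).[z] = p0.[r%:C * z] by rewrite horner_comp hornerZ hornerX.
exists ((p0.[0])^-1 *: (p0 \Po (r%:C *: 'X))); split.
  by rewrite hornerZ comp mulr0 mulVf// -normc_eq0 gt_eqF.
move=> t; rewrite hornerZ comp -/(rad r t) n2M n2_inv -!normc_n2.
have h1 : normc p0.[rad r t] ^+ 2 <= (1 + d) ^+ 2 * expR (g t + d).
  apply: le_trans (_ : (1 + d) ^+ 2 * n2 (G (rad r t)) <= _); last by rewrite ler_pM2l// exprn_gt0//; lra.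
  by rewrite -normc_n2 -exprMn lerXn2r ?nnegrE ?normc_ge0// mulr_ge0 ?normc_ge0//; lra.
have h2 : (1 - d) ^+ 2 * expR (\int[lambda]_s g s) <= normc p0.[0] ^+ 2.
  have -> : expR (\int[lambda]_s g s) = normc (G 0) ^+ 2.
    by rewrite G0 -expRM_natl; congr expR; field.
  by rewrite -exprMn lerXn2r ?nnegrE ?normc_ge0// mulr_ge0 ?normc_ge0//; lra.
rewrite mulrC ler_pdivrMr ?exprn_gt0//.
apply: le_trans h1 _.
apply: le_trans (_ : K * expR (g t - \int[lambda]_s g s) * ((1 - d) ^+ 2 * expR (\int[lambda]_s g s)) <= _);
  last by rewrite ler_wpM2l// mulr_ge0 ?expR_ge0//; lra.
have -> : K * expR (g t - \int[lambda]_s g s) * ((1 - d) ^+ 2 * expR (\int[lambda]_s g s)) =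
  K * (1 - d) ^+ 2 * (expR (g t - \int[lambda]_s g s) * expR (\int[lambda]_s g s)) by ring.
rewrite -expRD subrK expRD mulrCA [leRHS]mulrC ler_pM2l ?expR_gt0//.
have d1' : 0 < 1 - d by lra.
move: dK; rewrite expr_div_n mulrAC ler_pdivrMr ?exprn_gt0//.
Unshelve. all: by end_near.
Qed.

Lemma poly_e_meas (p : {poly C}) : cmeas (fun t : T => p.[e_ 1 t]).
Proof.
have := poly_rad_cmeas p 1; have -> : (fun t : T => p.[rad 1 t]) = fun t => p.[e_ 1 t] by apply/funext => t; rewrite /rad mul1r.
by [].
Qed.

Lemma poly_e_bdd (p : {poly C}) : exists2 M : R, 0 <= M & forall t : T, n2 p.[e_ 1 t] <= M.
Proof.
have [M M0 pM] := @poly_bdd R p 1 ler01; exists (M ^+ 2); first exact: sqr_ge0.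
by move=> t; rewrite n2_le_normc// pM// normc_e.
Qed.

Lemma poly_e_L2 (nu : {finite_measure set T -> \bar R}) (p : {poly C}) : L2 nu (fun t => p.[e_ 1 t]).
Proof. by have [M M0 pM] := poly_e_bdd p; apply: (@L2_bdd _ _ _ M) pM; exact: poly_e_meas. Qed.

Section sum_of_finite_measures.
Variables nu1 nu2 : {finite_measure set T -> \bar R}.
Definition nu12 : set T -> \bar R := measure_add nu1 nu2.
HB.instance Definition _ := Measure.on nu12.
Let fin12 : fin_num_fun nu12.
Proof. by move=> A mA; rewrite /nu12 measure_addE fin_numD !fin_num_measure. Qed.
HB.instance Definition _ := Measure_isFinite.Build _ _ _ nu12 fin12.

Lemma nu12_dist (u : T -> R) : rint nu12 u ->
  \int[nu12]_t `|u t| = \int[nu1]_t `|u t| + \int[nu2]_t `|u t| .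
Proof.
move=> /integrableP[mu_ iu]; rewrite /Rintegral /nu12 ge0_integral_measure_add//; last first.
  by move/measurable_EFinP : mu_ => mu_; apply/measurable_EFinP; exact: measurableT_comp.
have h : (\int[nu1]_t `|(u t)%:E| + \int[nu2]_t `|(u t)%:E| < +oo)%E.
  by rewrite -ge0_integral_measure_add//; apply: measurableT_comp.
rewrite fineD//.
- by rewrite ge0_fin_numE ?integral_ge0//; apply: le_lt_trans h; rewrite leeDl ?integral_ge0.
- by rewrite ge0_fin_numE ?integral_ge0//; apply: le_lt_trans h; rewrite leeDr ?integral_ge0.
Qed.
End sum_of_finite_measures.

Lemma expR_dist (M x y : R) : x <= M -> y <= M -> `|expR x - expR y| <= expR M * `|x - y|.
Proof.
wlog xy : x y / x <= y => [H|] xM yM.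
  case/orP: (le_total x y) => [/H|yx]; first by move=> h; exact: h.
  by rewrite distrC [X in _ * X]distrC; exact: H.
rewrite distrC [X in _ * X]distrC !ger0_norm ?subr_ge0 ?ler_expR//.
have := expR_ge1Dx (x - y) => h.
have -> : expR x = expR (x - y) * expR y by rewrite -expRD subrK.
have : expR y <= expR M by rewrite ler_expR.
have := expR_gt0 y; nra.
Qed.

Lemma szego_bdd (nu : {finite_measure set T -> \bar R}) (f : T -> R) M e :
  measurable_fun setT f -> (forall t, `|f t| <= M) -> 0 < e ->
  exists p : {poly C}, p.[0] = 1 /\
   nrm2 nu (fun t => p.[e_ 1 t]) <=
     expR (- \int[lambda]_t f t) * \int[nu]_t expR (f t) + e.
Proof.
move=> mf fM e0; have M0 : 0 <= M by exact: le_trans (normr_ge0 _) (fM point).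
set I := \int[lambda]_t f t; set A := \int[nu]_t expR (f t).
have rexp (h : T -> R) : measurable_fun setT h -> (forall t, `|h t| <= M) -> rint nu (fun t => expR (h t)).
  move=> mh hM; apply: (@rint_bdd _ _ _ (expR M)) => [|t]; first exact: measurableT_comp.
  by rewrite ger0_norm ?expR_ge0// ler_expR (le_trans (ler_norm _)).
(* The factor [1 + d] comes from [szego_lip], [expR (d - I)] from the change of the integral over
   [lambda], and [expR M * d] from the change of the integral over [nu]. *)
have [d [d0 dK]] : exists d : R, 0 < d /\ (1 + d) * (expR (d - I) * (A + expR M * d)) <= expR (- I) * A + e.
  have h : (1 + x) * (expR (x - I) * (A + expR M * x)) @[x --> (0 : R)^'+] -->
      (1 + 0) * (expR (0 - I) * (A + expR M * 0)).
    have cx : x @[x --> (0 : R)^'+] --> (0 : R) by exact: cvg_at_right_filter.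
    apply: cvgM; first by apply: cvgD => //; exact: cvg_cst.
    apply: cvgM; first by apply: (cvg_comp _ _ (cvgB cx (cvg_cst I))); exact: continuous_expR.
    by apply: cvgD; [exact: cvg_cst|apply: cvgM => //; exact: cvg_cst].
  rewrite mulr0 !addr0 mul1r add0r in h.
  have [d []] : exists d : R, 0 < d /\ (1 + d) * (expR (d - I) * (A + expR M * d)) < expR (- I) * A + e.
    apply: (@filter_ex _ (0 : R)^'+); near=> d; split.
    - by near: d; exact: nbhs_right_gt.
    - by near: d; apply: (cvgr_lt _ h); rewrite ltrDl.
  by move=> ? ?; exists d; split => //; exact: ltW.
pose nn : {finite_measure set T -> \bar R} := nu12 lambda nu.
have rf (n : {finite_measure set T -> \bar R}) : rint n f by exact: rint_bdd fM.
have [_ /(_ d d0) [g0 lg0 dg0]] := rint_lipdense (rf nn).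
(* Clipping keeps [g] below [M], where the exponential is Lipschitz with constant [expR M], and
   brings it no further from [f]. *)
pose g t := clip M (g0 t); have lg : lip g by exact: lip_clip.
have gM t : `|g t| <= M by exact: clip_norm.
have fg t : `|f t - g t| <= `|f t - g0 t| by rewrite -[X in `|X - g t|](clip_id (fM t)); exact: clip_lip.
have rfg (n : {finite_measure set T -> \bar R}) : rint n (fun t => f t - g t).
  by apply: rintB => //; exact: lip_rint.
have rfg0 (n : {finite_measure set T -> \bar R}) : rint n (fun t => f t - g0 t).
  by apply: rintB => //; exact: lip_rint.
have : \int[nn]_t `|f t - g t| <= d.
  by apply: le_trans dg0; apply: le_Rint => //; apply: rint_abs.
rewrite (nu12_dist (rfg nn)) => h.
have g1 : 0 <= \int[lambda]_t `|f t - g t| by apply: Rintegral_ge0.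
have g2 : 0 <= \int[nu]_t `|f t - g t| by apply: Rintegral_ge0.
have Ig : I - d <= \int[lambda]_t g t.
  have := le_normr_Rintegral measurableT (rfg lambda).
  rewrite RintegralB//; [|exact: (rf lambda)|exact: lip_rint].
  by rewrite ler_norml -/I => /andP[_]; lra.
have Ag : \int[nu]_t expR (g t) <= A + expR M * d.
  apply: (@le_trans _ _ (\int[nu]_t (expR (f t) + expR M * `|f t - g t|))).
    apply: le_Rint; [by apply: rexp => //; exact: lip_meas|apply: rintD; [exact: rexp|apply: rintZ; exact: rint_abs]|] => t.
    have := expR_dist (le_trans (ler_norm _) (gM t)) (le_trans (ler_norm _) (fM t)).
    by rewrite ler_norml distrC => /andP[]; lra.
  rewrite RintegralD//; [|exact: rexp|by apply: rintZ; exact: rint_abs].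
  rewrite RintegralZl//; last exact: rint_abs.
  by rewrite lerD2l ler_pM2l ?expR_gt0//; lra.
have d1 : 1 < 1 + d by rewrite ltrDl.
have [p [p0 pK]] := szego_lip lg d1.
exists p; split => //; apply: le_trans dK.
apply: (@le_trans _ _ (\int[nu]_t ((1 + d) * expR (- \int[lambda]_s g s) * expR (g t)))).
  apply: le_Rint.
  - exact: L2_n2 (poly_e_L2 nu p).
  - by apply: rintZ; apply: rexp => //; exact: lip_meas.
  - by move=> t; rewrite -mulrA -expRD (addrC _ (g t)); exact: pK.
rewrite RintegralZl//; last by apply: rexp => //; exact: lip_meas.
have A0 : 0 <= \int[nu]_t expR (g t) by apply: Rintegral_ge0 => t _; exact: expR_ge0.
rewrite -mulrA ler_pM2l ?(lt_trans ltr01 d1)//; apply: ler_pM; rewrite ?expR_ge0//.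
by rewrite ler_expR -(opprB I d) lerN2.
Unshelve. all: by end_near.
Qed.
End szego_bounded.

(** * Szego's theorem for a measure with singular part *)

Section lebesgue_decomposition.
Context (R : realType).
Local Notation T := (circle R).
Local Notation lambda := (@circle_lebesgue R).
Local Notation C := R[i].
Local Open Scope charge_scope.
Variables (mu : {finite_measure set T -> \bar R}) (w : T -> R).
Hypothesis hw : is_ac_density mu w.

Lemma ac_density_split : exists (N : set T) (mus : {finite_measure set T -> \bar R}),
  [/\ measurable N, lambda N = 0%E, mus (~` N) = 0%E &
   forall h : T -> R, rint mu h ->
    [/\ rint mus h, rint lambda (fun t => h t * w t) &
     \int[mu]_t h t = \int[lambda]_t (h t * w t) + \int[mus]_t h t]].
Proof.
have [mw w0 [mua [mus [aca [N [mN N0 sN]] muE wE]]]] := hw.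
exists N, mus; split => // h rh.
have mh := rint_meas rh.
have me : measurable_fun setT (EFin \o h) by exact/measurable_EFinP.
have mabs : measurable_fun setT (fun t => `|(h t)%:E|%E) by exact: measurableT_comp.
have fE (k : T -> \bar R) : (\int[mu]_t k t = \int[measure_add mua mus]_t k t)%E.
  apply: eq_measure_integral => A mA _.
  exact: eq_trans (muE A mA) (esym (measure_addE mua mus A)).
have ab : (\int[mua]_t `|(h t)%:E| + \int[mus]_t `|(h t)%:E| < +oo)%E.
  rewrite -ge0_integral_measure_add//.
  by move/integrableP : rh => [_]; rewrite fE.
have ra : rint mua h.
  apply/integrableP; split => //; apply: le_lt_trans ab.
  by rewrite leeDl// integral_ge0.
have rs : rint mus h.
  apply/integrableP; split => //; apply: le_lt_trans ab.
  by rewrite leeDr// integral_ge0.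
have E : (\int[lambda]_t (h t * w t)%:E = \int[mua]_t (h t)%:E)%E.
  rewrite -(Radon_Nikodym_change_of_variables aca measurableT ra).
  apply: ae_eq_integral => //.
  - by apply/measurable_EFinP; exact: measurable_funM.
  - by apply: emeasurable_funM.
  - by apply: filterS wE => t wt _; rewrite EFinM -wt.
have rl : rint lambda (fun t => h t * w t).
  apply/integrableP; split; first by apply/measurable_EFinP; exact: measurable_funM.
  have raa : mua.-integrable setT (fun t => `|(h t)%:E|%E) by exact: integrable_abse.
  rewrite (_ : (\int[lambda]_t _ = \int[mua]_t `|(h t)%:E|)%E).
    by move/integrableP : ra => [].
  rewrite -(Radon_Nikodym_change_of_variables aca measurableT raa).
  apply: ae_eq_integral => //.
  - by apply: measurableT_comp => //; apply/measurable_EFinP; exact: measurable_funM.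
  - by apply: emeasurable_funM.
  - by apply: filterS wE => t wt _; rewrite /= -wt// normrM (ger0_norm (w0 t)).
split => //; rewrite /Rintegral fE integral_measure_add// -E fineD//.
- by apply: integrable_fin_num.
- by apply: integrable_fin_num.
Qed.

Lemma ac_density_rint : rint lambda w.
Proof.
have [N [mus [_ _ _ H]]] := ac_density_split.
by have [_ + _] := H _ (rint_cst mu 1); under eq_fun do rewrite mul1r.
Qed.

(** Integrating [n2 f] against [w] gives the absolutely continuous part of its integral over [mu],
    and the singular part is nonnegative. The alternative [phi = 0] covers a non-integrable
    logarithm. *)
Lemma ac_density_n2 (f phi : T -> C) : cmeas phi ->
  ({ae lambda, forall t, n2 (phi t) = w t} \/ phi = fun=> 0) -> L2 mu f ->
  L2 lambda (fun t => f t * (phi t)^*) /\ nrm2 lambda (fun t => f t * (phi t)^*) <= nrm2 mu f.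
Proof.
move=> mphi [wphi|-> Lf]; last first.
  have -> : (fun t => f t * (0 : C)^*) = fun=> 0 by apply/funext => t; rewrite conjR mulr0.
  split; first exact: L2_0.
  by rewrite /nrm2; under eq_Rintegral do rewrite n2_0; rewrite Rintegral_lambda_cst nrm2_ge0.
move=> Lf; have [N [mus [_ _ _ H]]] := ac_density_split.
have [_ r1 E] := H _ (L2_n2 Lf).
have mfp : cmeas (fun t => f t * (phi t)^*) by apply: cmeasM; [exact: L2_meas Lf|exact: cmeas_conj].
have ae1 : {ae lambda, forall t, n2 (f t) * w t = n2 (f t * (phi t)^*)}.
  by apply: filterS wphi => t; rewrite n2M n2conj => ->.
split; first by apply/L2P; split => //; apply: ae_rint ae1 r1; exact: cmeas_n2.
rewrite {2}/nrm2 E /nrm2 (ae_Rintegral (u := fun t => n2 (f t) * w t) _ _ ae1); last 2 first.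
- exact: rint_meas r1.
- exact: cmeas_n2.
by rewrite lerDl; apply: Rintegral_ge0 => t _; exact: n2_ge0.
Qed.

(** The geometric mean of [w], read as 0 when its logarithm is not integrable. *)
Definition szego_cst : R := if `[< lambda.-integrable setT (fun s => lne (w s)%:E) >] then
  expR (\int[lambda]_t ln (w t)) else 0.

Definition wclip (n : nat) (t : T) : R := Num.min n.+1%:R (Num.max (n.+1%:R)^-1 (w t)).

Let n1 n : 1 <= n.+1%:R :> R. Proof. by rewrite ler1n. Qed.
Let nV n : 0 < (n.+1%:R : R)^-1 <= 1.
Proof. by rewrite invr_gt0 ltr0n/= invf_le1 ?ltr0n. Qed.

Lemma wclip_itv n t : (n.+1%:R)^-1 <= wclip n t <= n.+1%:R.
Proof.
have /andP[_ h] := nV n; rewrite /wclip le_min le_max ge_min !lexx /= andbT.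
by rewrite andbT; exact: le_trans h (n1 n).
Qed.

Lemma wclip_gt0 n t : 0 < wclip n t.
Proof. by have /andP[h _] := wclip_itv n t; apply: lt_le_trans h; case/andP: (nV n). Qed.

(** Raising small values only lowers the quotient. Above [n + 1] it is dominated by [1 + (w - n)],
    and the integral of the positive part of [w - n] tends to 0 by [posq_lim]. *)
Lemma wclip_quot n t : w t / wclip n t <= 1 + posq n%:R w t.
Proof.
rewrite ler_pdivrMr ?wclip_gt0//; have [_ w0 _] := hw.
have q0 := posq_ge0 n%:R w t; have c0 := wclip_gt0 n t.
have [wN|Nw] := leP (w t) n.+1%:R.
  have : w t <= wclip n t by rewrite /wclip le_min wN le_max lexx orbT.
  nra.
have -> : wclip n t = n.+1%:R.
  by rewrite /wclip min_l// le_max (ltW Nw) orbT.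
have : w t - n%:R <= posq n%:R w t by rewrite le_max lexx.
move: Nw; rewrite -natr1; have := ler0n R n; move: (n%:R) (posq _ _ _) (w t) => x y z.
nra.
Qed.

Let mw : measurable_fun setT w. Proof. by case: hw. Qed.
Let w0 t : 0 <= w t. Proof. by case: hw. Qed.

Lemma wclip_meas n : measurable_fun setT (wclip n).
Proof. by apply: measurable_minr; [exact: measurable_cst|apply: measurable_maxr => //; exact: measurable_cst]. Qed.

Lemma ln_wclip_norm n t : `|ln (wclip n t)| <= ln (n.+1%:R : R).
Proof.
have /andP[h1 h2] := wclip_itv n t; have c0 := wclip_gt0 n t.
have np : (0 : R) < n.+1%:R by rewrite ltr0n.
rewrite ler_norml -lnV ?posrE// !ler_ln ?posrE ?invr_gt0//; exact/andP.
Qed.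

Lemma ln_wclip_rint n : rint lambda (fun t => ln (wclip n t)).
Proof.
apply: rint_bdd (ln_wclip_norm n); apply: measurableT_comp => //; exact: wclip_meas.
Qed.

Lemma ln_wclip_clip n t : 0 < w t -> ln (wclip n t) = clip (ln n.+1%:R) (ln (w t)).
Proof.
move=> wt; have np : (0 : R) < n.+1%:R by rewrite ltr0n.
have nV0 : (0 : R) < n.+1%:R^-1 by rewrite invr_gt0.
have lm (x y : R) : 0 < x -> 0 < y -> ln (Num.max x y) = Num.max (ln x) (ln y).
  move=> x0 y0; case: (leP x y) => h; first by rewrite max_r// ler_ln.
  by rewrite max_l// ler_ln ?posrE// ltW.
have lm' (x y : R) : 0 < x -> 0 < y -> ln (Num.min x y) = Num.min (ln x) (ln y).
  move=> x0 y0; case: (leP x y) => h; first by rewrite min_l// ler_ln.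
  by rewrite min_r// ler_ln ?posrE// ltW.
have h : - ln (n.+1%:R : R) <= ln (n.+1%:R : R).
  by rewrite -lnV ?posrE// ler_ln ?posrE//; have /andP[_ h] := nV n; exact: le_trans h (n1 n).
rewrite /wclip lm' ?lt_max ?wt ?orbT// lm// lnV ?posrE// /clip.
case: (leP (ln (w t)) (ln n.+1%:R)) => h1.
  by rewrite min_r// ge_max h1 h.
rewrite [RHS]max_r// min_l//.
by rewrite le_max (ltW h1) orbT.
Qed.

Lemma ln_wclip_le n t : ln (wclip n t) <= w t.
Proof.
have c0 := wclip_gt0 n t.
have : ln (wclip n t) <= wclip n t - 1.
  by have := @le_ln1Dx R (wclip n t - 1); rewrite [1 + _]addrC subrK => -> //; lra.
have : wclip n t <= 1 + w t.
  rewrite /wclip ge_min; apply/orP; right; rewrite ge_max; have /andP[_ h] := nV n.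
  apply/andP; split.
    by apply: le_trans h _; rewrite lerDl.
  by rewrite lerDr.
lra.
Qed.

Lemma ln_natS_cvg (A : R) : \forall n \near \oo, A <= ln (n.+1%:R : R).
Proof.
exists (Num.trunc (expR A)) => // n /= hn.
rewrite -[A]expRK ler_ln ?posrE ?expR_gt0// (le_trans (ltW (truncnS_gt _)))// ler_nat ltnS //.
Qed.

Lemma szego_cst_cvg : lambda.-integrable setT (fun s => lne (w s)%:E) ->
  expR (\int[lambda]_t ln (wclip n t)) @[n --> \oo] --> expR (\int[lambda]_t ln (w t)).
Proof.
move=> iw; have [phi [_ _ _ rl _]] := varphi_spec mw w0 ac_density_rint iw.
have ae0 : {ae lambda, forall t, 0 < w t}.
  have := integrable_ae measurableT iw; apply: filterS => t /(_ I).
  by rewrite ltNge /lne; case: ifP.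
have H : \int[lambda]_t ln (wclip n t) @[n --> \oo] --> \int[lambda]_t ln (w t).
  have mln := rint_meas rl.
  have mc n : measurable_fun setT (fun t => clip (ln n.+1%:R) (ln (w t))).
    by apply: measurable_maxr; [exact: measurable_cst|apply: measurable_minr => //; exact: measurable_cst].
  have -> : (fun n => \int[lambda]_t ln (wclip n t)) =
      (fun n => \int[lambda]_t clip (ln n.+1%:R) (ln (w t))).
    apply/funext => n; apply: ae_Rintegral => //.
      exact: rint_meas (ln_wclip_rint n).
    by apply: filterS ae0 => t; exact: ln_wclip_clip.
  have [] := @real_dominated R lambda (fun n t => clip (ln n.+1%:R) (ln (w t))) (fun t => ln (w t)) (fun t => `|ln (w t)|) => //.
  - apply: aeW => t; apply: cvg_near_cst; apply: filterS (ln_natS_cvg `|ln (w t)|) => n.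
    exact: clip_id.
  - exact: rint_abs.
  - move=> n t; have l0 : 0 <= ln (n.+1%:R : R) by rewrite ln_ge0.
    have [h|h] := leP `|ln (w t)| (ln n.+1%:R); first by rewrite clip_id.
    by apply: le_trans (clip_norm _ l0) _; exact: ltW.
exact: cvg_comp _ _ H (@continuous_expR R _).
Qed.

(** If the integrals were bounded below, those of the nonnegative functions [w - ln (wclip n)] would
    be bounded above; Fatou's lemma would then make [w - lne w] integrable, and with it [lne w]. *)
Lemma szego_cst0 (K : R) : ~ lambda.-integrable setT (fun s => lne (w s)%:E) ->
  exists n, \int[lambda]_t ln (wclip n t) < K.
Proof.
move=> nint; apply: contrapT => nK; apply: nint.
have KI n : K <= \int[lambda]_t ln (wclip n t) by rewrite leNgt; apply/negP => h; apply: nK; exists n.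
pose k n t := w t - ln (wclip n t).
have k0 n t : 0 <= k n t by rewrite subr_ge0 ln_wclip_le.
have rk n : rint lambda (k n) by apply: rintB; [exact: ac_density_rint|exact: ln_wclip_rint].
have mlne : measurable_fun setT (fun s => lne (w s)%:E).
  rewrite /lne; apply: measurable_fun_ifT.
  - by apply: measurable_fun_ler => //; exact: measurable_cst.
  - exact: measurable_cst.
  - by apply/measurable_EFinP; exact: measurableT_comp.
have lim t : (k n t)%:E @[n --> \oo] --> ((w t)%:E - lne (w t)%:E)%E.
  have [wt|wt] := leP (w t) 0.
    have wt0 : w t = 0 by apply/eqP; rewrite eq_le wt w0.
    rewrite wt0 /lne lexx /=; apply/cvgeyPge => A.
    apply: filterS (ln_natS_cvg A) => n hn; rewrite lee_fin /k wt0 sub0r.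
    rewrite /wclip wt0 max_l ?invr_ge0// min_r; last first.
      by have /andP[_ h] := nV n; exact: le_trans h (n1 n).
    by rewrite lnV ?posrE ?ltr0n// opprK.
  rewrite lne_EFin//; apply: cvg_near_cst; apply: filterS (ln_natS_cvg `|ln (w t)|) => n hn.
  by rewrite /k ln_wclip_clip// clip_id.
pose B := \int[lambda]_t w t - K.
have B1 n : (\int[lambda]_t (k n t)%:E <= B%:E)%E.
  rewrite -(fineK (integrable_fin_num measurableT (rk n))) lee_fin.
  change (\int[lambda]_t k n t <= B).
  by rewrite RintegralB//; [rewrite lerD2l lerN2|exact: ac_density_rint|exact: ln_wclip_rint].
have mk n : measurable_fun setT (fun t => (k n t)%:E) by apply/measurable_EFinP; exact: rint_meas (rk n).
have F := @lebesgue_integral_monotone_convergence.fatou _ T R lambda setT measurableT (fun n t => (k n t)%:E) mk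
  (fun n t _ => k0 n t).
have E t : limn_einf (fun n => (k n t)%:E) = ((w t)%:E - lne (w t)%:E)%E.
  by have [-> _] := cvg_limn_einf_sup (lim t).
have F2 : (\int[lambda]_t ((w t)%:E - lne (w t)%:E) <= B%:E)%E.
  under eq_integral do rewrite -E.
  apply: le_trans F _; rewrite limn_einf_lim; apply: lime_le; first exact: is_cvg_einfs.
  apply: nearW => n; apply: le_trans (B1 n); rewrite /einfs; apply: ereal_inf_lbound.
  by exists n => //=.
have d0 t : (0 <= (w t)%:E - lne (w t)%:E)%E.
  by rewrite -E limn_einf_lim; apply: lime_ge; [exact: is_cvg_einfs|
    apply: nearW => n; apply: le_ereal_inf_tmp => _ [m _ <-]; rewrite lee_fin].
have md : measurable_fun setT (fun t => (w t)%:E - lne (w t)%:E)%E.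
  by apply: emeasurable_funB => //; exact/measurable_EFinP.
have mwe : measurable_fun setT (fun t => (w t)%:E) by exact/measurable_EFinP.
apply/integrableP; split => //.
apply: (@le_lt_trans _ _ (\int[lambda]_t (((w t)%:E - lne (w t)%:E) + (w t)%:E))%E).
  apply: ge0_le_integral => //.
  - exact: measurableT_comp.
  - exact: emeasurable_funD.
  - move=> t _; have [wt|wt] := leP (w t) 0; first by rewrite /lne wt.
    rewrite lne_EFin// lee_fin; have := ln_sublinear wt => h.
    by rewrite ler_norml; apply/andP; split; lra.
rewrite ge0_integralD//; last by move=> t _; rewrite lee_fin.
apply: lte_add_pinfty; first by apply: le_lt_trans F2 _; rewrite ltry.
by have /integrable_fin_num := ac_density_rint; move=> /(_ measurableT); rewrite ltey_eq => ->.
Qed.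

Lemma szego e : 0 < e -> exists p : {poly C}, p.[0] = 1 /\
  nrm2 mu (fun t => p.[e_ 1 t]) <= szego_cst + e.
Proof.
move=> e0; have [N [mus [mN N0 sN H]]] := ac_density_split.
pose S := \int[mus]_t (1 : R).
have S0 : 0 <= S by apply: Rintegral_ge0.
(* Off [N], [expR (f n)] is the inverse of the truncated density, so its integral against [w] is
   close to 1. On [N], which [lambda] does not see and which carries the singular part, it is
   [expR (- n.+1%:R)], so that part contributes almost nothing. *)
pose f n t := - (ln (wclip n t) * \1_(~` N) t + n.+1%:R * \1_N t).
have mf n : measurable_fun setT (f n).
  apply: measurableT_comp => //; apply: measurable_funD.
    apply: measurable_funM; last exact/measurable_indic/measurableC.
    exact: rint_meas (ln_wclip_rint n).
  by apply: measurable_funM; [exact: measurable_cst|exact: measurable_indic].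
have fN n t : N t -> f n t = - n.+1%:R.
  by move=> Nt; rewrite /f !indicE in_setC mem_set//= mulr0 add0r mulr1.
have fNC n t : ~ N t -> f n t = - ln (wclip n t).
  by move=> Nt; rewrite /f !indicE in_setC memNset//= mulr0 addr0 mulr1.
have fb n t : `|f n t| <= n.+1%:R.
  have [Nt|Nt] := pselect (N t); first by rewrite fN// normrN ger0_norm.
  rewrite fNC// normrN; apply: le_trans (ln_wclip_norm _ _) _.
  by apply: ltW; apply: ln_sublinear; rewrite ltr0n.
have aeN : {ae lambda, forall t, ~ N t}.
  by exists N; split => // t; rewrite /= => /contrapT.
have aes : {ae mus, forall t, N t}.
  by exists (~` N); split => //; exact: measurableC.
have I1 n : \int[lambda]_t f n t = - \int[lambda]_t ln (wclip n t).
  have -> : - (\int[lambda]_t ln (wclip n t)) = \int[lambda]_t (- ln (wclip n t)).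
    by rewrite -mulN1r -RintegralZl//; [apply: eq_Rintegral => t _; rewrite mulN1r|exact: ln_wclip_rint].
  apply: ae_Rintegral => //; first exact: rint_meas (rintN (ln_wclip_rint n)).
  by apply: filterS aeN => t; exact: fNC.
pose B n := 1 + \int[lambda]_t posq n%:R w t + expR (- n.+1%:R) * S.
have rexp n : rint mu (fun t => expR (f n t)).
  apply: (@rint_bdd _ _ _ (expR n.+1%:R)) => [|t]; first exact: measurableT_comp.
  by rewrite ger0_norm ?expR_ge0// ler_expR (le_trans (ler_norm _)).
have I2 n : \int[mu]_t expR (f n t) <= B n.
  have [r1 r2 ->] := H _ (rexp n); apply: lerD.
    have q1 : rint lambda (fun t => 1 + posq n%:R w t).
      by apply: rintD; [exact: rint_cst|exact: posq_rint ac_density_rint].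
    apply: (@le_trans _ _ (\int[lambda]_t (w t / wclip n t))).
      rewrite le_eqVlt; apply/orP; left; apply/eqP; apply: ae_Rintegral.
      - exact: rint_meas r2.
      - have -> : (fun t => w t / wclip n t) = fun t => w t * expR (- ln (wclip n t)).
          by apply/funext => t; rewrite expRN lnK// posrE wclip_gt0.
        apply: measurable_funM => //; apply: measurableT_comp => //.
        exact: rint_meas (rintN (ln_wclip_rint n)).
      - by apply: filterS aeN => t Nt; rewrite fNC// expRN lnK ?posrE ?wclip_gt0// mulrC.
    have -> : 1 + \int[lambda]_t posq n%:R w t = \int[lambda]_t (1 + posq n%:R w t).
      by rewrite RintegralD//; [rewrite Rintegral_lambda_cst|exact: rint_cst|exact: posq_rint ac_density_rint].
    apply: le_Rint => // [|t]; last exact: wclip_quot.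
    apply: (rint_le _ _ q1) => [|t].
      have -> : (fun t => w t / wclip n t) = fun t => w t * expR (- ln (wclip n t)).
        by apply/funext => t; rewrite expRN lnK// posrE wclip_gt0.
      apply: measurable_funM => //; apply: measurableT_comp => //.
      exact: rint_meas (rintN (ln_wclip_rint n)).
    by rewrite ger0_norm ?wclip_quot// divr_ge0// ltW// wclip_gt0.
  rewrite (@ae_Rintegral _ _ _ _ _ (fun=> expR (- n.+1%:R) * 1)).
  - by rewrite RintegralZl//; exact: rint_cst.
  - exact: rint_meas r1.
  - exact: measurable_cst.
  - by apply: filterS aes => t Nt; rewrite fN// mulr1.
have B0 n : 0 <= B n.
  by rewrite !addr_ge0 ?mulr_ge0 ?expR_ge0//; apply: Rintegral_ge0 => t _; exact: posq_ge0.
suff [n hn] : exists n, expR (\int[lambda]_t ln (wclip n t)) * B n <= szego_cst + e / 2.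
  have e2 : 0 < e / 2 by rewrite divr_gt0.
  have [p [p1 pn]] := szego_bdd mu (mf n) (fb n) e2; exists p; split => //.
  apply: le_trans pn _; rewrite I1 opprK.
  have := ler_wpM2l (expR_ge0 (\int[lambda]_t ln (wclip n t))) (I2 n); move: hn.
  by move: (_ * B n) (_ * \int[mu]_t _) szego_cst => a b c; lra.
rewrite /szego_cst; case: asboolP => [iw|niw].
  have c1 := szego_cst_cvg iw.
  have c2 : B n @[n --> \oo] --> 1 + 0 + 0 * S.
    apply: cvgD; first by apply: cvgD; [exact: cvg_cst|exact: posq_lim ac_density_rint].
    apply: cvgMl; apply/(cvgrPdist_le) => d d0.
    near=> n; rewrite sub0r normrN ger0_norm ?expR_ge0//.
    have : `|ln d| <= ln n.+1%:R by near: n; exact: ln_natS_cvg.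
    rewrite ler_norml => /andP[h _]; rewrite -[d]lnK ?posrE// ler_expR.
    have := @ln_sublinear R n.+1%:R; rewrite ltr0n => /(_ isT); lra.
  rewrite mul0r !addr0 in c2.
  have c3 : expR (\int[lambda]_t ln (wclip n t)) * B n @[n --> \oo] --> expR (\int[lambda]_t ln (w t)).
    by have := cvgM c1 c2; rewrite mulr1; exact.
  have [n hn] : exists n, expR (\int[lambda]_t ln (wclip n t)) * B n < expR (\int[lambda]_t ln (w t)) + e / 2.
    by apply: (@filter_ex _ \oo); apply: (cvgr_lt _ c3); rewrite ltrDl divr_gt0.
  by exists n; exact: ltW.
(* Here the target is 0: [B n] stays below [K], and the exponential factor can be made as small as
   desired. *)
pose K := 1 + \int[lambda]_t w t + S.
have Iw0 : 0 <= \int[lambda]_t w t by apply: Rintegral_ge0.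
have K0 : 0 < K by rewrite /K -addrA; apply: ltr_wpDr => //; rewrite addr_ge0.
have BK n : B n <= K.
  rewrite /B /K; apply: lerD; [apply: lerD => //|].
    apply: le_Rint; [exact: posq_rint ac_density_rint|exact: ac_density_rint|] => t.
    by rewrite /posq ge_max w0 andbT gerBl.
  by rewrite ler_piMl// -expR0 ler_expR oppr_le0.
have [n hn] := szego_cst0 (ln (e / 2 / K)) niw; exists n; rewrite add0r.
apply: (@le_trans _ _ (e / 2 / K * K)); last by rewrite divfK// gt_eqF.
apply: ler_pM; rewrite ?expR_ge0//.
rewrite -[leRHS]lnK ?posrE ?divr_gt0// ler_expR; exact: ltW.
Unshelve. all: by end_near.
Qed.
End lebesgue_decomposition.

(** * Density of trigonometric polynomials *)

Section trigonometric_density.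
Context (R : realType).
Local Notation T := (circle R).
Local Notation lambda := (@circle_lebesgue R).
Local Notation C := R[i].
Implicit Types p q : {poly C}.

Definition trig p q (t : T) : C := p.[e_ 1 t] + (q.[e_ 1 t])^*.

Section trig_dense.
Variable nu : {finite_measure set T -> \bar R}.

Definition trigdense (f : T -> C) := L2 nu f /\
  forall e, 0 < e -> exists p q, nrm2 nu (fun t => f t - trig p q t) <= e.

Lemma trig_L2 p q : L2 nu (trig p q).
Proof. by apply: L2D; [|apply: L2_conj]; exact: poly_e_L2. Qed.

Lemma trigdense_lim f : L2 nu f ->
  (forall e, 0 < e -> exists2 g, trigdense g & nrm2 nu (fun t => f t - g t) <= e) -> trigdense f.
Proof.
move=> Lf H; split => // e e0; have e4 : 0 < e / 4 by rewrite divr_gt0.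
have [g [Lg /(_ _ e4)[p [q pq]]] fg] := H _ e4; exists p, q.
have -> : (fun t => f t - trig p q t) = fun t => (f t - g t) + (g t - trig p q t).
  by apply/funext => t; rewrite addrA subrK.
apply: le_trans (nrm2D_le _ _) _; [exact: L2B|by apply: L2B => //; exact: trig_L2|].
by lra.
Qed.

Lemma trigdenseD f g : trigdense f -> trigdense g -> trigdense (fun t => f t + g t).
Proof.
move=> [Lf Hf] [Lg Hg]; split; first exact: L2D.
move=> e e0; have e4 : 0 < e / 4 by rewrite divr_gt0.
have [p [q pq]] := Hf _ e4; have [p' [q' pq']] := Hg _ e4; exists (p + p'), (q + q').
have -> : (fun t => f t + g t - trig (p + p') (q + q') t) =
    fun t => (f t - trig p q t) + (g t - trig p' q' t).
  by apply/funext => t; rewrite /trig !hornerD conjD; ring.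
apply: le_trans (nrm2D_le _ _) _; [by apply: L2B => //; exact: trig_L2..|].
by lra.
Qed.

Lemma trigdenseZ c f : trigdense f -> trigdense (fun t => c * f t).
Proof.
move=> [Lf Hf]; split; first exact: L2Z.
move=> e e0; have c0 : 0 < n2 c + 1 by have := n2_ge0 c; lra.
have [p [q pq]] := Hf _ (divr_gt0 e0 c0); exists (c *: p), (c^* *: q).
have -> : (fun t => c * f t - trig (c *: p) (c^* *: q) t) = fun t => c * (f t - trig p q t).
  by apply/funext => t; rewrite /trig !hornerZ conjM conjK; ring.
rewrite nrm2Z; last by apply: L2B => //; exact: trig_L2.
apply: le_trans (_ : (n2 c + 1) * (e / (n2 c + 1)) <= _); last by rewrite mulrC divfK// gt_eqF.
by apply: ler_pM => //; rewrite ?n2_ge0 ?nrm2_ge0// lerDl.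
Qed.

Lemma nrm2_bdd f (M : R) : cmeas f -> (forall t, n2 (f t) <= M) -> nrm2 nu f <= M * \int[nu]_t 1.
Proof.
move=> mf fM; rewrite -RintegralZl//; last exact: rint_cst.
apply: le_Rint => [||t]; last by rewrite mulr1.
- exact: L2_n2 (L2_bdd nu mf fM).
- by apply: rintZ; exact: rint_cst.
Qed.

Lemma L2_real_bdd (u : T -> R) (M : R) : measurable_fun setT u -> (forall t, `|u t| <= M) ->
  L2 nu (fun t => (u t)%:C).
Proof.
move=> mu_ uM; apply: (@L2_bdd _ _ _ (M ^+ 2)); first exact: cmeas_real.
move=> t; have M0 : 0 <= M by exact: le_trans (normr_ge0 _) (uM t).
by rewrite n2C -[X in X <= _]real_normK ?num_real// lerXn2r ?nnegrE.
Qed.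

(** On the circle of radius [r] the real part of a polynomial close to the Herglotz transform of [g]
    is uniformly close to the Poisson integral, hence to [g]. Taking half of the dilated polynomial
    in both slots of [trig] produces this real part. *)
Lemma trigdense_lip g : lip g -> trigdense (fun t => (g t)%:C).
Proof.
move=> lg; have Lg : L2 nu (fun t => (g t)%:C).
  by have [M M0 gM] := lip_bdd lg; apply: L2_real_bdd gM; exact: lip_meas.
split => // e e0.
pose V := \int[nu]_t (1 : R) + 1.
have V0 : 0 < V by rewrite ltr_wpDl//; apply: Rintegral_ge0.
pose d := Num.sqrt (e / V) / 2; have d0 : 0 < d by rewrite divr_gt0// sqrtr_gt0 divr_gt0.
have d2 : (2 * d) ^+ 2 = e / V.
  by rewrite /d mulrC divfK// sqr_sqrtr// ltW// divr_gt0.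
have [r [r0 r1 gr]] := poisson_lip lg d0.
have cg : cint lambda (fun s => (g s)%:C) by apply: cint_real; exact: lip_rint.
have [p pd] := adisc_rad (adisc_herglotz cg) r0 r1 d0.
pose p' : {poly C} := p \Po (r%:C *: 'X).
have p'E t : p'.[e_ 1 t] = p.[rad r t] by rewrite horner_comp hornerZ hornerX.
have Rp z : (2^-1 : C) * z + ((2^-1 : C) * z)^* = (Re z)%:C :> C.
  have -> : (2^-1 : C) = (2^-1 : R)%:C by rewrite -[RHS]/(real_complex R 2^-1) fmorphV rmorph_nat.
  by apply: complexP; rewrite !partsE; field.
exists (2^-1 *: p'), (2^-1 *: p').
have E t : (g t)%:C - trig (2^-1 *: p') (2^-1 *: p') t = (g t - Re p.[rad r t])%:C.
  by rewrite /trig !hornerZ p'E Rp; apply: complexP; rewrite !partsE; ring.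
under eq_fun do rewrite E.
apply: le_trans (@nrm2_bdd _ (e / V) _ _) _.
- apply: cmeas_real; apply: measurable_funB; first exact: lip_meas.
  by have [] := poly_rad_cmeas p r.
- move=> t; rewrite n2C -d2.
  have h1 := gr t; have h2 := pd r t r0 (lexx _).
  have h3 := le_trans (Re_normc _) h2; rewrite ReD ReN Re_herglotz ?normc_rad// in h3.
  suff : `|g t - Re p.[rad r t]| <= 2 * d.
    by move=> h; rewrite -[X in X <= _]real_normK ?num_real// lerXn2r ?nnegrE// mulr_ge0// ltW.
  move: h1 h3; rewrite !ler_norml => /andP[a1 a2] /andP[a3 a4]; apply/andP; split; lra.
- rewrite -[leRHS](divfK (lt0r_neq0 V0)) ler_wpM2l//; first by rewrite ltW// divr_gt0.
  by rewrite lerDl.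
Qed.

(** Both [u] and the clipped Lipschitz function are bounded by [M], so the square of their
    difference is at most a constant times its modulus, and approximation in L1 gives approximation
    in L2. *)
Lemma trigdense_bdd (u : T -> R) (M : R) : measurable_fun setT u -> (forall t, `|u t| <= M) ->
  trigdense (fun t => (u t)%:C).
Proof.
move=> mu_ uM; have M0 : 0 <= M by exact: le_trans (normr_ge0 _) (uM point).
have ru : rint nu u by exact: rint_bdd uM.
have Lu := L2_real_bdd mu_ uM.
apply: trigdense_lim => // e e0; have K0 : 0 < 2 * M + 1 by lra.
have [_ /(_ _ (divr_gt0 e0 K0))[g lg ug]] := rint_lipdense ru.
exists (fun t => (clip M (g t))%:C); first exact/trigdense_lip/lip_clip.
have lc := lip_clip M lg.
apply: (@le_trans _ _ (\int[nu]_t ((2 * M + 1) * `|u t - g t|))); last first.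
  rewrite RintegralZl//; last by apply/rint_abs/rintB => //; exact: lip_rint.
  by rewrite mulrC -ler_pdivlMr.
apply: le_Rint.
- apply: L2_n2; apply: L2B => //; apply: (@L2_real_bdd _ M) => [|t]; first exact: lip_meas.
  exact: clip_norm.
- by apply: rintZ; apply/rint_abs/rintB => //; exact: lip_rint.
- move=> t; have -> : (u t)%:C - (clip M (g t))%:C = (u t - clip M (g t))%:C.
    by apply: complexP; rewrite !partsE; ring.
  rewrite n2C -[X in X <= _]real_normK ?num_real// expr2.
  have h1 : `|u t - clip M (g t)| <= `|u t - g t|.
    by rewrite -{1}[u t](clip_id (uM t)); exact: clip_lip.
  have h2 : `|u t - clip M (g t)| <= 2 * M.
    have := ler_normB (u t) (clip M (g t)); have := uM t; have := clip_norm (g t) M0; lra.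
  by apply: ler_pM => //; lra.
Qed.

Lemma trigdense_real (u : T -> R) : L2 nu (fun t => (u t)%:C) -> trigdense (fun t => (u t)%:C).
Proof.
move=> Lu; apply: trigdense_lim => // e e0.
have mu_ : measurable_fun setT u by have [] := L2_meas Lu.
have ru2 : rint nu (fun t => u t ^+ 2) by have := L2_n2 Lu; under eq_fun do rewrite n2C.
have mc (n : nat) : measurable_fun setT (fun t => clip n%:R (u t)).
  by apply: measurable_maxr; [exact: measurable_cst|apply: measurable_minr => //; exact: measurable_cst].
have [] := @real_dominated R nu (fun n t => (u t - clip n%:R (u t)) ^+ 2) (fun=> 0) (fun t => u t ^+ 2).
- by move=> n; apply: measurable_funX; exact: measurable_funB.
- exact: measurable_cst.
- apply: aeW => t; apply: cvg_near_cst; exists (Num.trunc `|u t|).+1 => // n /= hn.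
  rewrite clip_id ?subrr ?expr0n// (le_trans (ltW (truncnS_gt _)))// ler_nat //.
- exact: ru2.
- move=> n t; rewrite ger0_norm ?sqr_ge0// -[X in X <= _]real_normK ?num_real// -[X in _ <= X]real_normK ?num_real//.
  by rewrite lerXn2r ?nnegrE// clip_sub.
move=> _; rewrite {2}/Rintegral integral0 /= => lim.
have [n hn] : exists n, \int[nu]_t (u t - clip n%:R (u t)) ^+ 2 < e.
  by apply: (@filter_ex _ \oo); exact: (cvgr_lt _ lim).
exists (fun t => (clip n%:R (u t))%:C).
  by apply: (@trigdense_bdd _ n%:R) => // t; exact: clip_norm.
rewrite /nrm2; under eq_Rintegral => t _.
  have -> : (u t)%:C - (clip n%:R (u t))%:C = (u t - clip n%:R (u t))%:C.
    by apply: complexP; rewrite !partsE; ring.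
  rewrite n2C; over.
exact: ltW.
Qed.

Lemma trig_dense f : L2 nu f -> trigdense f.
Proof.
move=> Lf; have [mr mi] := L2_meas Lf.
have -> : f = fun t => (Re (f t))%:C + (0 +i* 1)%C * (Im (f t))%:C.
  by apply/funext => t; apply: complexP; rewrite !partsE; ring.
apply: trigdenseD; last apply: trigdenseZ.
- apply: trigdense_real; apply: (L2_le _ _ (L2_n2 Lf)); first exact: cmeas_real.
  by move=> t; rewrite n2C Re_n2.
- apply: trigdense_real; apply: (L2_le _ _ (L2_n2 Lf)); first exact: cmeas_real.
  by move=> t; rewrite n2C Im_n2.
Qed.
End trig_dense.
End trigonometric_density.

(** * Distance to the span of the negative characters *)

Section bessel.
Context (R : realType).
Local Notation T := (circle R).
Local Notation lambda := (@circle_lebesgue R).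
Local Notation C := R[i].
Implicit Types (p q : {poly C}) (f g : T -> C).

Lemma ip_e k l : ip lambda (@e_ R k) (@e_ R l) = (k == l)%:R.
Proof. exact: fourier_e. Qed.

Lemma bessel_eq f m : L2 lambda f ->
  nrm2 lambda (fun t => f t - \sum_(l < m) ip lambda f (@e_ R (Posz l)) * e_ (Posz l) t) =
  nrm2 lambda f - \sum_(l < m) n2 (ip lambda f (@e_ R (Posz l))).
Proof.
move=> Lf; pose c l := ip lambda f (@e_ R (Posz l)).
pose s t := \sum_(l < m) c l * e_ (Posz l) t.
have Ls : L2 lambda s by apply: L2_sum => l; apply: L2Z; exact: L2_e.
have E : nrm2 lambda s = \sum_(l < m) n2 (c l) by exact: nrm2_e_sum.
have fs : ip lambda f s = (\sum_(l < m) n2 (c l))%:C.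
  rewrite ip_sumr//; last by move=> l; exact: L2_e.
  transitivity (\sum_(l < m) (n2 (c l))%:C); last by apply: complexP; rewrite ?Re_sum ?Im_sum// big1.
  by apply: eq_bigr => l _; rewrite mulrC mul_conj.
have -> : (fun t => f t - \sum_(l < m) ip lambda f (@e_ R (Posz l)) * e_ (Posz l) t) =
  fun t => f t + (-1) * s t by apply/funext => t; rewrite mulN1r.
rewrite nrm2D//; last exact: L2Z.
rewrite nrm2Z// ipZr// fs E n2N n2_1 mul1r -/(c _).
have -> : ((-1 : C)^* * (\sum_(l < m) n2 (c l))%:C) = (- \sum_(l < m) n2 (c l))%:C.
  by apply: complexP; rewrite !partsE /=; ring.
rewrite ReC; ring.
Qed.

Lemma bessel f m : L2 lambda f ->
  \sum_(l < m) n2 (ip lambda f (@e_ R (Posz l))) <= nrm2 lambda f.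
Proof. by move=> Lf; rewrite -subr_ge0 -bessel_eq// nrm2_ge0. Qed.

Lemma poly_eS p c t : (p * 'X + c%:P).[e_ 1 t] = p.[e_ 1 t] * e_ 1 t + c.
Proof. by rewrite hornerMXaddC. Qed.

Lemma analytic_poly phi (s : C) p k : L2 lambda phi ->
  (forall k, cintegral lambda (fun t => phi t * e_ (Posz k) t) = if k == 0%N then s else 0) ->
  cintegral lambda (fun t => phi t * p.[e_ 1 t] * e_ (Posz k) t) = if k == 0%N then s * p.[0] else 0.
Proof.
move=> Lphi Hphi; have Lc q k' : cint lambda (fun t => phi t * q.[e_ 1 t] * e_ (Posz k') t).
  have Lqe : L2 lambda (fun t => (e_ (Posz k') t * q.[e_ 1 t])^*).
    by apply: L2_conj; apply: (@L2M_bdd _ _ _ _ _ _ 1); [exact: poly_e_L2|exact: cmeas_e|move=> t; rewrite n2_e].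
  have := L2_cint Lphi Lqe; set A := (X in cint _ X); set B := (X in _ -> cint _ X).
  by have -> : A = B; last by []; apply/funext => t; rewrite /A /B conjK; ring.
elim/poly_ind: p k => [|p c IH] k.
  rewrite horner0 mulr0 if_same; under eq_cintegral do rewrite horner0 mulr0 mul0r.
  exact: cintegral0.
have -> : cintegral lambda (fun t => phi t * (p * 'X + c%:P).[e_ 1 t] * e_ (Posz k) t) =
   cintegral lambda (fun t => phi t * p.[e_ 1 t] * e_ (Posz k.+1) t + c * (phi t * e_ (Posz k) t)).
  by apply: eq_cintegral => t; rewrite poly_eS (e_nat k.+1) (e_nat k) exprS; ring.
have Lp : cint lambda (fun t => phi t * e_ (Posz k) t).
  have := Lc 1 k; under eq_fun do rewrite hornerC mulr1; exact.
rewrite cintegralD//; last exact: cintZ.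
rewrite IH /= cintegralZ// Hphi add0r hornerMXaddC mulr0 add0r.
by case: ifP; rewrite ?mulr0// mulrC.
Qed.

Lemma cintegral_conj_eq f g : cint lambda g -> (forall t, f t = (g t)^*) ->
  cintegral lambda f = (cintegral lambda g)^*.
Proof. by move=> ig fg; rewrite -cintegral_conj//; exact: eq_cintegral. Qed.
End bessel.

(** * Best approximation from the negative characters *)

Section prediction.
Context (R : realType).
Local Notation T := (circle R).
Local Notation lambda := (@circle_lebesgue R).
Local Notation C := R[i].
Implicit Types (p q : {poly C}) (f g h : T -> C).
Variables (mu : {finite_measure set T -> \bar R}) (phi : T -> C) (sigma : R).
Hypothesis mphi : cmeas phi.
Hypothesis Lphi : L2 lambda phi.
Hypothesis phi_coef : forall k, cintegral lambda (fun t => phi t * e_ (Posz k) t) = if k == 0%N then sigma%:C else 0.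
Hypothesis phi_L2 : forall f, L2 mu f ->
  L2 lambda (fun t => f t * (phi t)^*) /\ nrm2 lambda (fun t => f t * (phi t)^*) <= nrm2 mu f.
Hypothesis szego_sigma : forall e, 0 < e -> exists p, p.[0] = 1 /\
  nrm2 mu (fun t => p.[e_ 1 t]) <= sigma ^+ 2 + e.

(* The linear span of [e_ (-1), e_ (-2), ...]. *)
Definition neg h := exists p, p.[0] = 0 /\ h = fun t => (p.[e_ 1 t])^*.

Lemma neg_L2 (nu : {finite_measure set T -> \bar R}) h : neg h -> L2 nu h.
Proof. by move=> [p [_ ->]]; apply: L2_conj; exact: poly_e_L2. Qed.

Lemma neg0 : neg (fun=> 0).
Proof. by exists 0; split; [rewrite horner0|apply/funext => t; rewrite horner0 conjR]. Qed.

Lemma negD h h' : neg h -> neg h' -> neg (fun t => h t + h' t).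
Proof.
move=> [p [p0 ->]] [q [q0 ->]]; exists (p + q); split; first by rewrite hornerD p0 q0 addr0.
by apply/funext => t; rewrite hornerD conjD.
Qed.

Lemma negZ c h : neg h -> neg (fun t => c * h t).
Proof.
move=> [p [p0 ->]]; exists (c^* *: p); split; first by rewrite hornerZ p0 mulr0.
by apply/funext => t; rewrite hornerZ conjM conjK.
Qed.

Definition tw f t := f t * (phi t)^*.
Definition coef l f := ip lambda (tw f) (@e_ R (Posz l)).

Lemma twD f g : tw (fun t => f t + g t) = fun t => tw f t + tw g t.
Proof. by apply/funext => t; rewrite /tw mulrDl. Qed.
Lemma twZ c f : tw (fun t => c * f t) = fun t => c * tw f t.
Proof. by apply/funext => t; rewrite /tw mulrA. Qed.
Lemma tw_L2 f : L2 mu f -> L2 lambda (tw f). Proof. by case/phi_L2. Qed.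

Lemma coefD l f g : L2 mu f -> L2 mu g -> coef l (fun t => f t + g t) = coef l f + coef l g.
Proof. by move=> Lf Lg; rewrite /coef twD ipDl//; [exact: tw_L2..|exact: L2_e]. Qed.
Lemma coefZ l c f : L2 mu f -> coef l (fun t => c * f t) = c * coef l f.
Proof. by move=> Lf; rewrite /coef twZ ipZl//; [exact: tw_L2|exact: L2_e]. Qed.

Lemma phi_poly_cint p l : cint lambda (fun t => phi t * p.[e_ 1 t] * e_ (Posz l) t).
Proof.
have Lqe : L2 lambda (fun t => (e_ (Posz l) t * p.[e_ 1 t])^*).
  by apply: L2_conj; apply: (@L2M_bdd _ _ _ _ _ _ 1); [exact: poly_e_L2|exact: cmeas_e|move=> t; rewrite n2_e].
have := L2_cint Lphi Lqe; set A := (X in cint _ X); set B := (X in _ -> cint _ X).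
by have -> : A = B; last by []; apply/funext => t; rewrite /A /B conjK; ring.
Qed.

Lemma coef_neg l h : neg h -> coef l h = 0.
Proof.
move=> [p [p0 ->]]; rewrite /coef /ip (cintegral_conj_eq (phi_poly_cint p l)).
  by rewrite (analytic_poly p l Lphi phi_coef) p0 mulr0 if_same conjR.
by move=> t; rewrite /tw !conjM; ring.
Qed.

(** The characters cancel and leave the conjugate of the mean of [phi * q]; for analytic factors
    this mean is the product of the values at 0. *)
Lemma coef_shift k q : coef k (fun t => e_ (Posz k) t * (q.[e_ 1 t])^*) = sigma%:C * (q.[0])^*.
Proof.
rewrite /coef /ip (cintegral_conj_eq (phi_poly_cint q 0)).
  by rewrite (analytic_poly q 0 Lphi phi_coef) eqxx conjM conjR.
move=> t; rewrite /tw e_0 mulr1 conjM.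
rewrite -[RHS]mul1r -(e_conj t (Posz k)); ring.
Qed.

(* Decreases in [m] to [||f||^2 - ||P_(H^2) (f * conj phi)||^2]. *)
Definition defect m f := nrm2 mu f - \sum_(l < m) n2 (coef l f).

Lemma defect_ge0 m f : L2 mu f -> 0 <= defect m f.
Proof. by move=> Lf; have [L1 L2f] := phi_L2 Lf; rewrite subr_ge0 (le_trans (bessel m L1)). Qed.

Lemma defect_le m f : defect m f <= nrm2 mu f.
Proof. by rewrite gerBl sumr_ge0// => l _; exact: n2_ge0. Qed.

Lemma defect_mono m m' f : (m <= m')%N -> defect m' f <= defect m f.
Proof.
move=> mm; rewrite lerD2l lerN2 -(subnKC mm) big_split_ord /= lerDl sumr_ge0// => l _.
exact: n2_ge0.
Qed.

Lemma defectZ m c f : L2 mu f -> defect m (fun t => c * f t) = n2 c * defect m f.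
Proof.
move=> Lf; rewrite /defect nrm2Z// mulrBr mulr_sumr; congr (_ - _).
by apply: eq_bigr => l _; rewrite coefZ// n2M.
Qed.

(** The parallelogram law: [defect m] is a quadratic form, and by Bessel's inequality the term
    discarded is nonnegative. *)
Lemma defectD_le m f g : L2 mu f -> L2 mu g ->
  defect m (fun t => f t + g t) <= 2 * defect m f + 2 * defect m g.
Proof.
move=> Lf Lg; have Lg' : L2 mu (fun t => (-1) * g t) by exact: L2Z.
have h : defect m (fun t => f t + g t) + defect m (fun t => f t + (-1) * g t) =
   2 * defect m f + 2 * defect m g.
  rewrite /defect !nrm2D// nrm2Z// ipZr// n2N n2_1 mul1r.
  have -> : Re ((-1 : C)^* * ip mu f g) = - Re (ip mu f g) by rewrite !partsE /=; ring.
  have -> : \sum_(l < m) n2 (coef l (fun t => f t + g t)) =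
     2 * \sum_(l < m) n2 (coef l f) + 2 * \sum_(l < m) n2 (coef l g) -
     \sum_(l < m) n2 (coef l (fun t => f t + (-1) * g t)); last by ring.
  rewrite !mulr_sumr -big_split/= -sumrB; apply: eq_bigr => l _.
  by rewrite !coefD// coefZ// /n2 !partsE /=; ring.
rewrite -h lerDl; apply: defect_ge0; exact: L2D.
Qed.

(** By [coef_neg], subtracting [h] leaves the coefficients of [f] unchanged; the condition says that
    the squared distance from [f] to the span is at most the supremum of the Bessel sums of
    [tw f]. *)
Definition regular f := L2 mu f /\ forall e, 0 < e ->
  exists m h, neg h /\ defect m (fun t => f t - h t) <= e.

Lemma regular_neg h : neg h -> regular h.
Proof.
move=> nh; split; first exact: neg_L2.
move=> e e0; exists 0%N, h; split => //; under eq_fun do rewrite subrr.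
apply: le_trans (defect_le _ _) _; rewrite /nrm2; under eq_Rintegral do rewrite n2_0.
by rewrite /Rintegral integral0 /= ltW.
Qed.

Lemma regularD f g : regular f -> regular g -> regular (fun t => f t + g t).
Proof.
move=> [Lf Hf] [Lg Hg]; split; first exact: L2D.
move=> e e0; have e4 : 0 < e / 4 by rewrite divr_gt0.
have [m [h [nh fh]]] := Hf _ e4; have [m' [h' [nh' gh]]] := Hg _ e4.
exists (maxn m m'), (fun t => h t + h' t); split; first exact: negD.
have -> : (fun t => f t + g t - (h t + h' t)) = fun t => (f t - h t) + (g t - h' t).
  by apply/funext => t; ring.
apply: le_trans (defectD_le _ _ _) _; [by apply: L2B => //; exact: neg_L2..|].
have := defect_mono (fun t => f t - h t) (leq_maxl m m').
have := defect_mono (fun t => g t - h' t) (leq_maxr m m'); lra.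
Qed.

Lemma regularZ c f : regular f -> regular (fun t => c * f t).
Proof.
move=> [Lf Hf]; split; first exact: L2Z.
move=> e e0; have c0 : 0 < n2 c + 1 by have := n2_ge0 c; lra.
have [m [h [nh fh]]] := Hf _ (divr_gt0 e0 c0); exists m, (fun t => c * h t).
split; first exact: negZ.
have Lfh : L2 mu (fun t => f t - h t) by apply: L2B => //; exact: neg_L2.
have -> : (fun t => c * f t - c * h t) = fun t => c * (f t - h t).
  by apply/funext => t; rewrite mulrBr.
rewrite defectZ//.
apply: le_trans (_ : (n2 c + 1) * (e / (n2 c + 1)) <= _); last by rewrite mulrC divfK// gt_eqF.
by apply: ler_pM => //; rewrite ?n2_ge0 ?defect_ge0// lerDl.
Qed.

(** Closeness is measured by [defect] and not by the norm: in [regular_e] the error [e_ k * conj q]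
    need not be small in L2(mu), only its defect is. *)
Lemma regular_lim f : L2 mu f ->
  (forall e, 0 < e -> exists2 g, regular g & exists m, defect m (fun t => f t - g t) <= e) -> regular f.
Proof.
move=> Lf H; split => // e e0; have e4 : 0 < e / 4 by rewrite divr_gt0.
have [g [Lg /(_ _ e4)[m [h [nh gh]]]] [m' fg]] := H _ e4; exists (maxn m m'), h; split => //.
have Lh := neg_L2 mu nh.
have -> : (fun t => f t - h t) = fun t => (f t - g t) + (g t - h t).
  by apply/funext => t; rewrite addrA subrK.
apply: le_trans (defectD_le _ _ _) _; [exact: L2B..|].
have := defect_mono (fun t => g t - h t) (leq_maxl m m').
have := defect_mono (fun t => f t - g t) (leq_maxr m m'); lra.
Qed.

Lemma regular_sum n (c : nat -> C) (F : nat -> T -> C) : (forall i, (i < n)%N -> regular (F i)) ->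
  regular (fun t => \sum_(i < n) c i * F i t).
Proof.
elim: n => [_|n IH rF].
  by under eq_fun do rewrite big_ord0; apply/regular_neg/neg0.
under eq_fun do rewrite big_ord_recr/=; apply: regularD.
  by apply: IH => i ni; apply: rF; rewrite ltnS ltnW.
by apply: regularZ; apply: rF.
Qed.

Lemma neg_e k : neg (@e_ R (Negz k)).
Proof.
exists ('X^(k.+1)); split; first by rewrite hornerXn expr0n.
by apply/funext => t; rewrite hornerXn -e_nat -e_N.
Qed.

Lemma regular_e k : regular (@e_ R (Posz k)).
Proof.
elim/ltn_ind: k => k IH; apply: regular_lim; first exact: L2_e.
move=> e e0; have [q [q0 qe]] := szego_sigma e0.
(* Since [q] has value 1 at 0, [u] is [e_ k] minus [e_ k * conj q] and involves only characters of
   index below [k]. *)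
pose u t := \sum_(i < (size q).-1) (- (q`_i.+1)^*) * e_ (Posz k - Posz i.+1) t.
have E t : e_ (Posz k) t - u t = e_ (Posz k) t * (q.[e_ 1 t])^*.
  have s0 : (0 < size q)%N.
    by rewrite lt0n size_poly_eq0; apply/eqP => q00; move: q0; rewrite q00 horner0 => /eqP; rewrite eq_sym oner_eq0.
  rewrite horner_coef -(prednK s0) big_ord_recl expr0 mulr1 -horner_coef0 q0 /= conjD conj_sum mulrDr.
  rewrite (_ : (1 : C)^* = 1) ?mulr1; last by rewrite -[1 in LHS]/((1:R)%:C) conjR.
  congr (_ + _); rewrite /u -sumrN mulr_sumr; apply: eq_bigr => i _.
  by rewrite mulNr opprK conjM -e_nat e_D e_N; ring.
exists u.
  apply: (@regular_sum _ (fun i => - (q`_i.+1)^*) (fun i => @e_ R (Posz k - Posz i.+1))) => i _.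
  have [ki|ki] := leqP i.+1 k; first by rewrite subzn//; apply: IH; rewrite ltn_subrL /= (leq_trans _ ki).
  rewrite -opprB subzn 1?ltnW//; have : (0 < i.+1 - k)%N by rewrite subn_gt0.
  by case: (_ - _)%N => // j _; rewrite -NegzE; apply/regular_neg/neg_e.
(* With [k.+1] terms the Bessel sum reaches the index [k], whose term is exactly [sigma ^+ 2]; it
   cancels Szego's bound and leaves at most [e]. *)
exists k.+1; under eq_fun do rewrite E; rewrite /defect big_ord_recr/= coef_shift q0.
have -> : n2 (sigma%:C * (1 : C)^*) = sigma ^+ 2.
  by rewrite n2M n2conj n2_1 mulr1 n2C.
have -> : nrm2 mu (fun t => e_ (Posz k) t * (q.[e_ 1 t])^*) = nrm2 mu (fun t => q.[e_ 1 t]).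
  by rewrite /nrm2; apply: eq_Rintegral => t _; rewrite n2M n2_e mul1r n2conj.
have : 0 <= \sum_(l < k) n2 (coef l (fun t => e_ (Posz k) t * (q.[e_ 1 t])^*)).
  by apply: sumr_ge0 => l _; exact: n2_ge0.
by move: qe; move: (nrm2 _ _) (\sum_(_ < _) _) => a b; lra.
Qed.

Lemma regular_poly p : regular (fun t => p.[e_ 1 t]).
Proof.
have -> : (fun t : T => p.[e_ 1 t]) = fun t => \sum_(i < size p) p`_i * e_ (Posz i) t.
  by apply/funext => t; rewrite horner_coef; apply: eq_bigr => i _; rewrite e_nat.
by apply: (@regular_sum _ (fun i => p`_i) (fun i => @e_ R (Posz i))) => i _; exact: regular_e.
Qed.

Lemma conj_polyE p : (fun t : T => (p.[e_ 1 t])^*) = fun t => (p.[0])^* + ((p - (p.[0])%:P).[e_ 1 t])^*.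
Proof. by apply/funext => t; rewrite hornerD hornerN hornerC conjD conjN addrCA subrr addr0. Qed.

Lemma neg_conj_poly p : neg (fun t => ((p - (p.[0])%:P).[e_ 1 t])^*).
Proof. by exists (p - (p.[0])%:P); rewrite hornerD hornerN hornerC subrr. Qed.

Lemma regular_conj_poly p : regular (fun t => (p.[e_ 1 t])^*).
Proof.
rewrite conj_polyE; apply: regularD; last exact/regular_neg/neg_conj_poly.
have := regular_poly ((p.[0])^*)%:P; under eq_fun do rewrite hornerC; exact.
Qed.

Lemma L2_regular f : L2 mu f -> regular f.
Proof.
move=> Lf; have [_ H] := trig_dense Lf; apply: regular_lim => // e /H[p [q pq]].
exists (trig p q); first by apply: regularD; [exact: regular_poly|exact: regular_conj_poly].
by exists 0%N; apply: le_trans pq; exact: defect_le.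
Qed.

Variables (f F : T -> C).
Hypothesis Lf : L2 mu f.
Hypothesis H2F : H2 F.
Hypothesis projF : forall h, H2 h -> ip lambda (fun t => tw f t - F t) h = 0.

Lemma H2_e k : H2 (@e_ R (Posz k)).
Proof. by split; [exact: L2_e|move=> n n0; rewrite fourier_e; case: n n0]. Qed.

Lemma coef_proj l : coef l f = ip lambda F (@e_ R (Posz l)).
Proof.
have [LF _] := H2F.
have /eqP := projF (H2_e l).
by rewrite (ipBl (tw_L2 Lf) LF (L2_e lambda (Posz l))) subr_eq0 => /eqP.
Qed.

Lemma proj_upper e : 0 < e -> exists h, neg h /\ nrm2 mu (fun t => f t - h t) <= nrm2 lambda F + e.
Proof.
move=> e0; have [_ /(_ _ e0)[m [h [nh fh]]]] := L2_regular Lf; exists h; split => //.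
have [LF _] := H2F; have := bessel m LF.
move: fh; rewrite /defect (eq_bigr (fun l : 'I_m => n2 (ip lambda F (@e_ R (Posz l))))); first by lra.
move=> l _; have Lh := neg_L2 mu nh.
have -> : (fun t => f t - h t) = fun t => f t + (-1) * h t by apply/funext => t; rewrite mulN1r.
by rewrite (coefD _ Lf (L2Z (-1) Lh)) coefZ// (coef_neg l nh) mulr0 addr0 coef_proj.
Qed.

(** Split a trigonometric approximant into a polynomial in [e_ 1] and a part with negative
    frequencies. The latter is orthogonal to [F] and to polynomials, so by Pythagoras dropping it
    does not increase the error. *)
Lemma H2_approx e : 0 < e -> exists p, nrm2 lambda (fun t => F t - p.[e_ 1 t]) <= e.
Proof.
move=> e0; have [LF F0] := H2F; have [_ /(_ _ e0)[p [q pq]]] := trig_dense LF.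
pose p' := p + ((q.[0])^*)%:P; exists p'; apply: le_trans pq.
pose r t := ((q - (q.[0])%:P).[e_ 1 t])^*.
have nr : neg r by exact: neg_conj_poly.
have Lr : L2 lambda r by exact: neg_L2.
have Lp : L2 lambda (fun t => p'.[e_ 1 t]) by exact: poly_e_L2.
have LFp : L2 lambda (fun t => F t - p'.[e_ 1 t]) by exact: L2B.
have -> : (fun t => F t - trig p q t) = fun t => (F t - p'.[e_ 1 t]) + (-1) * r t.
  apply/funext => t; have := congr1 (@^~ t) (conj_polyE q); rewrite /trig /= => ->.
  have -> : p'.[e_ 1 t] = p.[e_ 1 t] + (q.[0])^* by rewrite hornerD hornerC.
  by rewrite /r; ring.
have orth : ip lambda (fun t => F t - p'.[e_ 1 t]) r = 0.
  have -> : r = fun t => \sum_(i < (size q).-1) (q`_i.+1)^* * e_ (Negz i) t.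
    apply/funext => t; rewrite /r hornerD hornerN hornerC.
    have [s0|s0] := posnP (size q).
      by rewrite s0 big_ord0; move/eqP: s0; rewrite size_poly_eq0 => /eqP ->; rewrite !horner0 subr0 conjR.
    rewrite horner_coef -(prednK s0) big_ord_recl expr0 mulr1 -horner_coef0 addrC addrA addNr add0r conj_sum.
    by apply: eq_bigr => i _ /=; rewrite conjM -e_nat -e_N.
  rewrite ip_sumr//; last by move=> i; exact: L2_e.
  rewrite big1// => i _; rewrite ipBl//; last exact: L2_e.
  rewrite (_ : ip lambda F _ = 0); last exact: F0.
  have -> : (fun t : T => p'.[e_ 1 t]) = fun t => \sum_(i < size p') p'`_i * e_ (Posz i) t.
    by apply/funext => t; rewrite horner_coef; apply: eq_bigr => j _; rewrite e_nat.
  rewrite ip_suml; [|by move=> j; exact: L2_e|exact: L2_e].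
  by rewrite big1 ?subrr ?mulr0// => j _; rewrite ip_e mulr0.
rewrite (nrm2D LFp (L2Z (-1) Lr)) (ipZr _ Lr LFp) orth mulr0 -[X in Re X]/((0 : R)%:C) ReC mulr0 addr0.
by apply: ler_wpDr; [exact: nrm2_ge0|exact: lexx].
Qed.

Lemma tw_neg_orth h : neg h -> ip lambda (tw h) F = 0.
Proof.
move=> nh; have [LF _] := H2F; have Lh := neg_L2 mu nh; have Lth := tw_L2 Lh.
have Lp p : L2 lambda (fun t => p.[e_ 1 t]) by move=> *; exact: poly_e_L2.
have po p : ip lambda (tw h) (fun t => p.[e_ 1 t]) = 0.
  have -> : (fun t : T => p.[e_ 1 t]) = fun t => \sum_(i < size p) p`_i * e_ (Posz i) t.
    by apply/funext => t; rewrite horner_coef; apply: eq_bigr => j _; rewrite e_nat.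
  rewrite ip_sumr//; last by move=> i; exact: L2_e.
  by rewrite big1// => i _; rewrite -/(coef i h) coef_neg ?mulr0.
apply/eqP; rewrite -n2_eq0 eq_le n2_ge0 andbT; apply/ler_addgt0Pr => e e0; rewrite add0r.
have K0 : 0 < nrm2 lambda (tw h) + 1 by have := nrm2_ge0 lambda (tw h); lra.
have [p hp] := H2_approx (divr_gt0 e0 K0).
have LFp : L2 lambda (fun t => F t - p.[e_ 1 t]) by exact: L2B.
have -> : ip lambda (tw h) F = ip lambda (tw h) (fun t => F t - p.[e_ 1 t]).
  by rewrite ipBr// po subr0.
apply: le_trans (ip_CS Lth LFp) _.
apply: le_trans (_ : (nrm2 lambda (tw h) + 1) * (e / (nrm2 lambda (tw h) + 1)) <= _); last by rewrite mulrC divfK// gt_eqF.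
by apply: ler_pM => //; rewrite ?nrm2_ge0// lerDl.
Qed.

(** As [tw h] is orthogonal to [F], pairing [tw (f - h)] with [F] still gives the squared norm of
    [F]; Cauchy-Schwarz and the contraction [phi_L2] conclude. *)
Lemma proj_lower h : neg h -> nrm2 lambda F <= nrm2 mu (fun t => f t - h t).
Proof.
move=> nh; have [LF _] := H2F; have Lh := neg_L2 mu nh.
have Lfh : L2 mu (fun t => f t - h t) by exact: L2B.
have [Lt le_t] := phi_L2 Lfh; apply: le_trans le_t; rewrite -/(tw _).
have E : ip lambda (tw (fun t => f t - h t)) F = (nrm2 lambda F)%:C.
  have -> : tw (fun t => f t - h t) = fun t => tw f t - tw h t.
    by apply/funext => t; rewrite /tw mulrBl.
  rewrite (ipBl (tw_L2 Lf) (tw_L2 Lh) LF) (tw_neg_orth nh) subr0.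
  have /eqP := projF H2F; rewrite (ipBl (tw_L2 Lf) LF LF).
  by rewrite subr_eq0 => /eqP ->; exact: ip_nrm2.
have := ip_CS Lt LF; rewrite E n2C expr2.
have [->|] := eqVneq (nrm2 lambda F) 0; first by rewrite nrm2_ge0.
by move=> n0; rewrite ler_pM2r// lt_def n0 nrm2_ge0.
Qed.
End prediction.

(** * Determinants *)

Section null_modification.
Context d (T : measurableType d) (R : realType) (mu : {measure set T -> \bar R}).
Import HBNNSimple.

(** A nonnegative integral is a supremum over simple functions below the integrand. Setting such a
    function to 0 on [N] keeps its integral and places it below [g]. *)
Lemma ge0_le_integral_null (f g : T -> \bar R) N : measurable N -> mu N = 0%E ->
  (forall x, 0 <= f x)%E -> (forall x, 0 <= g x)%E -> (forall x, ~ N x -> f x = g x) ->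
  (\int[mu]_x f x <= \int[mu]_x g x)%E.
Proof.
move=> mN N0 f0 g0 fg; rewrite (ge0_integralTE _ f0) (ge0_integralTE _ g0).
apply: ge_ereal_sup => _ [h hf <-]; rewrite -integralT_nnsfun.
pose h' := proj_nnsfun h (measurableC mN).
have h'E x : h' x = h x * \1_(~` N) x by [].
have -> : (\int[mu]_x (h x)%:E = \int[mu]_x (h' x)%:E)%E.
  apply: ae_eq_integral => //; try by apply/measurable_EFinP.
  exists N; split => // x; apply: contra_notP => Nx _.
  by rewrite h'E indicE mem_set// mulr1.
rewrite integralT_nnsfun; apply: ereal_sup_ubound; exists h' => // x.
rewrite h'E indicE; have [Nx|Nx] := pselect (N x).
  by rewrite memNset ?mulr0 ?g0//; exact.
by rewrite mem_set// mulr1 -fg.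
Qed.

Lemma integral_null (f g : T -> \bar R) : {ae mu, forall x, f x = g x} ->
  (\int[mu]_x f x = \int[mu]_x g x)%E.
Proof.
move=> [N [mN N0 sub]]; have fg x : ~ N x -> f x = g x by move=> Nx; apply: contrapT => h; exact/Nx/sub.
rewrite integralE [RHS]integralE; congr (_ - _)%E; apply/eqP; rewrite eq_le; apply/andP; split;
apply: (ge0_le_integral_null mN N0) => // x /fg; rewrite ?funeposE ?funenegE => ->//.
Qed.

(* No measurability is assumed: [varphi w] need not be measurable. *)
Lemma cintegral_null (f g : T -> R[i]) : {ae mu, forall x, f x = g x} ->
  cintegral mu f = cintegral mu g.
Proof.
by move=> fg; rewrite /cintegral /Rintegral; congr (fine _ +i* fine _)%C; apply: integral_null; apply: filterS fg => x ->.
Qed.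
End null_modification.

Section outer_data.
Context (R : realType).
Local Notation T := (circle R).
Local Notation lambda := (@circle_lebesgue R).
Local Notation C := R[i].

(** Supplies in both cases the data of the prediction argument: boundary values of the outer
    function if the logarithm of [w] is integrable, and zeros otherwise, where Szego's constant is 0
    too. *)
Lemma outer_exists (mu : {finite_measure set T -> \bar R}) (w : T -> R) : is_ac_density mu w ->
  exists (phi : T -> C) (sigma : R),
  [/\ cmeas phi, L2 lambda phi, {ae lambda, forall t, varphi w t = phi t},
   forall k, cintegral lambda (fun t => phi t * e_ (Posz k) t) = if k == 0%N then sigma%:C else 0 &
   ({ae lambda, forall t, n2 (phi t) = w t} \/ phi = fun=> 0) /\ sigma ^+ 2 = szego_cst w].
Proof.
move=> hw; have [mw w0 _] := hw; have rw := ac_density_rint hw.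
have [iw|niw] := pselect (lambda.-integrable setT (fun s => lne (w s)%:E)).
  have [phi [mp vp np rl fp]] := varphi_spec mw w0 rw iw.
  exists phi, (expR (2^-1 * \int[lambda]_t ln (w t))); split => //.
    apply/L2P; split => //; apply: ae_rint rw; first exact: cmeas_n2.
    by apply: filterS np => t ->.
  split; first by left.
  by rewrite /szego_cst asboolT// -expRM_natl; congr expR; field.
exists (fun=> 0), 0; split.
- exact: cmeas_cst.
- exact: L2_0.
- by apply: aeW => t; rewrite /varphi asboolF.
- move=> k; rewrite if_same; under eq_cintegral do rewrite mul0r; exact: cintegral0.
- by split; [right|rewrite /szego_cst asboolF// expr0n].
Qed.
End outer_data.

(** * Gram matrices and residuals of finite-dimensional projections *)

Section gram.
Context (R : realType).
Local Notation T := (circle R).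
Local Notation lambda := (@circle_lebesgue R).
Local Notation C := R[i].
Variable mu : {finite_measure set T -> \bar R}.
Implicit Types (f g h : T -> C).

Lemma neg_sum n (c : 'I_n -> C) (F : 'I_n -> T -> C) : (forall i, neg (F i)) ->
  neg (fun t => \sum_(i < n) c i * F i t).
Proof.
elim: n c F => [|n IH] c F nF; first by under eq_fun do rewrite big_ord0; exact: neg0.
by under eq_fun do rewrite big_ord_recr/=; apply: negD; [exact: IH|exact: negZ].
Qed.

Section fixed_size.
Variable n : nat.

Definition ebase (a : nat) : T -> C := e_ (a%:Z - n%:Z).
Definition gram : 'M[C]_n := \matrix_(a, b) ip mu (ebase a) (ebase b).
(** The solution of the normal equations, in row form; [gram_unit] makes [invmx] a genuine
    inverse. *)
Definition pcoef f : 'rV[C]_n := (\row_b ip mu f (ebase b)) *m invmx gram.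
Definition pr f t : C := \sum_(a < n) pcoef f 0 a * ebase a t.
Definition res f t : C := f t - pr f t.

Lemma ebase_neg (a : 'I_n) : neg (ebase a).
Proof.
rewrite /ebase -opprB subzn 1?ltnW//; have : (0 < n - a)%N by rewrite subn_gt0.
by case: (n - a)%N => // k _; rewrite -NegzE; exact: neg_e.
Qed.

Lemma ebase_L2 a : L2 mu (ebase a). Proof. exact: L2_e. Qed.
Hint Resolve ebase_L2 : core.

Lemma pr_neg f : neg (pr f).
Proof. by apply: neg_sum => a; exact: ebase_neg. Qed.

Lemma pr_L2 f : L2 mu (pr f). Proof. exact/neg_L2/pr_neg. Qed.

Lemma res_L2 f : L2 mu f -> L2 mu (res f).
Proof. by move=> Lf; apply: L2B => //; exact: pr_L2. Qed.

(** [n] is a successor because at 0 the Gram matrix is empty while [toeplitz_det mu 0.-1] is still a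
    1 by 1 determinant. *)
Lemma gram_toeplitz m : n = m.+1 -> \det gram = toeplitz_det mu n.-1.
Proof.
move=> nE; rewrite /toeplitz_det /gram; move: n nE => k kE; subst k => /=.
congr (\det _); apply/matrixP => a b; rewrite !mxE /ip /measure_coef; apply: eq_cintegral => t.
by rewrite /ebase -e_N -e_D; congr (e_ _ _); ring.
Qed.

Lemma pr_span (v : 'rV[C]_n) f : L2 mu f ->
  ip mu (fun t => \sum_(a < n) v 0 a * ebase a t) f = \sum_(a < n) v 0 a * ip mu (ebase a) f.
Proof. by move=> Lf; rewrite ip_suml. Qed.

(** A null vector gives a trigonometric polynomial of norm 0. The open set where it does not vanish
    is then [mu]-null, so the support lies among its zeros, which are finitely many because [e_ 1]
    maps them injectively to roots of [p]. *)
Lemma gram_unit : infinite_set (msupport mu) -> gram \in unitmx.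
Proof.
move=> hmu; rewrite unitmxE unitfE; apply/negP => /det0P[v v0 vA].
pose h t := \sum_(a < n) v 0 a * ebase a t.
have Lh : L2 mu h by apply: L2_sum => a; apply: L2Z.
have h0 : nrm2 mu h = 0.
  suff : ip mu h h = 0 by rewrite ip_nrm2 => /(congr1 (@complex.Re R)).
  rewrite {2}/h ip_sumr// big1// => b _; rewrite pr_span//.
  have := congr1 (fun M : 'rV_n => M 0 b) vA; rewrite !mxE => vAb.
  by rewrite (_ : \sum_(a < n) _ = 0) ?mulr0// -[RHS]vAb; apply: eq_bigr => a _; rewrite !mxE.
pose p : {poly C} := \poly_(i < n) (if insub i is Some a then v 0 a else 0).
have pv (a : 'I_n) : p`_a = v 0 a by rewrite coef_poly ltn_ord valK.
have p0 : p != 0.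
  by apply: contraNneq v0 => p0; apply/eqP/rowP => a; rewrite mxE -pv p0 coef0.
have hp t : n2 (h t) = n2 p.[e_ 1 t].
  have -> : h t = e_ (- n%:Z) t * p.[e_ 1 t]; last by rewrite n2M n2_e mul1r.
  rewrite (horner_coef_wide _ (size_poly _ _)) mulr_sumr; apply: eq_bigr => a _.
  by rewrite -/p pv /ebase -e_nat [RHS]mulrCA -e_D addrC.
have cp (q : {poly C}) : continuous (fun x : R => Re q.[e_ 1 (circle_pi x)]) /\
    continuous (fun x : R => Im q.[e_ 1 (circle_pi x)]).
  elim/poly_ind: q => [|q c [IH1 IH2]].
    by under eq_fun do rewrite horner0; split; [|under eq_fun do rewrite horner0] => x; exact: cvg_cst.
  have [c1 c2] := cont_e_pi R 1; split => x.
    under eq_fun do rewrite hornerMXaddC ReD ReM.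
    by apply: cvgD; [apply: cvgB; apply: cvgM; [exact: IH1|exact: c1|exact: IH2|exact: c2]|exact: cvg_cst].
  under eq_fun do rewrite hornerMXaddC ImD ImM.
  by apply: cvgD; [apply: cvgD; apply: cvgM; [exact: IH1|exact: c2|exact: IH2|exact: c1]|exact: cvg_cst].
pose U : set T := [set t | p.[e_ 1 t] != 0].
have oU : open U.
  rewrite circle_open_pi; have -> : (@circle_pi R) @^-1` U =
      (fun x : R => n2 p.[e_ 1 (circle_pi x)]) @^-1` [set y | y != 0].
    by apply/seteqP; split => x /=; rewrite n2_eq0.
  apply: open_comp => [x _|]; last exact: open_neq.
  by have [c1 c2] := cp p; apply: cvgD; apply: cvgM; [exact: c1|exact: c1|exact: c2|exact: c2].
have muU : mu U = 0%E.
  have mU := circle_measurable_open oU.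
  have rh := L2_n2 Lh; have mh : measurable_fun setT (EFin \o (fun t => n2 (h t))) by apply/measurable_EFinP; exact: (rint_meas rh).
  have : (\int[mu]_t `|(EFin \o (fun t => n2 (h t))) t| = 0)%E.
    rewrite -[RHS]/((0 : R)%:E) -h0 /nrm2 /Rintegral fineK ?(integrable_fin_num measurableT rh)//.
    by apply: eq_integral => t _ /=; rewrite ger0_norm ?n2_ge0.
  move/(ae_eq_integral_abs mu measurableT mh) => [N [mN N0 sub]].
  apply/eqP; rewrite eq_le measure_ge0 andbT -N0; apply: le_measure; rewrite ?inE// => t Ut; apply: sub => /=.
  by move=> /(_ I) [] /eqP; rewrite hp n2_eq0; apply/negP.
have suppU : msupport mu `<=` ~` U.
  by move=> t st Ut; have := st U oU Ut; rewrite muU ltxx.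
have [B sB nB] := infinite_set_fset (size p) hmu.
have := @max_poly_roots _ p [seq e_ 1 t | t <- finmap.enum_fset B] p0; rewrite size_map ltnNge nB => H.
suff : false by []; apply: H; last by rewrite map_inj_uniq ?finmap.fset_uniq//; exact: e_1_inj.
by apply/allP => _ /mapP[t tB ->]; have := suppU _ (sB _ tB); rewrite /U /= => /negP; rewrite negbK.
Qed.

Hypothesis gU : gram \in unitmx.

Lemma pr_orth f (b : 'I_n) : L2 mu f -> ip mu (res f) (ebase b) = 0.
Proof.
move=> Lf; rewrite /res ipBl//; last exact: pr_L2.
apply/eqP; rewrite subr_eq0 eq_sym; apply/eqP; rewrite /pr pr_span//.
have -> : \sum_(a < n) pcoef f 0 a * ip mu (ebase a) (ebase b) = (pcoef f *m gram) 0 b.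
  by rewrite mxE; apply: eq_bigr => a _; rewrite !mxE.
by rewrite /pcoef -mulmxA mulVmx// mulmx1 mxE.
Qed.

Lemma res_orth f (v : 'rV[C]_n) : L2 mu f ->
  ip mu (res f) (fun t => \sum_(a < n) v 0 a * ebase a t) = 0.
Proof.
move=> Lf; rewrite ip_sumr//; last exact: res_L2.
by rewrite big1// => a _; rewrite pr_orth// mulr0.
Qed.

Lemma res_ip f g : L2 mu f -> L2 mu g -> ip mu (res f) g = ip mu (res f) (res g).
Proof.
move=> Lf Lg; rewrite /res [RHS]ipBr//; [|exact: pr_L2|exact: res_L2].
by rewrite [X in _ - X]res_orth// subr0.
Qed.

Lemma res_min f (v : 'rV[C]_n) : L2 mu f ->
  nrm2 mu (res f) <= nrm2 mu (fun t => f t - \sum_(a < n) v 0 a * ebase a t).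
Proof.
move=> Lf; pose u : 'rV[C]_n := pcoef f - v.
have Lu : L2 mu (fun t => \sum_(a < n) u 0 a * ebase a t) by apply: L2_sum => a; exact: L2Z.
have -> : (fun t => f t - \sum_(a < n) v 0 a * ebase a t) = fun t => res f t + \sum_(a < n) u 0 a * ebase a t.
  apply/funext => t; rewrite /res /pr -addrA; congr (_ + _); rewrite addrC -sumrB -sumrN.
  by apply: eq_bigr => a _; rewrite /u !mxE; ring.
rewrite (nrm2D (res_L2 Lf) Lu).
by rewrite res_orth// -[X in Re X]/((0 : R)%:C) ReC mulr0 addr0 lerDl nrm2_ge0.
Qed.

Lemma resD f g : L2 mu f -> L2 mu g -> res (fun t => f t + g t) =1 fun t => res f t + res g t.
Proof.
move=> Lf Lg t; rewrite /res /pr addrACA -opprD -big_split/=; congr (_ - _).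
apply: eq_bigr => a _; rewrite -mulrDl; congr (_ * _).
have -> : pcoef (fun t => f t + g t) = pcoef f + pcoef g; last by rewrite mxE.
by rewrite /pcoef -mulmxDl; congr (_ *m _); apply/rowP => b; rewrite !mxE ipDl.
Qed.

Lemma resZ c f : L2 mu f -> res (fun t => c * f t) =1 fun t => c * res f t.
Proof.
move=> Lf t; rewrite /res /pr mulrBr mulr_sumr; congr (_ - _).
apply: eq_bigr => a _; rewrite [RHS]mulrA; congr (_ * _).
have -> : pcoef (fun t => c * f t) = c *: pcoef f; last by rewrite mxE.
by rewrite /pcoef scalemxAl; congr (_ *m _); apply/rowP => b; rewrite !mxE ipZl.
Qed.

Lemma schur r (f g : 'I_r -> T -> C) : (forall j, L2 mu (f j)) -> (forall j, L2 mu (g j)) ->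
  \det (block_mx gram (\matrix_(a, k) ip mu (ebase a) (g k))
    (\matrix_(j, b) ip mu (f j) (ebase b)) (\matrix_(j, k) ip mu (f j) (g k))) =
  \det gram * \det (\matrix_(j, k) ip mu (res (f j)) (g k)).
Proof.
move=> Lf Lg; set B := \matrix_(a, k) _; set D := \matrix_(j, b) _; set E := \matrix_(j, k) ip mu (f j) (g k).
have -> : block_mx gram B D E =
    block_mx 1%:M 0 (D *m invmx gram) 1%:M *m block_mx gram B 0 (E - D *m invmx gram *m B).
  rewrite mulmx_block !mul1mx !mul0mx !addr0 mulmxKV//.
  by rewrite addrC subrK.
rewrite det_mulmx det_lblock det_ublock !det1 !mul1r; congr (_ * \det _).
apply/matrixP => j k; rewrite !mxE /res ipBl//; last exact: pr_L2.
congr (_ - _); rewrite /pr pr_span//; apply: eq_bigr => a _; rewrite !mxE; congr (_ * _).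
by apply: eq_bigr => b _; rewrite /D !mxE.
Qed.
End fixed_size.

Lemma neg_ebase h : neg h -> exists n0, forall n, (n0 <= n)%N -> exists v : 'rV[C]_n,
  h = fun t => \sum_(a < n) v 0 a * ebase n a t.
Proof.
move=> [p [p0 ->]]; exists (size p) => n sn.
exists (\row_a (p`_(n - a))^*); apply/funext => t.
rewrite (horner_coef_wide _ (leqW sn)) big_ord_recl -horner_coef0 p0 mul0r add0r conj_sum.
rewrite (reindex_inj rev_ord_inj); apply: eq_bigr => a _ /=.
rewrite mxE /bump add1n subnSK// conjM -e_nat -e_N /ebase; congr (_ * e_ _ _).
by rewrite -subzn 1?ltnW// opprB.
Qed.

Hypothesis hmu : infinite_set (msupport mu).

Section limits.
Variables (phi : T -> C) (sigma : R).
Hypothesis Lphi : L2 lambda phi.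
Hypothesis phi_coef : forall k, cintegral lambda (fun t => phi t * e_ (Posz k) t) = if k == 0%N then sigma%:C else 0.
Hypothesis phi_L2 : forall f, L2 mu f ->
  L2 lambda (fun t => f t * (phi t)^*) /\ nrm2 lambda (fun t => f t * (phi t)^*) <= nrm2 mu f.
Hypothesis szego_sigma : forall e, 0 < e -> exists p, p.[0] = 1 /\
  nrm2 mu (fun t => p.[e_ 1 t]) <= sigma ^+ 2 + e.

Definition projects f F := [/\ L2 mu f, H2 F &
  forall h, H2 h -> ip lambda (fun t => tw phi f t - F t) h = 0].

Lemma projectsD f g F G : projects f F -> projects g G ->
  projects (fun t => f t + g t) (fun t => F t + G t).
Proof.
move=> [Lf [LF F0] fF] [Lg [LG G0] gG]; split; first exact: L2D.
  split; first exact: L2D.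
  move=> n n0; have Le := L2_e lambda n.
  change (ip lambda (fun t => F t + G t) (e_ n) = 0).
  by rewrite ipDl// [ip _ F _]F0// [ip _ G _]G0// addr0.
move=> h Hh; have [Lh _] := Hh.
have [Ltf _] := phi_L2 Lf; have [Ltg _] := phi_L2 Lg.
have h1 := fF h Hh; have h2 := gG h Hh; rewrite (ipBl Ltf LF Lh) in h1; rewrite (ipBl Ltg LG Lh) in h2.
rewrite twD (ipBl (L2D Ltf Ltg) (L2D LF LG) Lh) (ipDl Ltf Ltg Lh) (ipDl LF LG Lh).
by rewrite opprD addrACA h1 h2 addr0.
Qed.

Lemma projectsZ c f F : projects f F -> projects (fun t => c * f t) (fun t => c * F t).
Proof.
move=> [Lf [LF F0] fF]; split; first exact: L2Z.
  split; first exact: L2Z.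
  move=> n n0; have Le := L2_e lambda n.
  change (ip lambda (fun t => c * F t) (e_ n) = 0).
  by rewrite ipZl// [ip _ F _]F0// mulr0.
move=> h Hh; have [Lh _] := Hh; have [Lt _] := phi_L2 Lf.
have -> : (fun t => tw phi (fun t => c * f t) t - c * F t) = fun t => c * (tw phi f t - F t).
  by apply/funext => t; rewrite /tw; ring.
by rewrite ipZl ?fF ?mulr0//; exact: L2B.
Qed.

(** The residual minimises the distance to a span that contains the near-optimal [h] of [proj_upper]
    once [n] is large, while [proj_lower] bounds it below for every [n]. *)
Lemma res_nrm2_cvg f F : projects f F -> nrm2 mu (res n f) @[n --> \oo] --> nrm2 lambda F.
Proof.
move=> [Lf HF fF]; apply/cvgrPdist_le => e e0.
have [h [nh hle]] := proj_upper Lphi phi_coef phi_L2 szego_sigma Lf HF fF e0.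
have [n0 hn] := neg_ebase nh; exists n0 => // n /= n0n.
have [v hv] := hn n n0n.
have gU := gram_unit n hmu.
have lo := proj_lower Lphi phi_coef phi_L2 Lf HF fF (pr_neg n f).
have up : nrm2 mu (res n f) <= nrm2 mu (fun t => f t - h t) by rewrite hv; exact: res_min.
by rewrite distrC ger0_norm ?subr_ge0// lerBlDl (le_trans up).
Qed.

Lemma res_ip_cvg f g F G : projects f F -> projects g G ->
  ccvg \oo (fun n => ip mu (res n f) g) (ip lambda F G).
Proof.
move=> pf pg; have [Lf [LF _] _] := pf; have [Lg [LG _] _] := pg.
(* Polarization with a free scalar: [c = 1] returns the real part and [c = i] the imaginary part. *)
have key c : Re (c^* * ip mu (res n f) g) @[n --> \oo] --> Re (c^* * ip lambda F G).
  have pfg := projectsD pf (projectsZ c pg).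
  have h1 := res_nrm2_cvg pfg; have h2 := res_nrm2_cvg pf; have h3 := res_nrm2_cvg pg.
  have E d (S : measurableType d) (nu : {measure set S -> \bar R}) (u v : S -> C) : L2 nu u -> L2 nu v ->
      Re (c^* * ip nu u v) = 2^-1 * (nrm2 nu (fun t => u t + c * v t) - nrm2 nu u - n2 c * nrm2 nu v).
    by move=> Lu Lv; rewrite nrm2D ?nrm2Z ?ipZr//; [field|exact: L2Z].
  rewrite E//.
  have -> : (fun n => Re (c^* * ip mu (res n f) g)) = fun n => 2^-1 *
     (nrm2 mu (res n (fun t => f t + c * g t)) - nrm2 mu (res n f) - n2 c * nrm2 mu (res n g)).
    apply/funext => n; have gU := gram_unit n hmu.
    rewrite res_ip// E; [|exact: res_L2..]; congr (_ * (_ - _ - _)).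
    apply: eq_Rintegral => t _; rewrite resD//; last exact: L2Z.
    by rewrite resZ.
  apply: cvgMr; apply: cvgB; first exact: cvgB.
  exact: cvgMr.
split.
  have := key 1; have c1 (z : C) : (1 : C)^* * z = z by rewrite -[1 : C]/((1 : R)%:C) conjR mul1r.
  by under eq_fun do rewrite c1; rewrite c1.
have ci (z : C) : Re (((0 : R) +i* 1)%C^* * z) = Im z by rewrite !partsE; ring.
by have := key ((0 : R) +i* 1)%C; under eq_fun do rewrite ci; rewrite ci.
Qed.
End limits.
End gram.

(** * Passage to the limit in the determinants *)

Section determinant_limit.
Context (R : realType).
Local Notation C := R[i].

Lemma ccvg_sum (I : Type) (F : set_system I) (FF : ProperFilter F) (J : Type) (s : seq J)
  (P : pred J) (x : J -> I -> C) (l : J -> C) :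
  (forall j, ccvg F (x j) (l j)) -> ccvg F (fun i => \sum_(j <- s | P j) x j i) (\sum_(j <- s | P j) l j).
Proof.
move=> xl; elim: s => [|j s IH].
  by rewrite big_nil; under eq_fun do rewrite big_nil; exact: ccvg_cst.
rewrite big_cons; under eq_fun do rewrite big_cons; case: ifP => // _.
have [a1 a2] := xl j; case: IH => b1 b2; split.
  by rewrite ReD; under eq_fun do rewrite ReD; exact: cvgD.
by rewrite ImD; under eq_fun do rewrite ImD; exact: cvgD.
Qed.

Lemma ccvg_prod (I : Type) (F : set_system I) (FF : ProperFilter F) (J : Type) (s : seq J)
  (P : pred J) (x : J -> I -> C) (l : J -> C) :
  (forall j, ccvg F (x j) (l j)) -> ccvg F (fun i => \prod_(j <- s | P j) x j i) (\prod_(j <- s | P j) l j).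
Proof.
move=> xl; elim: s => [|j s IH].
  by rewrite big_nil; under eq_fun do rewrite big_nil; exact: ccvg_cst.
rewrite big_cons; under eq_fun do rewrite big_cons; case: ifP => // _.
exact: ccvgM.
Qed.

Lemma ccvg_det (I : Type) (F : set_system I) (FF : ProperFilter F) n
  (A : I -> 'M[C]_n) (L : 'M[C]_n) :
  (forall j k, ccvg F (fun i => A i j k) (L j k)) -> ccvg F (fun i => \det (A i)) (\det L).
Proof.
move=> AL; apply: ccvg_sum => s; apply: ccvgM; first exact: ccvg_cst.
by apply: ccvg_prod => j; exact: AL.
Qed.

Lemma extend_neg r (f : 'I_r.+1 -> circle R -> C) (z : int) : z < 0 -> extend f z = e_ z.
Proof. by case: z. Qed.

Lemma extend_pos r (f : 'I_r.+1 -> circle R -> C) (j : 'I_r.+1) : extend f j%:Z = f j.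
Proof. by rewrite /extend inord_val. Qed.

Lemma extend_block (mu : {finite_measure set (circle R) -> \bar R}) n r (f g : 'I_r.+1 -> circle R -> C) :
  \matrix_(j < n + r.+1, k < n + r.+1)
    cintegral mu (fun t => extend f (j%:Z - n%:Z) t * (extend g (k%:Z - n%:Z) t)^* ) =
  block_mx (gram mu n) (\matrix_(a, k) ip mu (ebase n a) (g k))
    (\matrix_(j, b) ip mu (f j) (ebase n b)) (\matrix_(j, k) ip mu (f j) (g k)).
Proof.
have lt0 (a : 'I_n) : a%:Z - n%:Z < 0 by rewrite subr_lt0 ltz_nat.
have rE (j : 'I_r.+1) : (n + j)%N%:Z - n%:Z = j%:Z by rewrite PoszD addrAC subrr add0r.
rewrite -[LHS]submxK; congr block_mx; apply/matrixP => a b; rewrite !mxE /=.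
- by rewrite !extend_neg.
- by rewrite extend_neg// rE extend_pos.
- by rewrite rE extend_pos extend_neg.
- by rewrite !rE !extend_pos.
Qed.
End determinant_limit.

Theorem theorem3p1 (R : realType)
  (mu : {finite_measure set (circle R) -> \bar R})
  (hmu : infinite_set (msupport mu))
  (w : circle R -> R) (hw : is_ac_density mu w)
  (r : nat) (f g : 'I_r.+1 -> circle R -> R[i])
  (hf : forall j, L2 mu (f j)) (hg : forall j, L2 mu (g j))
  (F G : 'I_r.+1 -> circle R -> R[i])
  (hF : forall j, is_proj_H2 (fun t => f j t * (varphi w t)^* ) (F j))
  (hG : forall j, is_proj_H2 (fun t => g j t * (varphi w t)^* ) (G j)) :
  (fun n : nat => (toeplitz_det mu n.-1)^-1 *
     \det (\matrix_(j < n + r.+1, k < n + r.+1)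
       cintegral mu (fun t => extend f (j%:Z - n%:Z) t *
                              (extend g (k%:Z - n%:Z) t)^* )))
    @ \oo -->
  (\det (\matrix_(j < r.+1, k < r.+1)
     cintegral (@circle_lebesgue R) (fun t => F j t * (G k t)^* ))
   : (R[i] : numFieldType)).
Proof.
have [phi [sigma [mp Lphi vp pc [np sE]]]] := outer_exists hw.
have phi_L2 h : L2 mu h -> _ := ac_density_n2 hw mp np.
have sz e : 0 < e -> exists p, p.[0] = 1 /\ nrm2 mu (fun t => p.[e_ 1 t]) <= sigma ^+ 2 + e.
  by rewrite sE; exact: szego.
(* The projections are given for [varphi w], which agrees almost everywhere with the measurable
   [phi]; the orthogonality relations do not see the difference. *)
have pr (k : 'I_r.+1 -> circle R -> R[i]) K : (forall j, L2 mu (k j)) ->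
    (forall j, is_proj_H2 (fun t => k j t * (varphi w t)^* ) (K j)) ->
    forall j, projects mu phi (k j) (K j).
  move=> Lk kK j; have [HK orth] := kK j; split => // h Hh; rewrite -[RHS](orth h Hh).
  by apply: cintegral_null; apply: filterS vp => t ->.
apply: ccvg_cvg.
have lim : ccvg \oo (fun n => \det (\matrix_(j, k) ip mu (res mu n (f j)) (g k)))
    (\det (\matrix_(j < r.+1, k < r.+1) cintegral (@circle_lebesgue R) (fun t => F j t * (G k t)^* ))).
  apply: ccvg_det => j k; rewrite mxE; under eq_fun do rewrite mxE.
  exact: (res_ip_cvg hmu Lphi pc phi_L2 sz (pr f F hf hF j) (pr g G hg hG k)).
have E : \forall n \near \oo, \det (\matrix_(j, k) ip mu (res mu n (f j)) (g k)) =
   (toeplitz_det mu n.-1)^-1 *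
     \det (\matrix_(j < n + r.+1, k < n + r.+1)
       cintegral mu (fun t => extend f (j%:Z - n%:Z) t * (extend g (k%:Z - n%:Z) t)^* )).
  (* The identity of determinants is claimed from [n = 1] on, where [n.-1] is the true
     predecessor. *)
  exists 1%N => // -[//|n] _; have gU := gram_unit n.+1 hmu.
  rewrite extend_block (schur gU hf hg) -(gram_toeplitz mu (erefl n.+1)) mulKf//.
case: lim => l1 l2; split.
- by apply: cvg_trans l1; apply: near_eq_cvg; apply: filterS E => n /= ->.
- by apply: cvg_trans l2; apply: near_eq_cvg; apply: filterS E => n /= ->.
Qed.
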